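(* Let $\mathcal T$ be a minimally complete abstract Newton tree at infinity. Choose $z\in\mathrm{In}(\mathcal T)$ and consider $\overline{\mathcal O}=\overline{\mathcal O}(\mathcal T,z)$. (a) $|\overline{\mathcal O}|+\sum_{C\in\overline{\mathcal O}\setminus\{C_0\}}\dot c(C)\le 1+\max\big(0,\widetilde\Delta(\mathcal N)\big)$. (When $\overline{\mathcal O}=\emptyset$, $C_0$ is not defined and the sum is empty.) (b) If $|\mathcal N|>1$ and $|\overline{\mathcal O}|\ge\widetilde\Delta(\mathcal N)$ then $\Omega(\mathcal T)\ne\emptyset$.
   Context: **Decorated rooted trees.** A rooted tree is a finite tree with set of cells $X_0$, edges (2-element subsets of $X_0$) and a root $v_0\in X_0$; $\delta_x$ is the valency of $x$, and $\gamma_{x,y}$ the unique path from $x$ to $y$. Arrows: $\mathcal A=\{x:\delta_x=1\}\setminus\{v_0\}$; vertices: $\mathcal V=X_0\setminus\mathcal A$. For distinct $x,y$, $x<y$ means that $x$ is on $\gamma_{v_0,y}$. In a decorated rooted tree, each arrow is decorated by $(0)$ or $(1)$ ($\mathcal A_0$ = set of arrows decorated by $(0)$), and each pair $(e,x)$ with $e$ an edge and $x\in e$ carries an integer $q(e,x)$ (decoration of $e$ near $x$). $Q(e,x)=\prod q(e',x)$ over edges $e'\ne e$ incident to $x$ (empty products are $1$). For an edge $e=\{x,y\}$ with $x,y\in\mathcal V$, $\det(e)=q(e,x)q(e,y)-Q(e,x)Q(e,y)$. A dead end is an edge incident to an element of $\mathcal A_0$. **Abstract Newton tree at infinity**: a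 decorated rooted tree such that (1) for each $v\in\mathcal V$ some $\alpha\in\mathcal A\setminus\mathcal A_0$ satisfies $\alpha>v$; (2) at most one dead end is incident to a given vertex; (3) $q(e,v_0)=1$ for all edges $e$ incident to $v_0$; (4) $q(e,\alpha)=1$ for every edge $e$ incident to an arrow $\alpha$; (5) for $v\in\mathcal V$ and distinct edges $e,e'$ incident to $v$, $q(e,v)$ and $q(e',v)$ are coprime; with $E_v^+$ the set of edges $\{v,x\}$ with $v<x$, $q(e,v)\ge1$ for all $e\in E_v^+$, at most one $e\in E_v^+$ has $q(e,v)>1$, and if a dead end $\epsilon$ is incident to $v$ then $q(\epsilon,v)=\max_{e\in E_v^+}q(e,v)$; (6) $\det(e)<0$ for every edge $e$ joining two vertices. For $v\in\mathcal V$, $\alpha\in\mathcal A\setminus\mathcal A_0$: $x_{v,\alpha}$ is the product of $q(\epsilon,u)$ over all edges $\epsilon$ not in $\gamma_{v,\alpha}$ but incident to a cell $u$ of $\gamma_{v,\alpha}$; $N_v=\sum_{\alpha\in\mathcal A\setminus\mathcal A_0}x_{v,\alpha}$. A dicritical vertex is a vertex with $N_v=0$. The tree is **minimally complete** if (i) $N_v\ge0$ for all $v\in\mathcal V$ and each arrow decorated by $(1)$ is adjacent to a dicritical vertex; (ii) a dead end is incident to each dicritical vertex; (iii) if a dead end $e$ incident to a vertex $v$ has $q(e,v)=1$ then $v$ is dicritical; (iv) every vertex $\ne v_0$ has valency $\ne2$. **Notation.** $\mathcal N=\{v\in\mathcal V:N_v>0\}$ (a subtree containing $v_0$; an edge of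 $\mathcal N$ is an edge with both endpoints in $\mathcal N$). $\mathcal D_v$: set of dicritical vertices adjacent to $v$. Degree $d_u$ of a dicritical $u$: number of $(1)$-arrows adjacent to $u$. For a dicritical $u$, $k_u=-\det(\{u,v\})$ where $v$ is the unique vertex adjacent to $u$ (one has $v\in\mathcal N$). $v\in\mathcal N$ is a node if $\mathcal D_v\neq\emptyset$. $a_v=q(e,v)$ if a dead end $e$ is incident to $v$, $a_v=1$ otherwise. $r_v=-1+$ (number of vertices adjacent to $v$). $\epsilon(v)$: number of elements of $\mathcal N$ adjacent to $v$. For $v\in\mathcal N$: $\widetilde\Delta(v)=(r_v-1)(N_v-1)+N_v(1-\frac1{a_v})-\sum_{u\in\mathcal D_v}(d_u-1)$, and $\widetilde\Delta(S)=\sum_{v\in S}\widetilde\Delta(v)$ for $S\subseteq\mathcal N$. $d(v)=N_v$ if $v$ is not a node, $d(v)=\gcd\{d_u:u\in\mathcal D_v\}$ if $v$ is a node. **Characteristic numbers.** $P$ is the set of pairs $(u,e)$ with $u\in\mathcal N$ and $e$ an edge of $\mathcal N$ incident to $u$; $(u',e')\prec(u,e)$ iff $\gamma_{u',u}$ contains $e$ but not $e'$. Let $(u,e)\in P$, $e=\{u,u_0\}$. If $\epsilon(u_0)=1$, $c(u,e)=d(u_0)/a_{u_0}$. Otherwise, with $u,u_1,\dots,u_n$ the elements of $\mathcal N$ adjacent to $u_0$ and $e_i=\{u_0,u_i\}$, $c(u,e)=\gcd(d(u_0),c(u_0,e_1),\dots,c(u_0,e_n))/a_{u_0}$, where the gcd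 of rationals is the nonnegative generator of the $\mathbb Z$-module they generate. $M(u,e)=N_u/c(u,e)$. For $A$ a set of edges of $\mathcal N$ incident to $u$, $R(u,A)=\sum_{x\in\mathcal D_u}(1-\frac1{k_x})+(1-\frac1{a_u})+\sum_{e\in A}(1-\frac1{M(u,e)})$. **Teeth, skeleton.** A $\widetilde\Delta$-trivial path is a path $(z_1,\dots,z_n)$ in $\mathcal N$ with $n>1$, $\epsilon(z_1)=1$, and $\epsilon(z_i)=2$, $\widetilde\Delta(z_i)=0$ for $1<i<n$. $Z=\{z\in\mathcal N:\epsilon(z)=1,\widetilde\Delta(z)\le0\}$. $\Gamma$: set of $\widetilde\Delta$-trivial paths with $\widetilde\Delta(z_1)\le0<\widetilde\Delta(\{z_1,\dots,z_n\})$ and $z_{n-1}>z_n$. $W$: set of last vertices $z_n$ of elements of $\Gamma$. For $w\in W$, $V(w)=\{v:\gamma_{v,w}\in\Gamma\}$ and $\bar V(w)$ is the set of all vertices on the paths $\gamma_{v,w}$, $v\in V(w)$; for $w\in\mathcal N\setminus W$, $V(w)=\emptyset$ and $\bar V(w)=\{w\}$. $(u,e)\in P$ is a tooth if there is $(z_1,\dots,z_n)\in\Gamma$ with $z_n=u$ and $\{z_n,z_{n-1}\}=e$. $\Omega(\mathcal T)=Z\setminus\bigcup_{w\in W}V(w)$. Skeleton: $S(\mathcal T)=\mathcal N\setminus\bigcup_{w\in W}(\bar V(w)\setminus\{w\})$, a subtree of $\mathcal N$. **Combs.** $(u,e)\in P$ is a comb over $(u',e')\in P$ if $(u,e)\succeq(u',e')$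 and every $(v,f)\in P$ with $(u,e)\succ(v,f)\succeq(u',e')$ satisfies: $\epsilon(v)\in\{2,3\}$; if $\epsilon(v)=2$ then $R(v,\{f\})<1$; if $\epsilon(v)=3$ then $R(v,\{f\})=0$ and $(v,g)$ is a tooth, where $g$ is the unique edge of $\mathcal N$ incident to $v$, not in $\gamma_{u,v}$ and distinct from $f$. On $P_S=\{(u,e)\in P:u\in S(\mathcal T)\}$ the relation $\sim$ (''one of the two is a comb over the other'') is an equivalence relation whose classes are totally ordered by $\preceq$. **The decomposition.** $\delta^*(v)$: number of edges of $\mathcal N$ incident to $v$ that are contained in no $\gamma\in\Gamma$. $\mathrm{In}(\mathcal T)=\Omega(\mathcal T)$ if $\Omega(\mathcal T)\ne\emptyset$, and $\mathrm{In}(\mathcal T)=\{z\in S(\mathcal T):\delta^*(z)\le1\}$ otherwise; it is nonempty. Given $z\in\mathrm{In}(\mathcal T)$: for $u\in S(\mathcal T)\setminus\{z\}$ let $e_u$ be the edge of $\gamma_{u,z}$ incident to $u$; $\mathcal O(\mathcal T,z)=\{(u,e_u):u\in S(\mathcal T)\setminus\{z\}\}$; $\overline{\mathcal O}(\mathcal T,z)$ is the set of $\sim$-equivalence classes of $\mathcal O(\mathcal T,z)$ (empty iff $|S(\mathcal T)|=1$). For $C\in\overline{\mathcal O}$ with greatest element $(u,e_u)$ and least element $(v,e_v)$, $\dot c(C)=c(v,e_v)-c(u,e_u)$. If $|S(\mathcal T)|>1$, $C_0\in\overline{\mathcal O}$ is the class of $(z',e_{z'})$, where $z'$ is the unique element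 of $S(\mathcal T)$ adjacent to $z$. *)

(* Defs.v *)
From mathcomp Require Import all_boot all_order all_algebra.
From mathcomp Require Import ring.

Set Implicit Arguments.
Unset Strict Implicit.
Unset Printing Implicit Defensive.

Import Order.TTheory GRing.Theory Num.Theory.
Local Open Scope ring_scope.

(* Main correspondences: [mult v] is N_v, [NN] is the set (calligraphic) N,
   [dics v] is D_v, [degree u] is d_u, [dgcd v] is d(v), [kdet u] is k_u,
   [acoef v] is a_v, [rcoef v] is r_v, [eps v] is epsilon(v), [Delta] and
   [DeltaS] are Delta-tilde on vertices and on sets, [cnum], [MM], [RR] are
   c, M, R, [prec] is the strict order on P, [toward z u] is (u, e_u), and
   [cdot C] is the difference c(least) - c(greatest) of a class C. *)

(* Edges are 2-element sets of cells.  The sequence p is a path from x to y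
   when x :: p lists its cells; paths do not repeat cells. *)
Definition edge_rel (X : finType) (E : {set {set X}}) : rel X :=
  fun x y => [set x; y] \in E.

Definition simple_path (X : finType) (E : {set {set X}}) (x y : X)
    (p : seq X) : bool :=
  [&& path (edge_rel E) x p, uniq (x :: p) & last x p == y].

(* A tree is a graph in which any two cells are joined by exactly one path.
   [arrow_one] is only meaningful on arrows and [q e x] only for x \in e with
   e an edge; no definition below reads their other values. *)
Record decorated_tree (X : finType) := DecoratedTree {
  root : X;
  edges : {set {set X}};
  card_edge : forall e, e \in edges -> #|e| = 2%N;
  path_exists : forall x y, exists p, simple_path edges x y p;
  path_unique : forall x y p p',
    simple_path edges x y p -> simple_path edges x y p' -> p = p';
  arrow_one : pred X;
  q : {set X} -> X -> int
}.

(* The nonnegative generator of the subgroup x Z + y Z of rat. *)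
Definition gcdq (x y : rat) : rat :=
  (gcdz (numq x * denq y) (numq y * denq x))%:~R / (denq x * denq y)%:~R.

Definition gcdqs (s : seq rat) : rat := foldr gcdq 0 s.

Lemma gcdqP (x y r : rat) :
  (exists m n : int, r = m%:~R * x + n%:~R * y) <->
  (exists k : int, r = k%:~R * gcdq x y).
Proof.
pose D : int := denq x * denq y.
pose a := numq x * denq y; pose b := numq y * denq x.
have D0 : D%:~R != 0 :> rat by rewrite intr_eq0 mulf_neq0 ?denq_neq0.
have xE : x = a%:~R / D%:~R.
  rewrite -[LHS]divq_num_den /a /D !rmorphM /=.
  have h1 : (denq x)%:~R != 0 :> rat by rewrite intr_eq0 denq_neq0.
  have h2 : (denq y)%:~R != 0 :> rat by rewrite intr_eq0 denq_neq0.
  by field; rewrite h1 h2.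
have yE : y = b%:~R / D%:~R.
  rewrite -[LHS]divq_num_den /b /D !rmorphM /=.
  have h1 : (denq x)%:~R != 0 :> rat by rewrite intr_eq0 denq_neq0.
  have h2 : (denq y)%:~R != 0 :> rat by rewrite intr_eq0 denq_neq0.
  by field; rewrite h1 h2.
rewrite /gcdq -/a -/b -/D; split=> [[m [n ->]]|[k ->]].
  have /dvdzP[a' Ea] := dvdz_gcdl a b; have /dvdzP[b' Eb] := dvdz_gcdr a b.
  move: (gcdz a b) Ea Eb => g Ea Eb.
  exists (m * a' + n * b'); rewrite xE yE Ea Eb.
  by rewrite !(rmorphD, rmorphM) /=; ring.
have [m [n <-]] := Bezoutz a b.
exists (k * m), (k * n); rewrite xE yE !(rmorphD, rmorphM) /=; ring.
Qed.

Lemma gcdqs_ge0 (s : seq rat) : 0 <= gcdqs s.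
Proof.
case: s => //= x s.
by rewrite divr_ge0 ?ler0z // mulr_ge0 ?denq_ge0.
Qed.

Lemma gcdqsP (s : seq rat) (r : rat) :
  inIntSpan (in_tuple s) r <-> exists k : int, r = k%:~R * gcdqs s.
Proof.
elim: s r => [|x s IH] r.
  split=> [[a ->]|[k ->]]; first by exists 0; rewrite big_ord0 mul0r.
  by exists [ffun=> 0]; rewrite big_ord0 mulr0.
rewrite /= -gcdqP; split=> [[a ->]|[m [n ->]]].
  have /IH[k Ek] : inIntSpan (in_tuple s)
      (\sum_(i < size s) s`_i *~ a (lift ord0 i)).
    by exists [ffun i => a (lift ord0 i)]; apply: eq_bigr => i _; rewrite ffunE.
  exists (a ord0), k; rewrite -Ek big_ord_recl /= mulrzl.
  by congr (_ + _).
have /IH[b Eb] : exists k : int, n%:~R * gcdqs s = k%:~R * gcdqs s by exists n.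
exists [ffun i => if unlift ord0 i is Some j then b j else m].
rewrite big_ord_recl /= !ffunE unlift_none mulrzl Eb; congr (_ + _).
by apply: eq_bigr => i _; rewrite !ffunE liftK.
Qed.

Section DecoratedTree.
Context {X : finType} (T : decorated_tree X).
Implicit Types (x y u v w z : X) (e f g A : {set X}) (s : seq X).

Definition adj : rel X := edge_rel (edges T).

Definition gamma x y : seq X := x :: xchoose (path_exists T x y).

Definition path_edges s : seq {set X} :=
  if s is x :: p then pairmap (fun a b => [set a; b]) x p else [::].

Definition incident x : {set {set X}} := [set e in edges T | x \in e].

Definition valency x : nat := #|incident x|.

Definition arrows : {set X} := [set x | valency x == 1%N] :\ root T.
Definition arrows0 : {set X} := [set x in arrows | ~~ arrow_one T x].
Definition arrows1 : {set X} := arrows :\: arrows0.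
Definition vertices : {set X} := ~: arrows.

Definition tlt x y : bool := (x != y) && (x \in gamma (root T) y).

Definition Qprod e x : int := \prod_(f in incident x | f != e) q T f x.

Definition edet x y : int :=
  let e := [set x; y] in q T e x * q T e y - Qprod e x * Qprod e y.

Definition dead_end e : bool :=
  (e \in edges T) && [exists x in arrows0, x \in e].

Definition dead_ends x : {set {set X}} := [set e in incident x | dead_end e].

Definition Eplus v : {set {set X}} :=
  [set e in incident v | [exists x in e, tlt v x]].

Record newton_tree : Prop := NewtonTree {
  newton_arrow : forall v, v \in vertices ->
    exists2 x, x \in arrows1 & tlt v x;
  newton_dead_end : forall v, v \in vertices -> (#|dead_ends v| <= 1)%N;
  newton_root : forall e, e \in incident (root T) -> q T e (root T) = 1;
  newton_q_arrow : forall x e, x \in arrows -> e \in incident x -> q T e x = 1;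
  newton_coprime : forall v e f, v \in vertices ->
    e \in incident v -> f \in incident v -> e != f ->
    coprimez (q T e v) (q T f v);
  newton_Eplus_ge1 : forall v e, v \in vertices -> e \in Eplus v ->
    1 <= q T e v;
  newton_Eplus_gt1 : forall v, v \in vertices ->
    (#|[set e in Eplus v | (1 < q T e v)%R]| <= 1)%N;
  newton_max : forall v e, v \in vertices -> e \in dead_ends v ->
    (exists2 f, f \in Eplus v & q T e v = q T f v) /\
    (forall f, f \in Eplus v -> q T f v <= q T e v);
  newton_det : forall x y, x \in vertices -> y \in vertices -> adj x y ->
    edet x y < 0
}.

Definition xmult v x : int :=
  \prod_(u <- gamma v x)
    \prod_(e in incident u | e \notin path_edges (gamma v x)) q T e u.

Definition mult v : int := \sum_(x in arrows1) xmult v x.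

Definition dicriticals : {set X} := [set v in vertices | mult v == 0].

Record minimally_complete : Prop := MinimallyComplete {
  mc_mult_ge0 : forall v, v \in vertices -> 0 <= mult v;
  mc_arrow1 : forall x, x \in arrows1 ->
    exists2 v, v \in dicriticals & adj x v;
  mc_dicritical : forall v, v \in dicriticals ->
    exists e, e \in dead_ends v;
  mc_dead_end : forall v e, v \in vertices -> e \in dead_ends v ->
    q T e v = 1 -> v \in dicriticals;
  mc_valency : forall v, v \in vertices -> v != root T -> valency v <> 2%N
}.

Definition NN : {set X} := [set v in vertices | 0 < mult v].

Definition dics v : {set X} := [set u in dicriticals | adj v u].

Definition degree u : nat := #|[set x in arrows1 | adj u x]|.

Definition kdet u : int :=
  if [pick v in vertices | adj u v] is Some v then - edet u v else 0.

Definition node v : bool := (v \in NN) && (dics v != set0).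

Definition acoef v : int :=
  if [pick e in dead_ends v] is Some e then q T e v else 1.

Definition rcoef v : int := -1 + (#|[set u in vertices | adj v u]|)%:Z.

Definition nbrs v : {set X} := [set u in NN | adj v u].

Definition eps v : nat := #|nbrs v|.

Definition Delta v : rat :=
  (rcoef v - 1)%:~R * (mult v - 1)%:~R
  + (mult v)%:~R * (1 - 1 / (acoef v)%:~R)
  - \sum_(u in dics v) ((degree u)%:R - 1).

Definition DeltaS (S : {set X}) : rat := \sum_(v in S) Delta v.

Definition dgcd v : int :=
  if node v then (\big[gcdn/0%N]_(u in dics v) degree u)%:Z else mult v.

Definition edgesN v : {set {set X}} := [set e in incident v | e \subset NN].

Definition PP : {set X * {set X}} := [set p | (p.1 \in NN) && (p.2 \in edgesN p.1)].

Definition prec (p' p : X * {set X}) : bool :=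
  (p.2 \in path_edges (gamma p'.1 p.1)) &&
  (p'.2 \notin path_edges (gamma p'.1 p.1)).

Definition preceq p' p : bool := (p' == p) || prec p' p.

(* [cnum_rec n u u0] is the number c(u, {u, u0}); n bounds the length of the
   branches of the tree that are explored (see [cnumE]). *)
Fixpoint cnum_rec (n : nat) u u0 : rat :=
  if n is n'.+1 then
    if eps u0 == 1%N then (dgcd u0)%:~R / (acoef u0)%:~R
    else gcdqs ((dgcd u0)%:~R ::
                [seq cnum_rec n' u0 w | w <- enum (nbrs u0 :\ u)])
         / (acoef u0)%:~R
  else 0.

Definition other_end u e : X := odflt u [pick x in e :\ u].

Definition cnum (p : X * {set X}) : rat :=
  cnum_rec #|X| p.1 (other_end p.1 p.2).

Lemma edge_rel_sym (E : {set {set X}}) : symmetric (edge_rel E).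
Proof. by move=> x y; rewrite /edge_rel setUC. Qed.

Lemma adj_neq u v : adj u v -> v != u.
Proof.
move=> uv; apply/eqP=> vu.
have := card_edge uv; rewrite vu setUid cards1 => e; discriminate e.
Qed.

Lemma path_extend x y s w : path adj x (y :: s) -> uniq (x :: y :: s) ->
  adj x w -> w != y -> w \notin x :: y :: s.
Proof.
move=> ps us xw wy; rewrite !inE (negbTE wy) /=; apply/norP; split.
  exact: adj_neq xw.
apply/negP=> ws.
have h1 : simple_path (edges T) x w [:: w].
  rewrite /simple_path /= eqxx !andbT -/adj xw inE.
  by rewrite eq_sym adj_neq.
pose n := (index w s).+1.
have wn : last y (take n s) = w.
  have ilt : (index w s < size s)%N by rewrite index_mem.
  by rewrite -nth_last size_takel // nth_take //= (set_nth_default w) ?nth_index.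
have h2 : simple_path (edges T) x w (y :: take n s).
  apply/and3P; split; last by rewrite /= wn.
    exact: (@take_path _ _ x (y :: s) n.+1 ps).
  exact: (take_uniq n.+2 us).
by have [wy'] := path_unique h1 h2; rewrite wy' eqxx in wy.
Qed.

Lemma cnum_rec_stable n m u u0 s : path adj u0 (u :: s) ->
  uniq (u0 :: u :: s) -> (#|X| < n + size (u0 :: u :: s))%N -> (n <= m)%N ->
  cnum_rec n u u0 = cnum_rec m u u0.
Proof.
elim: n m u u0 s => [|n IH] [|m] u u0 s ps us lt nm //=.
  by move: lt; rewrite add0n -(card_uniqP us) ltnNge max_card.
case: ifP => // _; congr (gcdqs (_ :: _) / _).
apply/eq_in_map => w; rewrite mem_enum !inE => /and3P[wu wN u0w].
have wn := path_extend ps us u0w wu.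
apply: (IH _ _ _ (u :: s)) => //.
- by apply/andP; split; [rewrite /adj edge_rel_sym | exact: ps].
- by rewrite /= in wn us *; rewrite wn.
- by move: lt; rewrite /= addSnnS.
Qed.

Lemma other_endE u v : v != u -> other_end u [set u; v] = v.
Proof.
move=> vu; rewrite /other_end; case: pickP => [x|/(_ v)].
  by rewrite !inE => /andP[/negbTE-> /eqP->].
by rewrite !inE eqxx orbT vu.
Qed.

Lemma cnumE u u0 : adj u u0 ->
  cnum (u, [set u; u0]) =
    if eps u0 == 1%N then (dgcd u0)%:~R / (acoef u0)%:~R
    else gcdqs ((dgcd u0)%:~R ::
                [seq cnum (u0, [set u0; w]) | w <- enum (nbrs u0 :\ u)])
         / (acoef u0)%:~R.
Proof.
move=> uu0; rewrite /cnum /= other_endE ?adj_neq //.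
have u0u : adj u0 u by rewrite /adj edge_rel_sym.
rewrite (@cnum_rec_stable #|X| #|X|.+1 u u0 [::]) //=; first last.
- by rewrite addn2 leqW.
- by rewrite inE adj_neq.
- by rewrite u0u.
case: ifP => // _; congr (gcdqs (_ :: _) / _).
by apply/eq_in_map => w; rewrite mem_enum !inE => /and3P[_ _ h];
  rewrite other_endE ?adj_neq.
Qed.
Definition MM (p : X * {set X}) : rat := (mult p.1)%:~R / cnum p.

Definition RR u (A : {set {set X}}) : rat :=
  \sum_(x in dics u) (1 - 1 / (kdet x)%:~R)
  + (1 - 1 / (acoef u)%:~R)
  + \sum_(e in A) (1 - 1 / MM (u, e)).

Definition trivial_path s : bool :=
  if s is z1 :: p then
    [&& path adj z1 p, uniq s, all [in NN] s, (1 < size s)%N, eps z1 == 1%N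
      & all (fun z => (eps z == 2%N) && (Delta z == 0)) (behead (belast z1 p))]
  else false.

Definition ZZ : {set X} := [set z in NN | (eps z == 1%N) && (Delta z <= 0)].

Definition Gamma s : bool :=
  if s is z1 :: p then
    [&& trivial_path s, Delta z1 <= 0, 0 < DeltaS [set:: s]
      & tlt (last z1 p) (last z1 (belast z1 p))]
  else false.

(* Every path is of the form [gamma x y], so "for some element of Gamma" is
   expressed by quantifying over its endpoints. *)
Definition WW : {set X} := [set w | [exists v, Gamma (gamma v w)]].

Definition VV w : {set X} := [set v | Gamma (gamma v w)].

Definition Vbar w : {set X} :=
  if w \in WW then \bigcup_(v in VV w) [set:: gamma v w] else [set w].

Definition tooth (p : X * {set X}) : bool :=
  (p \in PP) &&
  [exists v, Gamma (gamma v p.1) &&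
     (last set0 (path_edges (gamma v p.1)) == p.2)].

Definition Omega : {set X} := ZZ :\: \bigcup_(w in WW) VV w.

Definition skeleton : {set X} := NN :\: \bigcup_(w in WW) (Vbar w :\ w).

Definition comb (p p' : X * {set X}) : bool :=
  [&& p \in PP, p' \in PP, preceq p' p &
    [forall r in PP, prec r p && preceq p' r ==>
      [|| (eps r.1 == 2%N) && (RR r.1 [set r.2] < 1)
        | [&& eps r.1 == 3%N, RR r.1 [set r.2] == 0 &
            [exists g in edgesN r.1,
              [&& g \notin path_edges (gamma p.1 r.1), g != r.2
                & tooth (r.1, g)]]]]]].

Definition comb_eq (p p' : X * {set X}) : bool := comb p p' || comb p' p.

Definition delta_star v : nat :=
  #|[set e in edgesN v |
      ~~ [exists x, exists y, Gamma (gamma x y) &&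
                              (e \in path_edges (gamma x y))]]|.

Definition In_tree : {set X} :=
  if Omega != set0 then Omega
  else [set z in skeleton | (delta_star z <= 1)%N].

Definition toward z u : X * {set X} := (u, head set0 (path_edges (gamma u z))).

Definition OO z : {set X * {set X}} :=
  [set toward z u | u in skeleton :\ z].

Definition OObar z : {set {set X * {set X}}} :=
  equivalence_partition comb_eq (OO z).

Definition cdot (C : {set X * {set X}}) : rat :=
  if [pick p in C | [forall r in C, preceq r p]] is Some p then
    if [pick p' in C | [forall r in C, preceq p' r]] is Some p' then
      cnum p' - cnum p
    else 0
  else 0.

(* The junk value set0, taken when |S(T)| = 1, is never an equivalence class. *)
Definition C0 z : {set X * {set X}} :=
  if [pick z' in skeleton | adj z z'] is Some z' then
    [set p in OO z | comb_eq (toward z z') p]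
  else set0.

End DecoratedTree.

(* Main.v *)
(* Write B(u, v) for the sum of the x_{u,y} over the (1)-arrows y beyond v, with
   the decorations at u left out. For e = {u, v} one has
   N_v = q(e, v) B(u, v) + Q(e, v) B(v, u), and c(u, e) divides B(u, v), B(v, u)
   and N_u, so the M(u, e) are integers. Arithmetic of the gcd then gives the
   local inequality 1 - c(u, e) <= Delta(v) + sum of (1 - c(v, f)) over the edges
   f <> e of the tree N at v, while det < 0 and valency <> 2 force
   c(u, e) <= N_u / 2 when v lies above u.

   Let Dbar(v) be Delta(v) plus Delta of the starting points of the teeth at v;
   its sum over the skeleton is at most Delta(N). By the inequalities above Dbar
   is >= 1 at every leaf of the skeleton outside Omega and wherever a class of
   pairs directed towards z ends, and inside a class Dbar(v) dominates the
   decrease of c from one step to the next. Hence each class C contributes at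
   least cdot(C) + 1 to Delta(N). If Omega is empty, z itself contributes 1 more.
   If Omega = {z}, a possibly negative Dbar(z) is compensated by C0, unless C0
   is the only class. If Omega contains z and another vertex, then N is a path
   with Delta = 0 inside, and again there is only one class. *)

Require Import Defs.
From mathcomp Require Import all_boot all_order all_algebra.
From mathcomp Require Import ring lra zify.

Set Implicit Arguments.
Unset Strict Implicit.
Unset Printing Implicit Defensive.

Import Order.TTheory GRing.Theory Num.Theory.
Local Open Scope ring_scope.

(** * Paths in trees *)


(** Two kinds of rounding drive the estimates. M(u, e), k_x and a_v are positive integers, so each
    term 1 - 1/m of R is 0 or at least 1/2; and Dbar takes integer values, so a positive one is at
    least 1. The obstacle is that Delta may be negative at leaves of N. A leaf that starts a tooth
    is charged to the base of the tooth. Teeth point away from the root, so the bound c <= N_v / 2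
    applies at the base v, and two teeth there already outweigh the term -(N_v - 1) produced by a
    leaf of the skeleton. At a cell z of Omega no such local repair exists. The deficit at z is at
    most c - 1 for the edge entering z; as c telescopes along C0, it is paid for at a cell of C0
    where the comb condition fails. *)

Section Tree.
Context {X : finType} (T : decorated_tree X).
Implicit Types (x y u v w z : X) (e f g : {set X}) (s : seq X).

(** The default of [head] makes [step x x] equal to x, so that facts such as [step_dich] need no
    assumption that y differs from the other cells. *)
Definition step x y : X := head x (behead (gamma T x y)).

Lemma adjC x y : adj T x y = adj T y x.
Proof. exact: edge_rel_sym. Qed.

Lemma gammaP x y : simple_path (edges T) x y (behead (gamma T x y)).
Proof. exact: (xchooseP (path_exists T x y)). Qed.

Lemma gamma_eq x y p : simple_path (edges T) x y p -> gamma T x y = x :: p.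
Proof. by move=> h; congr (_ :: _); exact: path_unique (gammaP x y) h. Qed.

Lemma gamma_cons x y : gamma T x y = x :: behead (gamma T x y).
Proof. by []. Qed.

Lemma gamma_path x y : path (adj T) x (behead (gamma T x y)).
Proof. by case/and3P: (gammaP x y). Qed.

Lemma gamma_uniq x y : uniq (gamma T x y).
Proof. by case/and3P: (gammaP x y). Qed.

Lemma gamma_last x y a : last a (gamma T x y) = y.
Proof. by case/and3P: (gammaP x y) => _ _ /eqP. Qed.

Lemma gammaxx x : gamma T x x = [:: x].
Proof. by apply: gamma_eq; rewrite /simple_path /= eqxx. Qed.

Lemma mem_gammal x y : x \in gamma T x y.
Proof. by rewrite gamma_cons mem_head. Qed.

Lemma mem_gammar x y : y \in gamma T x y.
Proof.
have := mem_last x (behead (gamma T x y)).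
by have -> : last x (behead (gamma T x y)) = y := gamma_last x y x.
Qed.

Lemma stepxx x : step x x = x.
Proof. by rewrite /step gammaxx. Qed.

Lemma gammaE x y : x != y -> gamma T x y = x :: gamma T (step x y) y.
Proof.
move=> xy; have [] := and3P (gammaP x y); rewrite /step.
case: (behead _) (gamma_cons x y) => [|a p] E /=.
  by move=> _ _ /eqP exy; rewrite exy eqxx in xy.
case/andP=> xa pa /and3P[_ a1 a2] l.
by rewrite E (@gamma_eq a y p) // /simple_path pa /= a1 a2.
Qed.

Lemma step_adj x y : x != y -> adj T x (step x y).
Proof.
move=> xy; move: (gamma_path x y); rewrite /step.
rewrite (gammaE xy) /=; by case/andP.
Qed.

Lemma step_neq x y : x != y -> step x y != x.
Proof. by move=> /step_adj/adj_neq. Qed.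

Lemma adj_neqC x y : adj T x y -> x != y.
Proof. by rewrite adjC; exact: adj_neq. Qed.

Lemma notin_step x y : x != y -> x \notin gamma T (step x y) y.
Proof. by move=> xy; move: (gamma_uniq x y); rewrite (gammaE xy) /= => /andP[]. Qed.

Lemma gamma_adj x a y : adj T x a -> x \notin gamma T a y ->
  gamma T x y = x :: gamma T a y.
Proof.
move=> xa xn; apply: gamma_eq; apply/and3P; split.
- by apply/andP; split; [exact: xa | exact: gamma_path].
- by rewrite cons_uniq xn gamma_uniq.
- by apply/eqP; exact: gamma_last.
Qed.

Lemma step_gamma x a y : adj T x a -> x \notin gamma T a y -> step x y = a.
Proof. by move=> xa xn; rewrite /step (gamma_adj xa xn). Qed.

(** By [path_extend], a neighbour of a occurring later on the path would close a cycle. *)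
Lemma mem_gamma_adj x a y : adj T a x -> x \in gamma T a y -> step a y = x.
Proof.
move=> ax xin; case: (eqVneq a y) xin => [->|ay].
  by rewrite gammaxx inE => /eqP xy; rewrite xy stepxx.
case: (eqVneq x (step a y)) => [->//|xs].
have := @path_extend X T a (step a y) (behead (gamma T (step a y) y)) x.
have E := gammaE ay.
rewrite -gamma_cons -E; move: (gamma_path a y); rewrite {1}E => pa.
by move=> /(_ pa (gamma_uniq a y) ax xs)/negbTE->.
Qed.

(** Removing the edge {x, a} cuts the tree in two, and y lies on exactly one side. *)
Lemma step_dich x a y : adj T x a -> (step x y == a) = (step a y != x).
Proof.
move=> xa; case: (boolP (x \in gamma T a y)) => xin.
  rewrite (mem_gamma_adj _ xin) ?eqxx; last by rewrite adjC.
  apply/eqP => sxy.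
  have xy : x != y.
    by apply/eqP => xy; move: sxy (adj_neq xa); rewrite xy stepxx => ->; rewrite eqxx.
  by move: (notin_step xy); rewrite sxy xin.
rewrite (step_gamma xa xin) eqxx; apply/esym/eqP => say.
case: (eqVneq a y) => [ay|ay].
  by move: say (adj_neq xa); rewrite -ay stepxx => ->; rewrite eqxx.
by move: xin; rewrite gammaE // say inE mem_gammal orbT.
Qed.

Lemma step_adjE x a : adj T x a -> step x a = a.
Proof.
move=> xa; apply/eqP; rewrite step_dich // stepxx; exact: adj_neq xa.
Qed.

Lemma gamma_ind y (P : X -> Prop) :
  P y -> (forall x, x != y -> P (step x y) -> P x) -> forall x, P x.
Proof.
move=> Py IH x; move E: (size (gamma T x y)) => n.
elim: n x E => [|n IHn] x; first by rewrite gamma_cons.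
case: (eqVneq x y) => [->//|xy]; rewrite (gammaE xy) => -[] /IHn.
exact: IH.
Qed.

Lemma mem_gamma_trans x y w u :
  w \in gamma T x y -> u \in gamma T w y -> u \in gamma T x y.
Proof.
elim/(gamma_ind (y := y)): x => [|x xy IH]; first by rewrite gammaxx inE => /eqP->; rewrite gammaxx.
rewrite [in X in X -> _]gammaE // inE => /orP[/eqP->//|wi ui].
by rewrite gammaE // inE IH ?orbT.
Qed.

Lemma mem_gammaC x y w : (w \in gamma T x y) = (w \in gamma T y x).
Proof.
suff H a b : w \in gamma T a b -> w \in gamma T b a by apply/idP/idP; exact: H.
rewrite -mem_rev; suff -> : gamma T b a = rev (gamma T a b) by [].
have := gamma_uniq a b; have := gamma_path a b; have := gamma_last a b a.
rewrite gamma_cons; move: (behead _) => p /= lp pp up.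
have E : rev (a :: p) = b :: rev (belast a p) by rewrite lastI lp rev_rcons.
rewrite E; apply: gamma_eq; apply/and3P; split.
- rewrite -lp rev_path; apply: sub_path pp => c d.
  by rewrite /adj edge_rel_sym.
- by rewrite -E rev_uniq.
- by case: p E {lp pp up} => [|c p] /=; rewrite ?rev_cons ?last_rcons // => -[->].
Qed.

Lemma gamma_anti x y z : x \in gamma T y z -> y \in gamma T x z -> x = y.
Proof.
case: (eqVneq y z) => [->|yz]; first by rewrite gammaxx inE => /eqP.
rewrite gammaE // inE => /orP[/eqP//|xi yi].
by move: (notin_step yz); rewrite (mem_gamma_trans xi yi).
Qed.

(** Paths that leave v by different edges glue to a path through v. *)
Lemma step_between v w z : v != z -> step v w != step v z ->
  v \in gamma T w z.
Proof.
elim/(gamma_ind (y := w)): v => [|v vw IH] vz; first by rewrite mem_gammal.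
have va := step_adj vw; set a := step v w in va IH *; move=> ns.
have saz : step a z = v.
  by apply/eqP; rewrite step_dich ?(adjC a) // eq_sym.
have az : a != z.
  by apply/eqP=> az; move: saz va; rewrite az stepxx => ->; move/adj_neq; rewrite eqxx.
have ai : a \in gamma T w z.
  case: (eqVneq a w) => [->|aw]; first by rewrite mem_gammal.
  apply: IH => //; rewrite saz.
  by apply/eqP => /eqP; rewrite step_dich ?(adjC a) // => /negP; apply; apply/eqP.
apply: mem_gamma_trans ai _.
by rewrite gammaE // inE saz mem_gammal orbT.
Qed.

Lemma step_prefix v w z : v \in gamma T w z -> v != w -> step w v = step w z.
Proof.
elim/(gamma_ind (y := z)): w => [|w wz IH]; first by rewrite gammaxx inE => ->.
rewrite gammaE // inE => /orP[/eqP->|]; first by rewrite eqxx.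
set a := step w z => vi vw; have wa : adj T w a := step_adj wz.
apply/eqP; rewrite step_dich //; apply/eqP => sav.
have va : v != a.
  apply/eqP=> va; move: sav wa; rewrite va stepxx => ->.
  by move/adj_neq; rewrite eqxx.
have := IH vi va; rewrite sav => /esym/eqP.
by apply/negP; rewrite -step_dich // eqxx.
Qed.

Lemma between_step v w z : v \in gamma T w z -> v != w -> v != z ->
  step v w != step v z.
Proof.
elim/(gamma_ind (y := z)): w => [|w wz IH]; first by rewrite gammaxx inE => ->.
move=> vi vw vz; move: (vi); rewrite gammaE // inE (negbTE vw) /=.
have wa : adj T w (step w z) := step_adj wz.
have sw : step w v = step w z by apply: step_prefix.
move=> via; case: (eqVneq v (step w z)) => [->|va].
  rewrite step_adjE; last by rewrite adjC.
  by rewrite eq_sym -step_dich ?eqxx.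
have -> : step v w = step v (step w z).
  apply/esym/step_prefix; last by rewrite eq_sym.
  by rewrite mem_gammaC gammaE 1?eq_sym // sw inE mem_gammal orbT.
exact: IH.
Qed.

(** A tree has no cycle, so an edge with both ends on a path belongs to the path. Conditions on
    edges thus become conditions on cells. *)
Lemma mem_path_edges a b x y : adj T a b ->
  ([set a; b] \in path_edges (gamma T x y)) =
  (a \in gamma T x y) && (b \in gamma T x y).
Proof.
have aux c x' : adj T x' c -> [set x'; c] = [set x'; step x' y] -> step x' y = c.
  move=> xc E; have : c \in [set x'; step x' y] by rewrite -E !inE eqxx orbT.
  by rewrite !inE (negbTE (adj_neq xc)) /= => /eqP.
move=> ab; elim/(gamma_ind (y := y)): x => [|x xy IH].
  rewrite gammaxx /= !inE; case: eqP => //= <-.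
  by rewrite (negbTE (adj_neq ab)).
have -> : path_edges (gamma T x y) =
    [set x; step x y] :: path_edges (gamma T (step x y) y).
  by rewrite (gammaE xy) gamma_cons.
rewrite in_cons IH (gammaE xy) !(in_cons x).
case: (eqVneq a x) => [ax|ax]; case: (eqVneq b x) => [bx|bx] /=.
- by move: (adj_neq ab); rewrite ax bx eqxx.
- rewrite ax (negbTE (notin_step xy)) /= orbF; apply/eqP/idP => [/aux|bi].
    by rewrite -ax ab ax => /(_ isT) <-; rewrite mem_gammal.
  rewrite (@mem_gamma_adj b) // -?ax // ax gammaE // in_cons bi orbT //.
- rewrite bx (negbTE (notin_step xy)) andbF orbF andbT; apply/eqP/idP => [|bi].
    rewrite setUC => /aux; rewrite -bx adjC ab bx => /(_ isT) <-.
    by rewrite mem_gammal.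
  by rewrite setUC (@mem_gamma_adj a) // -?bx ?(adjC b) // bx gammaE // in_cons bi orbT.
- case: eqP => //= E; have : x \in [set a; b] by rewrite E !inE eqxx.
  by rewrite !inE eq_sym (negbTE ax) eq_sym (negbTE bx).
Qed.

Definition branch v w : {set X} := [set y | step v y == w].

Lemma branch_proper v w u : adj T v w -> adj T w u -> u != v ->
  (#|branch w u| < #|branch v w|)%N.
Proof.
move=> vw wu uv; apply: proper_card; apply/properP; split.
  apply/subsetP => y; rewrite !inE => /eqP swy.
  by rewrite step_dich // swy.
exists w; first by rewrite inE step_adjE.
by rewrite inE stepxx eq_sym (adj_neq wu).
Qed.

(** Recursion into the component of w after removal of {v, w}; these components shrink strictly. *)
Lemma branch_ind (P : X -> X -> Prop) :
  (forall v w, adj T v w -> (forall u, adj T w u -> u != v -> P w u) -> P v w) ->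
  forall v w, adj T v w -> P v w.
Proof.
move=> IH v w; have [n] := ubnP #|branch v w|.
elim: n v w => // n IHn v w lt vw; apply: IH => // u wu uv.
apply: IHn => //; apply: leq_trans (branch_proper vw wu uv) _.
by rewrite -ltnS.
Qed.

Lemma set2_inj v w w' : adj T v w -> adj T v w' ->
  [set v; w] = [set v; w'] -> w = w'.
Proof.
move=> vw vw' E; have : w \in [set v; w'] by rewrite -E !inE eqxx orbT.
by rewrite !inE (negbTE (adj_neq vw)) => /eqP.
Qed.

Lemma edge_set2 v e : e \in incident T v ->
  exists2 w, adj T v w & e = [set v; w].
Proof.
rewrite inE => /andP[eE ve]; have /eqP/cards2P[a [b [ab E]]] := card_edge eE.
move: ve; rewrite E !inE => /orP[]/eqP va.
  by exists b; rewrite /adj /edge_rel va -?E.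
by exists a; rewrite /adj /edge_rel va setUC -?E.
Qed.

Lemma set2_incident v w : ([set v; w] \in incident T v) = adj T v w.
Proof. by rewrite inE !inE eqxx andbT. Qed.

Lemma incidentE v : incident T v = [set [set v; w] | w in adj T v].
Proof.
apply/setP => e; apply/idP/imsetP => [/edge_set2[w vw ->]|[w vw ->]].
  by exists w.
by rewrite set2_incident.
Qed.

Lemma big_incident (R : Type) (idx : R) (op : Monoid.com_law idx) v
    (P : pred {set X}) (F : {set X} -> R) :
  \big[op/idx]_(e in incident T v | P e) F e =
  \big[op/idx]_(w | adj T v w && P [set v; w]) F [set v; w].
Proof.
rewrite incidentE big_imset_cond //=.
by move=> a b va vb; apply: set2_inj.
Qed.

Lemma valencyE v : valency T v = #|[set w | adj T v w]|.
Proof.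
rewrite /valency incidentE card_in_imset; last first.
  by move=> a b va vb; apply: set2_inj.
by apply: eq_card => w; rewrite inE.
Qed.

End Tree.

Arguments gammaE {X T x y} _.
Arguments step_adj {X T x y} _.
Arguments step_neq {X T x y} _.
Arguments notin_step {X T x y} _.

(** * Multiplicities and one-sided arrow sums *)


Section ArrowSums.
Context {X : finType} (T : decorated_tree X).
Implicit Types (x y u v w z : X) (e f g : {set X}) (s : seq X).

(* With e = {v, w}: qn v w is q(e, v), Qn v w is Q(e, v), and Qn2 v w u omits
   the edge {v, u} from Q(e, v) as well. *)
Definition qn v w : int := q T [set v; w] v.

Definition Qn v w : int := \prod_(w' | adj T v w' && (w' != w)) qn v w'.

Definition Qn2 v w u : int :=
  \prod_(w' | adj T v w' && ((w' != w) && (w' != u))) qn v w'.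

Lemma QnE v w : adj T v w -> Qprod T [set v; w] v = Qn v w.
Proof.
move=> vw; rewrite /Qprod big_incident; apply: eq_bigl => w'.
case vw' : (adj T v w') => //=; congr negb.
by apply/eqP/eqP => [/(set2_inj vw' vw)|->].
Qed.

Lemma Qn2C v w u : Qn2 v w u = Qn2 v u w.
Proof. by apply: eq_bigl => w'; rewrite [(w' != w) && _]andbC. Qed.

Lemma Qn_split v w u : adj T v u -> u != w -> Qn v w = qn v u * Qn2 v w u.
Proof.
move=> vu uw; rewrite /Qn (bigD1 u) ?vu //=.
by congr (_ * _); apply: eq_bigl => w'; rewrite andbA.
Qed.

(* For a path from u through its neighbour v, [xside u v y] is the part of
   x_{u,y} contributed by the cells from v on, so Bs u v depends only on the
   branch at v, and N_v = q(e, v) Bs u v + Q(e, v) Bs v u for e = {u, v}. *)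
Definition xside u v y : int :=
  \prod_(x <- gamma T v y)
    \prod_(w | adj T x w && (w \notin u :: gamma T v y)) qn x w.

Definition Bs u v : int := \sum_(y in arrows1 T | step T u y == v) xside u v y.

Lemma xmultE v y : xmult T v y =
  \prod_(x <- gamma T v y) \prod_(w | adj T x w && (w \notin gamma T v y)) qn x w.
Proof.
rewrite /xmult big_seq [RHS]big_seq; apply: eq_bigr => x xi.
rewrite big_incident; apply: eq_bigl => w.
by case xw : (adj T x w) => //=; rewrite mem_path_edges // xi.
Qed.

Lemma xmult_step v y : v != y ->
  xmult T v y = Qn v (step T v y) * xside v (step T v y) y.
Proof.
move=> vy; rewrite xmultE (gammaE vy) big_cons; congr (_ * _).
apply: eq_bigl => w; case vw : (adj T v w) => //=.
rewrite in_cons (negbTE (adj_neq vw)) /=; congr negb.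
apply/idP/eqP => [wi|->]; last exact: mem_gammal.
by apply/esym/(mem_gamma_adj vw); rewrite gammaE // in_cons wi orbT.
Qed.

Lemma xside_step u v y : adj T u v -> step T u y = v -> v != y ->
  xside u v y = Qn2 v u (step T v y) * xside v (step T v y) y.
Proof.
move=> uv uy vy; rewrite /xside {1}(gammaE vy) big_cons.
have su : u != y by apply: contraTneq (adj_neq uv) => uy'; rewrite -uy uy' stepxx eqxx.
congr (_ * _).
  apply: eq_bigl => w; case vw : (adj T v w) => //=.
  rewrite in_cons negb_or; congr (_ && _); congr negb.
  apply/idP/eqP => [wi|->]; first exact/esym/(mem_gamma_adj vw).
  by rewrite gammaE // in_cons mem_gammal orbT.
rewrite big_seq [RHS]big_seq; apply: eq_bigr => x xi.
apply: eq_bigl => w; case xw : (adj T x w) => //=.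
rewrite in_cons negb_or {1}(gammaE vy); case: eqP => //= wu.
exfalso; move: (@notin_step _ T _ _ vy).
have xi' : x \in gamma T u y by rewrite gammaE // uy (gammaE vy) 2!in_cons xi !orbT.
have ux : adj T u x by rewrite adjC -wu.
by have := mem_gamma_adj ux xi'; rewrite uy => {1}->; rewrite xi.
Qed.

(** The arrows are grouped by the first edge of their path from v; that edge exists because v is not
    itself one of them. *)
Lemma mult_sum v : v \notin arrows1 T ->
  mult T v = \sum_(w | adj T v w) Qn v w * Bs v w.
Proof.
move=> vn; rewrite /mult /Bs.
under [RHS]eq_bigr => w _ do rewrite big_distrr /=.
rewrite (exchange_big_dep (mem (arrows1 T))) //=; last by move=> ? ? _ /andP[].
apply: eq_bigr => y yA; have vy : v != y by apply: contraNneq vn => ->.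
rewrite (big_pred1 (step T v y)) ?xmult_step // => w /=.
rewrite yA eq_sym andbC; apply/andP/eqP => [[/eqP//]|->].
by rewrite eqxx step_adj.
Qed.

Lemma BsE u v : adj T u v -> v \notin arrows1 T ->
  Bs u v = \sum_(w | adj T v w && (w != u)) Qn2 v u w * Bs v w.
Proof.
move=> uv vn; rewrite /Bs.
under [RHS]eq_bigr => w _ do rewrite big_distrr /=.
rewrite (exchange_big_dep (mem (arrows1 T))) //=; last by move=> ? ? _ /andP[].
rewrite big_mkcondr; apply: eq_bigr => y yA.
have vy : v != y by apply: contraNneq vn => ->.
case: ifP => [/eqP uy|uy].
  rewrite (big_pred1 (step T v y)) ?(xside_step uv) // => w /=.
  rewrite yA /=; apply/andP/eqP => [[_ /eqP//]|->].
  by rewrite eqxx step_adj // -step_dich // uy eqxx.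
rewrite big_pred0 // => w; rewrite yA /=; apply/negP => /andP[/andP[vw wu] /eqP vyw].
by move: uy; rewrite step_dich // vyw wu.
Qed.

(** The path from v to an arrow beyond v avoids {u, v} and picks up q(e, v); the path to any other
    arrow starts with {u, v} and picks up Q(e, v). *)
Lemma mult_split u v : adj T u v -> v \notin arrows1 T ->
  mult T v = qn v u * Bs u v + Qn v u * Bs v u.
Proof.
move=> uv vn; rewrite mult_sum // (bigD1 u) /=; last by rewrite adjC.
rewrite addrC (BsE uv vn); congr (_ + _); rewrite big_distrr; apply: eq_bigr => w /andP[vw wu].
by rewrite /= mulrA (@Qn_split v w u) // 1?adjC // 1?eq_sym // Qn2C.
Qed.

Lemma edetE u v : adj T u v ->
  edet T u v = qn u v * qn v u - Qn u v * Qn v u.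
Proof.
move=> uv; rewrite /edet QnE // /qn; congr (_ * q T _ _ - _ * _).
  exact: setUC.
by rewrite setUC QnE // adjC.
Qed.

Lemma edetC u v : adj T u v -> edet T u v = edet T v u.
Proof. by move=> uv; rewrite !edetE // 1?adjC // [qn u v * _]mulrC [Qn u v * _]mulrC. Qed.

(** Elimination of [Bs v u] between the [mult_split] formulas for N_u and N_v. *)
Lemma edet_Bs u v : adj T u v -> u \notin arrows1 T -> v \notin arrows1 T ->
  qn u v * mult T v - Qn v u * mult T u = edet T u v * Bs u v.
Proof.
move=> uv un vn; rewrite (mult_split uv vn) (@mult_split v u) // 1?adjC //.
rewrite edetE //; ring.
Qed.

End ArrowSums.

(** * Abstract Newton trees *)


Section Newton.
Context {X : finType} (T : decorated_tree X).
Implicit Types (x y u v w z : X) (e f g : {set X}) (s : seq X).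

Notation adj := (adj T).
Notation step := (step T).
Notation root := (Defs.root T).
Notation qn := (qn T).
Notation Qn := (Qn T).
Notation Qn2 := (Qn2 T).
Notation Bs := (Bs T).

(* w is a child of v for the orientation away from the root. *)
Definition up v w : bool := adj v w && (step w root == v).

Lemma up_adj v w : up v w -> adj v w.
Proof. by case/andP. Qed.

Lemma up_step v w : up v w -> step w root = v.
Proof. by case/andP => _ /eqP. Qed.

Lemma upC v w : adj v w -> up v w = ~~ up w v.
Proof. by move=> vw; rewrite /up vw (adjC T w v) vw /= step_dich // adjC. Qed.

Lemma up_step_root v : v != root -> up (step v root) v.
Proof. by move=> vr; rewrite /up eqxx adjC step_adj. Qed.

Lemma up_other u v w : up u v -> adj v w -> w != u -> up v w.
Proof.
move=> uv vw wu; rewrite upC //; apply/negP => /up_step.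
by rewrite (up_step uv) => uw; rewrite uw eqxx in wu.
Qed.

Lemma up_root w : adj root w -> up root w.
Proof.
move=> rw; rewrite upC // /up stepxx adjC rw /=.
exact: adj_neqC rw.
Qed.

Lemma up_nroot v w : up v w -> w != root.
Proof.
case/andP=> /adj_neq wv /eqP E; apply: contraNneq wv => wr.
by rewrite -E wr stepxx.
Qed.

Lemma tlt_up v w : adj v w -> tlt T v w = up v w.
Proof.
move=> vw; rewrite /tlt /up vw (adj_neqC vw) mem_gammaC /=.
have wv : adj w v by rewrite adjC.
apply/idP/eqP => [/(mem_gamma_adj wv)//|E].
have wr : w != root by apply: (@up_nroot v); rewrite /up vw E eqxx.
by rewrite gammaE // in_cons E mem_gammal orbT.
Qed.

Lemma Eplus_up v w : ([set v; w] \in Eplus T v) = up v w.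
Proof.
rewrite inE set2_incident; case vw: (adj v w); last by rewrite /up vw.
rewrite -tlt_up //; apply/existsP/idP => [[x /andP[]]|h].
  by rewrite !inE => /orP[]/eqP-> //; rewrite /tlt eqxx.
by exists w; rewrite !inE eqxx orbT h.
Qed.

Lemma arrow_root x : x \in arrows T -> x != root.
Proof. by rewrite !inE => /andP[]. Qed.

Lemma arrow_nbr x w w' : x \in arrows T -> adj x w -> adj x w' -> w = w'.
Proof.
rewrite !inE valencyE => /andP[_ /cards1P[a E]] xw xw'.
have : w \in [set w | adj x w] by rewrite inE.
have : w' \in [set w | adj x w] by rewrite inE.
by rewrite E !inE => /eqP-> /eqP->.
Qed.

Lemma arrow_adj_up x w : x \in arrows T -> adj x w -> up w x.
Proof.
move=> xA xw; have xr := arrow_root xA.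
by rewrite (arrow_nbr xA xw (step_adj xr)) up_step_root.
Qed.

Lemma arrows0_arrow x : x \in arrows0 T -> x \in arrows T.
Proof. by rewrite inE => /andP[]. Qed.

Lemma arrows1_arrow x : x \in arrows1 T -> x \in arrows T.
Proof. by rewrite inE => /andP[]. Qed.

Lemma arrows0_n1 x : x \in arrows0 T -> x \notin arrows1 T.
Proof. by move=> x0; rewrite inE x0. Qed.

Lemma vertex_n1 x : x \in vertices T -> x \notin arrows1 T.
Proof. by rewrite inE; apply: contra; exact: arrows1_arrow. Qed.

Lemma vertex_n0 x : x \in vertices T -> x \notin arrows0 T.
Proof. by rewrite inE; apply: contra; exact: arrows0_arrow. Qed.

Lemma cell_cases x : [\/ x \in vertices T, x \in arrows0 T | x \in arrows1 T].
Proof.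
rewrite /vertices in_setC; case xA : (x \in arrows T); last by constructor 1.
case x0 : (x \in arrows0 T); first by constructor 2.
by constructor 3; rewrite inE xA x0.
Qed.

Lemma root_vertex : root \in vertices T.
Proof. by rewrite !inE eqxx. Qed.

Lemma step_arrow v y : v != y -> step v y \in arrows T -> step v y = y.
Proof.
move=> vy sA; have va := step_adj (T := T) vy; apply/eqP/negPn/negP => sy.
have av : adj (step v y) v by rewrite adjC.
have := arrow_nbr sA av (step_adj sy); apply/eqP.
by rewrite eq_sym -step_dich ?eqxx.
Qed.

Lemma Bs_arrow1 u v : adj u v -> v \in arrows1 T -> Bs u v = 1.
Proof.
move=> uv v1; rewrite /Bs (big_pred1 v) => [|y /=].
  rewrite /xside gammaxx big_seq1 big_pred0 // => w.
  apply/negP => /andP[vw]; rewrite !inE => /norP[wu _].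
  have vu : adj v u by rewrite adjC.
  by rewrite (arrow_nbr (arrows1_arrow v1) vw vu) eqxx in wu.
apply/andP/eqP => [[y1 /eqP uy]|->]; last by rewrite v1 step_adjE.
case: (eqVneq u y) => [uy'|uny]; first by move: (adj_neq uv); rewrite -uy uy' stepxx eqxx.
by rewrite -uy step_arrow // uy arrows1_arrow.
Qed.

Lemma Bs_arrow0 u v : adj u v -> v \in arrows0 T -> Bs u v = 0.
Proof.
move=> uv v0; rewrite BsE ?arrows0_n1 // big_pred0 // => w.
apply/negP => /andP[vw]; have vu : adj v u by rewrite adjC.
by rewrite (arrow_nbr (arrows0_arrow v0) vw vu) eqxx.
Qed.

Lemma prod_int_ge1 (I : finType) (P : pred I) (F : I -> int) :
  (forall i, P i -> 1 <= F i) -> 1 <= \prod_(i | P i) F i.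
Proof.
move=> h; elim/big_ind: _ => // a b a1 b1.
by have := ler_pM ler01 ler01 a1 b1; rewrite mulr1.
Qed.

Section NewtonTree.
Context (newtonT : newton_tree T).

Lemma qn_up v w : v \in vertices T -> up v w -> 1 <= qn v w.
Proof. by move=> vV vw; apply: newton_Eplus_ge1; rewrite ?Eplus_up. Qed.

Lemma qn_root w : adj root w -> qn root w = 1.
Proof. by move=> rw; apply: newton_root; rewrite ?set2_incident. Qed.

Lemma exists_up v : v \in vertices T ->
  exists2 y, y \in arrows1 T & v != y /\ up v (step v y).
Proof.
move=> vV; have [y y1 /andP[vy vi]] := newton_arrow newtonT vV.
exists y => //; split=> //; have va := step_adj (T := T) vy; rewrite upC //.
case: (eqVneq v root) => [vr|vr]; first by apply/negP => /up_nroot; rewrite vr eqxx.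
apply/negP => /up_step vs.
by have := between_step vi vr vy; rewrite vs eqxx.
Qed.

Lemma Qn2_ge1 u v w : v \in vertices T -> up u v -> 1 <= Qn2 v u w.
Proof.
move=> vV uv; apply: prod_int_ge1 => w' /andP[vw' /andP[wu _]].
by apply: qn_up => //; apply: up_other uv vw' wu.
Qed.

Lemma Qn_ge1 u v : v \in vertices T -> up u v -> 1 <= Qn v u.
Proof.
move=> vV uv; apply: prod_int_ge1 => w' /andP[vw' wu].
by apply: qn_up => //; apply: up_other uv vw' wu.
Qed.

(** Induction through [BsE]: away from the root the products [Qn2] are at least 1, and condition (1)
    provides a branch with a positive term. A (0)-arrow gives 0, whence the restriction of
    positivity to vertices. *)
Lemma Bs_pos u v : adj u v -> up u v ->
  0 <= Bs u v /\ (v \in vertices T -> 0 < Bs u v).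
Proof.
move: u v; apply: branch_ind => u v uv IH upuv.
have [vV|v0|v1] := cell_cases v; first last.
- by rewrite Bs_arrow1.
- by rewrite Bs_arrow0 //; split=> // /vertex_n0; rewrite v0.
suff h : 0 < Bs u v by rewrite h ltW.
rewrite BsE ?vertex_n1 //.
have ge0 w : adj v w -> w != u -> 0 <= Qn2 v u w * Bs v w.
  move=> vw wu; apply: mulr_ge0.
    by apply: le_trans (Qn2_ge1 _ vV upuv).
  by have [] := IH w vw wu (up_other upuv vw wu).
have [y y1 [vy vsy]] := exists_up vV; set w := step v y in vsy *.
have vw := up_adj vsy.
have wu : w != u by apply: contraTneq vsy => ->; rewrite upC ?upuv // adjC.
rewrite (bigD1 w) ?vw //=; apply: ltr_wpDr.
  by apply: sumr_ge0 => a /andP[/andP[va au] _]; exact: ge0.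
apply: mulr_gt0; first exact: lt_le_trans (Qn2_ge1 _ vV upuv).
case wA : (w \in arrows T); last first.
  by have [_ h] := IH w vw wu vsy; apply: h; rewrite inE wA.
have wy : w = y by apply: step_arrow.
by rewrite Bs_arrow1 // wy.
Qed.

Lemma Bs_gt0 u v : v \in vertices T -> up u v -> 0 < Bs u v.
Proof. by move=> vV uv; have [_ ->] := Bs_pos (up_adj uv) uv. Qed.

(** Condition (6) and [Bs_gt0] make the right side of [edet_Bs] negative. In particular N_u > 0 as
    soon as u has a child that is a vertex, so dicritical vertices have none. *)
Lemma mult_up_lt u v : u \in vertices T -> v \in vertices T -> up u v ->
  qn u v * mult T v < Qn v u * mult T u.
Proof.
move=> uV vV uv; rewrite -subr_lt0 edet_Bs ?vertex_n1 ?up_adj //.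
by rewrite nmulr_rlt0 ?Bs_gt0 // (newton_det newtonT) ?up_adj.
Qed.

Context (minT : minimally_complete T).

Lemma mult_gt0_up u v : u \in vertices T -> v \in vertices T -> up u v ->
  0 < mult T u.
Proof.
move=> uV vV uv; have := mult_up_lt uV vV uv.
move/(le_lt_trans (mulr_ge0 (le_trans ler01 (qn_up uV uv)) (mc_mult_ge0 minT vV))).
by rewrite pmulr_rgt0 // (lt_le_trans ltr01) // Qn_ge1.
Qed.

Lemma dic_vertex u : u \in dicriticals T -> u \in vertices T.
Proof. by rewrite inE => /andP[]. Qed.

Lemma dic_mult0 u : u \in dicriticals T -> mult T u = 0.
Proof. by rewrite inE => /andP[_ /eqP]. Qed.

Lemma NN_vertex u : u \in NN T -> u \in vertices T.
Proof. by rewrite inE => /andP[]. Qed.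

Lemma NN_mult u : u \in NN T -> 0 < mult T u.
Proof. by rewrite inE => /andP[]. Qed.

Lemma vertex_cases u : u \in vertices T -> u \in NN T \/ u \in dicriticals T.
Proof.
move=> uV; have := mc_mult_ge0 minT uV; rewrite le_eqVlt eq_sym => /orP[]h.
  by right; rewrite inE uV.
by left; rewrite inE uV.
Qed.

Lemma dic_nNN u : u \in dicriticals T -> u \notin NN T.
Proof. by move/dic_mult0 => h; rewrite inE h ltxx andbF. Qed.

Lemma root_NN : root \in NN T.
Proof.
rewrite inE root_vertex mult_sum ?vertex_n1 ?root_vertex //=.
have [y y1 [vy vsy]] := exists_up root_vertex.
have rw := up_adj vsy; rewrite (bigD1 (step root y)) //=; apply: ltr_wpDr.
  apply: sumr_ge0 => a /andP[ra _]; apply: mulr_ge0.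
    by apply: prodr_ge0 => b /andP[rb _]; rewrite qn_root.
  by have [] := Bs_pos ra (up_root ra).
apply: mulr_gt0.
  by rewrite /Qn big1 // => b /andP[rb _]; rewrite qn_root.
have [_ h] := Bs_pos rw vsy.
case wA : (step root y \in arrows T); last by apply: h; rewrite inE wA.
by rewrite Bs_arrow1 // step_arrow.
Qed.

Lemma dic_nup u v : u \in dicriticals T -> v \in vertices T -> ~~ up u v.
Proof.
move=> uD vV; apply/negP => uv.
by have := mult_gt0_up (dic_vertex uD) vV uv; rewrite dic_mult0.
Qed.

Lemma dic_nbr u w : u \in dicriticals T -> w \in vertices T -> adj u w ->
  w = step u root /\ up w u.
Proof.
move=> uD wV uw; have wu : adj w u by rewrite adjC.
have h : up w u by rewrite upC // dic_nup.
by split=> //; rewrite (up_step h).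
Qed.

Lemma NN_nbr1 v w : v \in NN T -> adj v w -> w \notin arrows1 T.
Proof.
move=> vN vw; apply/negP => w1; have [u uD wu] := mc_arrow1 minT w1.
have wv : adj w v by rewrite adjC.
by move: (dic_nNN uD); rewrite (arrow_nbr (arrows1_arrow w1) wu wv) vN.
Qed.

Lemma NN_nbr_cases v w : v \in NN T -> adj v w ->
  [\/ w \in nbrs T v, w \in dics T v | w \in arrows0 T].
Proof.
move=> vN vw; have [wV|w0|w1] := cell_cases w.
- by have [h|h] := vertex_cases wV; [constructor 1|constructor 2]; rewrite inE h.
- by constructor 3.
- by move: (NN_nbr1 vN vw); rewrite w1.
Qed.

Lemma dead_endE v w : v \in vertices T ->
  ([set v; w] \in dead_ends T v) = adj v w && (w \in arrows0 T).
Proof.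
move=> vV; rewrite inE set2_incident; case vw : (adj v w) => //=.
rewrite /dead_end -[_ \in edges T]/(adj v w) vw /=.
apply/existsP/idP => [[x /andP[x0]]|w0]; last by exists w; rewrite w0 !inE eqxx orbT.
by rewrite in_set2 => /orP[]/eqP E; move: x0; rewrite E // (negbTE (vertex_n0 vV)).
Qed.

Lemma dead_ends_set2 v e : v \in vertices T -> e \in dead_ends T v ->
  exists w, [/\ adj v w, w \in arrows0 T & e = [set v; w]].
Proof.
move=> vV eD; have : e \in incident T v by move: eD; rewrite inE => /andP[].
case/edge_set2 => w vw E; exists w; split=> //.
by move: eD; rewrite E dead_endE // vw.
Qed.

Lemma arrow0_uniq v w w' : v \in vertices T -> adj v w -> adj v w' ->
  w \in arrows0 T -> w' \in arrows0 T -> w = w'.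
Proof.
move=> vV vw vw' w0 w0'; have := newton_dead_end newtonT vV.
move/card_le1_eqP => /(_ [set v; w] [set v; w']).
by rewrite !dead_endE // vw vw' w0 w0' => /(_ isT isT)/esym/(set2_inj vw vw').
Qed.

Lemma acoef0 v w : v \in vertices T -> adj v w -> w \in arrows0 T ->
  acoef T v = qn v w.
Proof.
move=> vV vw w0; rewrite /acoef; case: pickP => [e /(dead_ends_set2 vV)[w' [vw' w0' ->]]|].
  by rewrite (arrow0_uniq vV vw vw' w0 w0').
by move/(_ [set v; w]); rewrite dead_endE // vw w0.
Qed.

Lemma acoef1 v : v \in vertices T -> (forall w, adj v w -> w \notin arrows0 T) ->
  acoef T v = 1.
Proof.
move=> vV h; rewrite /acoef; case: pickP => // e /(dead_ends_set2 vV)[w [vw w0 _]].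
by move: (h w vw); rewrite w0.
Qed.

(** Extracts the dead-end factor from a product of decorations at v; the default value 1 of [acoef]
    covers vertices without dead end. *)
Lemma acoefE v (P : pred X) : v \in vertices T -> (forall w, w \in arrows0 T -> P w) ->
  \prod_(w | adj v w && P w) qn v w =
  acoef T v * \prod_(w | adj v w && (P w && (w \notin arrows0 T))) qn v w.
Proof.
move=> vV hP; case: (pickP (fun w => adj v w && (w \in arrows0 T))) => [w /andP[vw w0]|h].
  rewrite (bigD1 w) /= ?vw ?hP // (acoef0 vV vw w0); congr (_ * _).
  apply: eq_bigl => w'; case vw' : (adj v w') => //=; congr (_ && _); congr negb.
  by apply/eqP/idP => [->//|w0']; exact: arrow0_uniq vV vw' vw w0' w0.
rewrite acoef1 // ?mul1r => [|w vw]; last by move: (h w); rewrite vw /= => ->.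
apply: eq_bigl => w; case vw : (adj v w) => //=.
by move: (h w); rewrite vw /= => ->; rewrite andbT.
Qed.

Lemma acoef_ge1 v : v \in vertices T -> 1 <= acoef T v.
Proof.
move=> vV; case: (pickP (fun w => adj v w && (w \in arrows0 T))) => [w /andP[vw w0]|h].
  rewrite (acoef0 vV vw w0) qn_up //.
  by apply: arrow_adj_up; rewrite 1?adjC // arrows0_arrow.
by rewrite acoef1 // => w vw; move: (h w); rewrite vw /= => ->.
Qed.

Lemma acoef_gt1 v w : v \in NN T -> adj v w -> w \in arrows0 T -> 1 < acoef T v.
Proof.
move=> vN vw w0; have vV := NN_vertex vN.
rewrite lt_neqAle acoef_ge1 // andbT; apply/eqP => h.
have eD : [set v; w] \in dead_ends T v by rewrite dead_endE ?vw.
have := mc_dead_end minT vV eD; rewrite -/(qn v w) -(acoef0 vV vw w0) => /(_ (esym h)).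
by move/dic_nNN; rewrite vN.
Qed.

Lemma qn_up_uniq v w w' : v \in vertices T -> up v w -> up v w' ->
  1 < qn v w -> 1 < qn v w' -> w = w'.
Proof.
move=> vV vw vw' w1 w1'; have := newton_Eplus_gt1 newtonT vV.
move/card_le1_eqP => /(_ [set v; w] [set v; w']).
have h a : up v a -> 1 < qn v a ->
    [set v; a] \in [set e in Eplus T v | 1 < q T e v].
  by move=> va a1; rewrite inE Eplus_up va.
by move=> /(_ (h _ vw w1) (h _ vw' w1'))/esym/(set2_inj (up_adj vw) (up_adj vw')).
Qed.

(** By (5) the dead end carries the largest decoration going up and at most one of these exceeds 1,
    so a second one above 1 is impossible. *)
Lemma qn_dead_end v x w : v \in vertices T -> adj v x -> x \in arrows0 T ->
  up v w -> w != x -> qn v w = 1.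
Proof.
move=> vV vx x0 vw wx; have w1 := qn_up vV vw.
apply/eqP; rewrite eq_le w1 andbT leNgt; apply/negP => wgt.
have eD : [set v; x] \in dead_ends T v by rewrite dead_endE ?vx.
have [_ /(_ [set v; w])] := newton_max newtonT vV eD.
rewrite Eplus_up -/(qn v x) => /(_ vw) le.
have ux : up v x by apply: arrow_adj_up; rewrite 1?adjC // arrows0_arrow.
have := qn_up_uniq vV vw ux wgt (lt_le_trans wgt le).
by move/eqP; rewrite (negbTE wx).
Qed.

Lemma qn_coprime v w w' : v \in vertices T -> adj v w -> adj v w' -> w != w' ->
  coprimez (qn v w) (qn v w').
Proof.
move=> vV vw vw' ww'; apply: newton_coprime; rewrite ?set2_incident //.
by apply: contra ww' => /eqP/(set2_inj vw vw')->.
Qed.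

End NewtonTree.
End Newton.

(** * Characteristic numbers *)


(** Divisibility is needed in the rationals: c(u, e) is a gcd divided by some a_v. *)
Definition dvq (c x : rat) : Prop := exists k : int, x = k%:~R * c.

Lemma dvq0 c : dvq c 0.
Proof. by exists 0; rewrite mul0r. Qed.

Lemma dvqxx c : dvq c c.
Proof. by exists 1; rewrite mul1r. Qed.

Lemma dvqD c x y : dvq c x -> dvq c y -> dvq c (x + y).
Proof. by move=> [k ->] [l ->]; exists (k + l); rewrite rmorphD mulrDl. Qed.

Lemma dvqMl c (k : int) x : dvq c x -> dvq c (k%:~R * x).
Proof. by move=> [l ->]; exists (k * l); rewrite rmorphM mulrA. Qed.

Lemma dvqN c x : dvq c x -> dvq c (- x).
Proof. by move=> [l ->]; exists (- l); rewrite rmorphN mulNr. Qed.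

Lemma dvqB c x y : dvq c x -> dvq c y -> dvq c (x - y).
Proof. by move=> cx cy; apply: dvqD => //; apply: dvqN. Qed.

Lemma dvq_trans c x y : dvq c x -> dvq x y -> dvq c y.
Proof. by move=> cx [k ->]; exact: dvqMl. Qed.

Lemma dvq_sum (I : Type) (r : seq I) (P : pred I) c (F : I -> rat) :
  (forall i, P i -> dvq c (F i)) -> dvq c (\sum_(i <- r | P i) F i).
Proof. by move=> h; elim/big_ind: _ => //; [exact: dvq0 | exact: dvqD]. Qed.

Lemma dvq_le c x : 0 < c -> 0 < x -> dvq c x -> c <= x.
Proof.
move=> c0 x0 [k xE]; move: x0; rewrite xE pmulr_lgt0 // ltr0z => k0.
apply: ler_peMl; first exact: ltW.
by rewrite -[1]/(1%:~R : rat) ler_int -gtz0_ge1.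
Qed.

Lemma gcdqs_dvq (s : seq rat) x : x \in s -> dvq (gcdqs s) x.
Proof.
elim: s => //= y s IH.
have [k1 E1] : dvq (gcdq y (gcdqs s)) y.
  by apply/gcdqP; exists 1, 0; rewrite mul1r mul0r addr0.
have h2 : dvq (gcdq y (gcdqs s)) (gcdqs s).
  by apply/gcdqP; exists 0, 1; rewrite mul1r mul0r add0r.
rewrite inE => /orP[/eqP->|/IH]; first by exists k1.
exact: dvq_trans.
Qed.

Lemma gcdqs_max (s : seq rat) y : (forall x, x \in s -> dvq y x) -> dvq y (gcdqs s).
Proof.
elim: s => [|x s IH] h /=; first exact: dvq0.
have [m [n ->]] : exists m n : int, gcdq x (gcdqs s) = m%:~R * x + n%:~R * gcdqs s.
  by apply/gcdqP; exists 1; rewrite mul1r.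
apply: dvqD; apply: dvqMl; first by apply: h; rewrite inE eqxx.
by apply: IH => z zs; apply: h; rewrite inE zs orbT.
Qed.

Lemma gcdqs1 (k : int) : 0 <= k -> gcdqs [:: k%:~R] = k%:~R.
Proof.
move=> k0; rewrite /= /gcdq numq_int denq_int.
have [-> ->] : numq 0 = 0 /\ denq 0 = 1 by [].
by rewrite mulr1 mul0r gcdz0 divr1 gez0_abs.
Qed.

Lemma coprime_prod (I : finType) (P : pred I) (F : I -> int) a :
  (forall i, P i -> coprimez a (F i)) -> coprimez a (\prod_(i | P i) F i).
Proof.
move=> h; elim/big_ind: _ => // [|x y ax ay]; first by rewrite coprimezE coprimen1.
by rewrite coprimezMr ax.
Qed.

(* Omitting each of several pairwise coprime factors in turn gives products of gcd 1. *)
Lemma dvq_coprime_prod (I : finType) (A : {set I}) (F : I -> int) c x :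
  A != set0 ->
  (forall i j, i \in A -> j \in A -> i != j -> coprimez (F i) (F j)) ->
  (forall i, i \in A -> dvq c ((\prod_(j in A :\ i) F j)%:~R * x)) -> dvq c x.
Proof.
move: {2}#|A| (leqnn #|A|) => n.
elim: n A x => [|n IH] A x; first by rewrite leqn0 cards_eq0 => ->.
move=> An /set0Pn[i0 i0A] cop h; pose A' := A :\ i0.
have [A0|A0] := eqVneq A' set0.
  by have := h i0 i0A; rewrite -/A' A0 big_set0 mul1r.
have A'A j : j \in A' -> j \in A by rewrite inE => /andP[].
have c0 : dvq c ((F i0)%:~R * x).
  apply: (IH A') => //.
  - by move: An; rewrite (cardsD1 i0) i0A.
  - by move=> i j /A'A iA /A'A jA; apply: cop.
  move=> i iA'; have iA := A'A i iA'.
  have ii0 : i != i0 by move: iA'; rewrite inE in_set1 => /andP[].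
  have E : \prod_(j in A :\ i) F j = F i0 * \prod_(j in A' :\ i) F j.
    rewrite (bigD1 i0) /=; last by rewrite !inE eq_sym ii0.
    by congr (_ * _); apply: eq_bigl => j; rewrite !inE -andbA [(j \in A) && _]andbC.
  by have := h i iA; rewrite E rmorphM /= mulrAC mulrC.
have := h i0 i0A; rewrite -/A' => c1.
have cpr : coprimez (F i0) (\prod_(j in A') F j).
  apply: coprime_prod => j jA'; apply: cop => //; first exact: A'A.
  by move: jA'; rewrite !inE eq_sym => /andP[].
have [[u v] /= uv] := coprimezP _ _ cpr.
have -> : x = u%:~R * ((F i0)%:~R * x) + v%:~R * ((\prod_(j in A') F j)%:~R * x).
  by rewrite !mulrA -mulrDl -!rmorphM -rmorphD /= uv mul1r.
by apply: dvqD; exact: dvqMl.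
Qed.

Section Char.
Context {X : finType} (T : decorated_tree X).
Context (newtonT : newton_tree T) (minT : minimally_complete T).
Implicit Types (x y u v w z : X) (e f g : {set X}) (s : seq X).

Notation adj := (adj T).
Notation step := (step T).
Notation root := (Defs.root T).
Notation qn := (qn T).
Notation Qn := (Qn T).
Notation Qn2 := (Qn2 T).
Notation Bs := (Bs T).
Notation up := (up T).

Lemma dicsP v u : v \in NN T -> u \in dics T v ->
  [/\ u \in dicriticals T, up v u & v = step u root].
Proof.
move=> vN; rewrite inE => /andP[uD vu].
have uv : adj u v by rewrite adjC.
by have [] := dic_nbr newtonT minT uD (NN_vertex vN) uv.
Qed.

Lemma dic_nbr_cases u p w : u \in dicriticals T -> up p u -> adj u w -> w != p ->
  w \notin arrows0 T -> w \in arrows1 T.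
Proof.
move=> uD pu uw wp w0; have [wV|w0'|//] := cell_cases T w; last by rewrite w0' in w0.
have [wE _] := dic_nbr newtonT minT uD wV uw.
by rewrite wE (up_step pu) eqxx in wp.
Qed.

Lemma dic_qn1 u p w : u \in dicriticals T -> up p u -> adj u w -> w != p ->
  w \notin arrows0 T -> qn u w = 1.
Proof.
move=> uD pu uw wp w0; have uV := dic_vertex uD.
have [e eD] := mc_dicritical minT uD.
have [x [ux x0 _]] := dead_ends_set2 uV eD.
apply: (qn_dead_end newtonT uV ux x0); first exact: up_other pu uw wp.
by apply: contraNneq w0 => ->.
Qed.

Lemma par_notarrow p u : up p u -> p \notin arrows T.
Proof.
move=> pu; apply/negP => pA.
have := arrow_adj_up pA (up_adj pu); apply/negP.
by rewrite upC ?pu // adjC up_adj.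
Qed.

Lemma par_notin0 p u : up p u -> p \notin arrows0 T.
Proof. by move/par_notarrow; apply: contra; exact: arrows0_arrow. Qed.

Lemma dic_Qn u p : u \in dicriticals T -> up p u -> Qn u p = acoef T u.
Proof.
move=> uD pu; have uV := dic_vertex uD; rewrite /Qn (acoefE newtonT) //.
  rewrite big1 ?mulr1 // => w /and3P[uw wp w0]; exact: dic_qn1 uD pu uw wp w0.
by move=> w w0; apply: contraTneq w0 => ->; exact: par_notin0 pu.
Qed.

Lemma dic_Bs u p : u \in dicriticals T -> up p u ->
  Bs p u = acoef T u * (degree T u)%:Z.
Proof.
move=> uD pu; have uV := dic_vertex uD; rewrite BsE ?vertex_n1 ?up_adj //.
rewrite (bigID (mem (arrows1 T))) /= [X in _ + X]big1 ?addr0; last first.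
  move=> w /andP[/andP[uw wp] w1]; rewrite Bs_arrow0 ?mulr0 //.
  by apply: contraNT w1 => w0; exact: dic_nbr_cases uD pu uw wp w0.
rewrite (eq_bigr (fun=> acoef T u)) => [|w /andP[/andP[uw wp] w1]].
  rewrite big_const iter_addr_0 -mulr_natr; congr (_ * _).
  rewrite /degree natz; congr Posz; apply: eq_card => w.
  rewrite in_set -topredE /=; case uw : (adj u w); rewrite ?andbF //= andbT.
  case: eqP => [->|_] //=; apply/esym/negbTE; apply: contra (par_notarrow pu).
  exact: arrows1_arrow.
rewrite Bs_arrow1 // mulr1 /Qn2 (acoefE newtonT) //.
  rewrite big1 ?mulr1 // => w' /and3P[uw' /andP[wp' _] w0].
  exact: dic_qn1 uD pu uw' wp' w0.
move=> w' w0; apply/andP; split; apply: contraTneq w0 => ->.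
  exact: par_notin0 pu.
by apply/negP => /arrows0_n1; rewrite w1.
Qed.

(** N_u = 0 makes the two terms of [mult_split] at u cancel, and the sum on the side of u is known
    from [dic_Bs]. *)
Lemma dic_Bs_par u p : u \in dicriticals T -> up p u ->
  Bs u p = - (qn u p * (degree T u)%:Z).
Proof.
move=> uD pu; have a1 := acoef_ge1 newtonT (dic_vertex uD).
have := mult_split (up_adj pu) (vertex_n1 (dic_vertex uD)).
rewrite (dic_mult0 uD) dic_Bs // dic_Qn // => E.
have a0 : acoef T u != 0 by apply: contraTneq a1 => ->.
apply: (mulfI a0); rewrite -[LHS](addrK (qn u p * (acoef T u * degree T u))).
by rewrite [X in X - _]addrC -E; ring.
Qed.

Lemma kdetE u p : u \in dicriticals T -> up p u -> kdet T u = - edet T u p.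
Proof.
move=> uD pu; have pV : p \in vertices T by rewrite inE (par_notarrow pu).
rewrite /kdet; case: pickP => [w /andP[wV uw]|/(_ p)].
  by have [-> _] := dic_nbr newtonT minT uD wV uw; rewrite (up_step pu).
by rewrite pV adjC up_adj.
Qed.

(** [edet_Bs] with N_u = 0: the factor a_u appears on both sides, through Q(e, u) and [Bs v u], and
    cancels. *)
Lemma dic_mult v u : v \in NN T -> u \in dics T v ->
  [/\ mult T v = kdet T u * (degree T u)%:Z, 0 < kdet T u & (0 < degree T u)%N].
Proof.
move=> vN uDv; have [uD vu _] := dicsP vN uDv.
have vV := NN_vertex vN; have uV := dic_vertex uD; have vau := up_adj vu.
have a1 := acoef_ge1 newtonT uV.
have k0 : 0 < kdet T u.
  by rewrite (kdetE uD vu) oppr_gt0 -edetC // (newton_det newtonT).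
have B0 := Bs_gt0 newtonT uV vu; rewrite dic_Bs // in B0.
have d0 : (0 < degree T u)%N.
  by case: (degree T u) B0 => //; rewrite mulr0.
split=> //; have := edet_Bs vau (vertex_n1 vV) (vertex_n1 uV).
rewrite (dic_mult0 uD) mulr0 sub0r dic_Qn // dic_Bs // edetC // => E.
have a0 : acoef T u != 0 by apply: contraTneq a1 => ->.
apply: (mulfI a0); rewrite (kdetE uD vu) -[LHS]opprK E; ring.
Qed.

(* c(u, {u, w}). *)
Definition cc u w : rat := cnum T (u, [set u; w]).

Definition cgens u u0 : seq rat :=
  (dgcd T u0)%:~R :: [seq cc u0 w | w <- enum (nbrs T u0 :\ u)].

Lemma nbrsP v w : (w \in nbrs T v) = (w \in NN T) && adj v w.
Proof. by rewrite inE. Qed.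

(** The case eps(u0) = 1 of the definition is not special: [cgens] then has the single generator
    d(u0), which is its own gcd. *)
Lemma ccE u u0 : u \in NN T -> u0 \in NN T -> adj u u0 ->
  cc u u0 = gcdqs (cgens u u0) / (acoef T u0)%:~R.
Proof.
move=> uN u0N uu0; rewrite /cc cnumE //; case: ifP => // /cards1P[w E].
have uw : u \in nbrs T u0 by rewrite nbrsP uN adjC.
have -> : cgens u u0 = [:: (dgcd T u0)%:~R].
  rewrite /cgens; have -> : nbrs T u0 :\ u = set0; last by rewrite enum_set0.
  by apply/eqP; rewrite setD_eq0 E; move: uw; rewrite E in_set1 => /eqP->; exact: subxx.
rewrite gcdqs1 // /dgcd; case: ifP => // _; exact: ltW (NN_mult u0N).
Qed.

Lemma dvq_dgcd (y : rat) v : (forall x, x \in dics T v -> dvq y (degree T x)%:R) ->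
  dvq y (mult T v)%:~R -> dvq y (dgcd T v)%:~R.
Proof.
move=> hd hm; rewrite /dgcd; case: ifP => // _.
rewrite -[X in dvq _ X]/((\big[gcdn/0%N]_(u in dics T v) degree T u)%:R).
elim/big_ind: _ => [|m n ym yn|x /hd//]; first exact: dvq0.
have [a [b E]] := Bezoutz m n.
have -> : (gcdn m n)%:R = (a * m%:Z + b * n%:Z)%:~R :> rat by rewrite E.
by rewrite rmorphD !rmorphM; apply: dvqD; exact: dvqMl.
Qed.

Lemma dgcd_gt0 v : v \in NN T -> 0 < dgcd T v.
Proof.
move=> vN; rewrite /dgcd; case: ifP => [/andP[_ /set0Pn[x xD]]|_]; last exact: NN_mult.
have [_ _ d0] := dic_mult vN xD.
rewrite ltz_nat lt0n; apply: contraTneq d0 => E.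
have : (\big[gcdn/0]_(u in dics T v) degree T u %| degree T x)%N.
  by rewrite (bigD1 x) //= dvdn_gcdl.
by rewrite E dvd0n => /eqP->.
Qed.

Lemma dgcd_dvd v x : v \in NN T -> x \in dics T v ->
  dvq (dgcd T v)%:~R (degree T x)%:R.
Proof.
move=> vN xD; have -> : dgcd T v = (\big[gcdn/0%N]_(u in dics T v) degree T u)%:Z.
  by rewrite /dgcd /node vN; case: eqP => // E; rewrite E inE in xD.
have : (\big[gcdn/0]_(u in dics T v) degree T u %| degree T x)%N.
  by rewrite (bigD1 x) //= dvdn_gcdl.
by case/dvdnP => k ->; exists k; rewrite natrM.
Qed.

Lemma gens_gt0 u v : v \in NN T -> 0 < gcdqs (cgens u v).
Proof.
move=> vN; rewrite lt_neqAle gcdqs_ge0 andbT eq_sym; apply/eqP => g0.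
have [k] : dvq (gcdqs (cgens u v)) (dgcd T v)%:~R by apply: gcdqs_dvq; rewrite mem_head.
by rewrite g0 mulr0 => /eqP; rewrite intr_eq0 gt_eqF // dgcd_gt0.
Qed.

Lemma gens_dic u v x : v \in NN T -> x \in dics T v ->
  dvq (gcdqs (cgens u v)) (degree T x)%:R.
Proof.
move=> vN xD; apply: dvq_trans (dgcd_dvd vN xD).
by apply: gcdqs_dvq; rewrite mem_head.
Qed.

Lemma gens_nbr u v w : w \in nbrs T v -> w != u -> dvq (gcdqs (cgens u v)) (cc v w).
Proof.
move=> wv wu; apply: gcdqs_dvq; rewrite inE; apply/orP; right.
by apply: map_f; rewrite mem_enum in_setD1 wu.
Qed.

Lemma gens_max u v (y : rat) : dvq y (mult T v)%:~R ->
  (forall x, x \in dics T v -> dvq y (degree T x)%:R) ->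
  (forall w, w \in nbrs T v -> w != u -> dvq y (cc v w)) ->
  dvq y (gcdqs (cgens u v)).
Proof.
move=> hm hd hc; apply: gcdqs_max => x; rewrite inE => /orP[/eqP->|/mapP[w]].
  exact: dvq_dgcd.
by rewrite mem_enum in_setD1 => /andP[wu wv] ->; exact: hc.
Qed.

Lemma acoef_neq0 v : v \in vertices T -> (acoef T v)%:~R != 0 :> rat.
Proof. by move=> /(acoef_ge1 newtonT) h; rewrite intr_eq0 gt_eqF // (lt_le_trans _ h). Qed.

Lemma gens_cc u v : u \in NN T -> v \in NN T -> adj u v ->
  gcdqs (cgens u v) = (acoef T v)%:~R * cc u v.
Proof.
by move=> uN vN uv; rewrite ccE // mulrC divfK // acoef_neq0 // NN_vertex.
Qed.

Lemma cc_gt0 u v : u \in NN T -> v \in NN T -> adj u v -> 0 < cc u v.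
Proof.
move=> uN vN uv; rewrite ccE // divr_gt0 ?gens_gt0 // ltr0z.
exact: lt_le_trans (acoef_ge1 newtonT (NN_vertex vN)).
Qed.

(* g = a_v c(u, e) divides both sums attached to each branch at v other than u,
   hence a_v Bs v u times any product of the decorations at v omitting one of
   these branches; the decorations being coprime, g divides a_v Bs v u. *)
Lemma cc_dvq_Bs u v : adj u v -> u \in NN T -> v \in NN T ->
  dvq (cc u v) (Bs u v)%:~R /\ dvq (cc u v) (Bs v u)%:~R.
Proof.
move: u v; apply: branch_ind => u v uv IH uN vN.
have vV := NN_vertex vN; have vn1 := vertex_n1 vV.
have vu : adj v u by rewrite adjC.
set g := gcdqs (cgens u v); have gE := gens_cc uN vN uv; rewrite -/g in gE.
have nbrD w : adj v w -> w != u -> w \notin arrows0 T ->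
    dvq g (Bs v w)%:~R /\ dvq g (Bs w v)%:~R.
  move=> vw wu w0; case: (NN_nbr_cases minT vN vw) => [wn|wD|]; last by rewrite (negbTE w0).
    have wN : w \in NN T by move: wn; rewrite nbrsP => /andP[].
    have [h1 h2] := IH w vw wu vN wN.
    by split; apply: dvq_trans (gens_nbr wn wu) _.
  have [wd vuw _] := dicsP vN wD; have hd := gens_dic u vN wD.
  rewrite dic_Bs // dic_Bs_par // -!(mulNr, rmorphM) !rmorphM.
  by split; apply: dvqMl.
have Bvw w : adj v w -> w != u -> dvq g (Bs v w)%:~R.
  move=> vw wu; case w0 : (w \in arrows0 T); first by rewrite Bs_arrow0 //; exact: dvq0.
  by have [] := nbrD w vw wu (negbT w0).
have gB : dvq g (Bs u v)%:~R.
  rewrite BsE // rmorph_sum; apply: dvq_sum => w /andP[vw wu].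
  by rewrite rmorphM; apply: dvqMl; exact: Bvw.
split; first by apply: dvq_trans gB; exists (acoef T v).
suff [k E] : dvq g ((acoef T v)%:~R * (Bs v u)%:~R).
  exists k; apply: (mulfI (acoef_neq0 vV)); rewrite E gE; ring.
pose I := [set w | adj v w & (w != u) && (w \notin arrows0 T)].
have u0 : u \notin arrows0 T := vertex_n0 (NN_vertex uN).
(* [I] collects the branches at v other than u and the dead end. If there is none, both g and a_v
   [Bs v u] equal N_v. *)
have [I0|I0] := eqVneq I set0.
  have h w : adj v w -> w != u -> w \in arrows0 T.
    move=> vw wu; apply: contraT => w0; have : w \in I by rewrite inE vw wu.
    by rewrite I0 inE.
  have B0 : Bs u v = 0.
    by rewrite BsE // big1 // => w /andP[vw wu]; rewrite Bs_arrow0 ?mulr0 // h.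
  have QE : Qn v u = acoef T v.
    rewrite /Qn (acoefE newtonT) //.
      by rewrite big1 ?mulr1 // => w /and3P[vw wu /negP[]]; exact: h.
    by move=> w w0; apply: contraTneq w0 => ->.
  have -> : g = (mult T v)%:~R.
    have nD : dics T v = set0.
      apply/setP => x; rewrite [RHS]inE; apply/negP => xD.
      have [xd vx _] := dicsP vN xD.
      have /vertex_n0/negP[] := dic_vertex xd; apply: h; first exact: up_adj.
      by apply: contraTneq uN => <-; exact: dic_nNN.
    rewrite /g /cgens; have -> : nbrs T v :\ u = set0.
      apply/setP => x; rewrite [RHS]inE in_setD1 nbrsP; apply/negP => /and3P[xu xN vx].
      by have /vertex_n0/negP[] := NN_vertex xN; exact: h.
    by rewrite enum_set0 /dgcd /node nD eqxx andbF gcdqs1 // ltW // NN_mult.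
  rewrite (mult_split uv vn1) B0 mulr0 add0r QE rmorphM; exact: dvqxx.
apply: (@dvq_coprime_prod _ I (qn v)) => // [i j|i].
  rewrite !inE => /and3P[vi _ _] /and3P[vj _ _] ij; exact: qn_coprime.
rewrite inE => /and3P[vi iu i0]; have [_] := nbrD i vi iu i0.
have iv : adj i v by rewrite adjC.
(* Seen from the branch i, the sum [Bs i v] is a multiple of [Bs v u] plus terms divisible by g. The
   multiplier is a_v times the product of the decorations over [I] without i, as [dvq_coprime_prod]
   requires. *)
rewrite (BsE iv vn1) (bigD1 u) /=; last by rewrite vu eq_sym.
set R := \sum_(_ | _) _ => h.
have hR : dvq g R%:~R.
  rewrite /R rmorph_sum; apply: dvq_sum => w /andP[/andP[vw wi] wu].
  by rewrite rmorphM; apply: dvqMl; exact: Bvw.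
have := dvqB h hR; rewrite rmorphD addrK rmorphM.
have -> : Qn2 v i u = acoef T v * \prod_(j in I :\ i) qn v j.
  rewrite /Qn2 (acoefE newtonT) //; last first.
    by move=> w w0; apply/andP; split; apply: contraTneq w0 => ->.
  congr (_ * _); apply: eq_bigl => w; rewrite !inE -!andbA.
  by case: (adj v w); case: (w != i); case: (w != u); rewrite ?andbF.
by rewrite rmorphM /= -mulrA mulrCA mulrA.
Qed.

Lemma cc_dvq_mult u v : adj u v -> u \in NN T -> v \in NN T ->
  exists2 m : nat, (0 < m)%N & (mult T u)%:~R = m%:R * cc u v.
Proof.
move=> uv uN vN; have [h1 h2] := cc_dvq_Bs uv uN vN.
have c0 := cc_gt0 uN vN uv; have vu : adj v u by rewrite adjC.
have [k E] : dvq (cc u v) (mult T u)%:~R.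
  rewrite (mult_split vu (vertex_n1 (NN_vertex uN))) rmorphD !rmorphM.
  by apply: dvqD; apply: dvqMl.
have : 0 < (mult T u)%:~R :> rat by rewrite ltr0z NN_mult.
rewrite E pmulr_lgt0 // ltr0z; case: k E => // k E k0; by exists k.
Qed.

End Char.

(** * The local inequality for Delta *)


(** A positive integer quotient m different from 1 is at least 2; this is where the halves in the
    estimates of c come from. *)
Lemma multiple_half (N f : rat) (m : nat) :
  0 < N -> 0 < f -> N = m%:R * f -> f != N -> f <= N / 2.
Proof.
move=> N0 f0 E fN; have m2 : (2 <= m)%N.
  case: m E => [|[|m]] // E; last by rewrite E mul1r eqxx in fN.
  by move: N0; rewrite E mul0r ltxx.
have : 2 <= m%:R :> rat by rewrite (ler_nat _ 2).
rewrite E; nra.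
Qed.

(* With m_x = N / F x this is 1 - R <= g / (a N): if two of the integers m_x
   exceed 1 then R >= 1, and otherwise g is at least N / m_x for the
   exceptional x. *)
Lemma gcd_deficit (I : finType) (A : {set I}) (F : I -> rat) (N a g : rat) :
  0 < N -> 1 <= a -> 0 < g ->
  (forall x, x \in A -> 0 < F x /\ exists m : nat, N = m%:R * F x) ->
  (forall y, 0 < y -> dvq y N -> (forall x, x \in A -> dvq y (F x)) -> y <= g) ->
  N / a - \sum_(x in A) (N - F x) <= g / a.
Proof.
move=> N0 a1 g0 hF hg; have a0 : 0 < a by lra.
have half x : x \in A -> F x != N -> F x <= N / 2.
  by move=> /hF[f0 [m E]]; exact: multiple_half E.
have ia1 : a^-1 <= 1 by rewrite invf_le1.
have ia0 : 0 < a^-1 by rewrite invr_gt0.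
have term0 x : x \in A -> 0 <= N - F x.
  by move=> xA; case: (eqVneq (F x) N) => [->|/(half x xA)]; lra.
case: (pickP (fun x => (x \in A) && (F x != N))) => [x0 /andP[x0A x0N]|h0]; last first.
  have E x : x \in A -> F x = N by move=> xA; move: (h0 x); rewrite xA => /negbFE/eqP.
  rewrite big1 => [|x /E->]; last by rewrite subrr.
  rewrite subr0 ler_pM2r //; apply: hg => // [|x /E->]; exact: dvqxx.
have [f0 [m E0]] := hF x0 x0A.
rewrite (bigD1 x0) //=.
case: (pickP (fun x => [&& x \in A, x != x0 & F x != N]))
    => [x1 /and3P[x1A x10 x1N]|h1]; last first.
  have E x : x \in A -> x != x0 -> F x = N.
    by move=> xA xx0; move: (h1 x); rewrite xA xx0 => /negbFE/eqP.
  rewrite big1 ?addr0 => [|x /andP[xA xx0]]; last by rewrite E // subrr.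
  (* [F x0] divides N, the common value of all other [F x], hence is at most g; and dividing N -
     [F x0] by a >= 1 does not increase it. *)
  have : F x0 <= g.
    apply: hg => // [|x xA]; first by exists m.
    by case: (eqVneq x x0) => [->|/(E _ xA)->]; [exact: dvqxx | exists m].
  have := half x0 x0A x0N; nra.
rewrite (bigD1 x1) ?x1A //=.
set S := \sum_(_ | _) _; have S0 : 0 <= S by apply: sumr_ge0 => x /andP[/andP[/term0]].
have := half x0 x0A x0N; have := half x1 x1A x1N.
have : 0 <= g / a by rewrite divr_ge0 // ltW.
nra.
Qed.

Section Defect.
Context {X : finType} (T : decorated_tree X).
Context (newtonT : newton_tree T) (minT : minimally_complete T).
Implicit Types (x y u v w z : X) (e f g : {set X}) (s : seq X).

Notation adj := (adj T).
Notation qn := (qn T).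
Notation Qn := (Qn T).
Notation Bs := (Bs T).
Notation up := (up T).
Notation cc := (cc T).
Notation N v := ((mult T v)%:~R : rat).

(* Such a child w satisfies Q(e, v) Bs v w <= Bs u v, and |det e| Bs u v is
   smaller than Q(e, v) N_u; this is where valency <> 2 enters. *)
Lemma unit_child u v : v \in NN T -> up u v ->
  exists w, [/\ adj v w, w != u, w \notin arrows0 T & qn v w = 1].
Proof.
move=> vN uv; have vV := NN_vertex vN; have vu : adj v u by rewrite adjC up_adj.
have vr := up_nroot uv.
(* v has at least two children, being neither an arrow nor of valency 2. At most one of them has
   decoration above 1; if there is a dead end, all other children have decoration 1. *)
pose K := [set w | adj v w] :\ u.
have K2 : (1 < #|K|)%N.
  have := cardsD1 u [set w | adj v w]; rewrite -/K inE vu -valencyE add1n => E.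
  have := mc_valency minT vV vr; have : valency T v != 1%N.
    by move: vV; rewrite !inE vr.
  by rewrite E; case: #|K| => [|[|]].
have KP w : w \in K -> adj v w /\ w != u by rewrite !inE => /andP[].
have Kup w : w \in K -> up v w by move=> /KP[vw wu]; exact: up_other uv vw wu.
case: (pickP (fun x => adj v x && (x \in arrows0 T))) => [x /andP[vx x0]|h].
  have /card_gt0P[w] : (0 < #|K :\ x|)%N.
    by move: K2; rewrite (cardsD1 x); case: (x \in K); rewrite ?ltnS // => /ltnW.
  rewrite in_setD1 => /andP[wx wK]; have [vw wu] := KP w wK.
  exists w; split=> //; last exact: (qn_dead_end newtonT vV vx x0 (Kup w wK) wx).
  by apply: contra wx => w0; apply/eqP; exact: (arrow0_uniq newtonT vV vw vx).
have n0 w : adj v w -> w \notin arrows0 T by move=> vw; move: (h w); rewrite vw /= => ->.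
have /card_gt1P[w1 [w2 [w1K w2K w12]]] := K2.
have [vw1 w1u] := KP w1 w1K; have [vw2 w2u] := KP w2 w2K.
have := qn_up newtonT vV (Kup _ w1K); rewrite le_eqVlt => /orP[/eqP E|q1].
  by exists w1; split=> //; exact: n0.
have := qn_up newtonT vV (Kup _ w2K); rewrite le_eqVlt => /orP[/eqP E|q2].
  by exists w2; split=> //; exact: n0.
by have := qn_up_uniq newtonT vV (Kup _ w1K) (Kup _ w2K) q1 q2; move/eqP: w12.
Qed.

(** With w from [unit_child], the gcd a_v c(u, v) divides the positive integer [Bs v w], so c(u, v)
    <= [Bs v w] < N_u. That integer being at least 1 also gives N_u > 1. *)
Lemma up_gap u v : u \in NN T -> v \in NN T -> up u v ->
  cc u v < N u /\ 1 < mult T u.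
Proof.
move=> uN vN uv; have uV := NN_vertex uN; have vV := NN_vertex vN.
have auv := up_adj uv.
have [w [vw wu w0 qw1]] := unit_child vN uv.
have upw : up v w := up_other uv vw wu.
have wV : w \in vertices T.
  by have [//|w0'|w1] := cell_cases T w; [rewrite w0' in w0 | move: (NN_nbr1 minT vN vw); rewrite w1].
have B0 := Bs_gt0 newtonT wV upw.
have BvE : Qn v u * Bs v w <= Bs u v.
  rewrite (BsE auv (vertex_n1 vV)) (bigD1 w) ?vw //=.
  rewrite (Qn_split vw wu) qw1 mul1r Qn2C Qn2C lerDl sumr_ge0 // => x /andP[/andP[vx xu] _].
  rewrite mulr_ge0 ?(le_trans _ (Qn2_ge1 newtonT _ vV uv)) //.
  by have [] := Bs_pos newtonT vx (up_other uv vx xu).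
have Q1 := Qn_ge1 newtonT vV uv.
have d0 := newton_det newtonT uV vV auv.
have := edet_Bs auv (vertex_n1 uV) (vertex_n1 vV).
have q1 := qn_up newtonT uV uv; have mv := NN_mult vN; have mu := NN_mult uN => E.
have Q0 : 0 < Qn v u := lt_le_trans ltr01 Q1.
have h1 : 0 < qn u v * mult T v by apply: mulr_gt0 => //; exact: lt_le_trans ltr01 q1.
have h2 : Bs u v <= - (edet T u v * Bs u v).
  rewrite -mulNr ler_peMl //; last by rewrite -gtz0_ge1 oppr_gt0.
  by apply: le_trans BvE; apply: mulr_ge0; exact: ltW.
have lt : Bs v w < mult T u.
  rewrite -(ltr_pM2l Q0); apply: le_lt_trans BvE (le_lt_trans h2 _).
  by rewrite -E opprB ltrBlDr ltrDl.
split; last by apply: le_lt_trans lt; rewrite -gtz0_ge1.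
have hg : dvq (gcdqs (cgens T u v)) (Bs v w)%:~R.
  case: (NN_nbr_cases minT vN vw) => [wn|wD|]; last by rewrite (negbTE w0).
    have wN : w \in NN T by move: wn; rewrite nbrsP => /andP[].
    have [hB _] := cc_dvq_Bs newtonT minT vw vN wN.
    exact: dvq_trans (gens_nbr wn wu) hB.
  have [wd vuw _] := dicsP newtonT minT vN wD.
  by rewrite (dic_Bs newtonT minT) // rmorphM; apply: dvqMl; exact: gens_dic.
have gle : gcdqs (cgens T u v) <= (Bs v w)%:~R.
  by apply: dvq_le hg; rewrite ?ltr0z // gens_gt0.
rewrite (gens_cc newtonT) // in gle.
have c0 := cc_gt0 newtonT minT uN vN auv.
have a1 : 1 <= (acoef T v)%:~R :> rat by rewrite (ler_int _ 1) acoef_ge1.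
have : (Bs v w)%:~R < N u by rewrite ltr_int.
nra.
Qed.

Lemma up_cc_half u v : u \in NN T -> v \in NN T -> up u v -> cc u v <= N u / 2.
Proof.
move=> uN vN uv; have auv := up_adj uv.
have [m _ E] := cc_dvq_mult newtonT minT auv uN vN.
apply: multiple_half E _; first by rewrite ltr0z NN_mult.
  exact: cc_gt0.
by have [h _] := up_gap uN vN uv; rewrite lt_eqF.
Qed.

Lemma cc_le_mult u v : u \in NN T -> v \in NN T -> adj u v -> cc u v <= N u.
Proof.
move=> uN vN uv; have [m m0 ->] := cc_dvq_mult newtonT minT uv uN vN.
by rewrite ler_peMl ?ler1n // ltW // cc_gt0.
Qed.

Lemma mem_dics v x : (x \in dics T v) = (x \in dicriticals T) && adj v x.
Proof. by rewrite inE. Qed.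

Lemma dics_card v : v \in NN T ->
  #|[set u in vertices T | adj v u]| = (eps T v + #|dics T v|)%N.
Proof.
move=> vN; have -> : [set u in vertices T | adj v u] = nbrs T v :|: dics T v.
  apply/setP => x; apply/idP/setUP => [|[]]; first rewrite inE => /andP[xV vx].
  - by case: (vertex_cases minT xV) => h; [left|right]; rewrite inE h vx.
  - by rewrite nbrsP inE => /andP[/NN_vertex->].
  - by rewrite mem_dics inE => /andP[/dic_vertex->].
rewrite /eps cardsU [X in (_ - X)%N](_ : _ = 0%N) ?subn0 //.
apply/eqP; rewrite cards_eq0; apply/eqP/setP => x; rewrite [RHS]inE; apply/negP.
by rewrite in_setI nbrsP => /andP[/andP[xN _]]; rewrite inE => /andP[/dic_nNN]; rewrite xN.
Qed.

(** Here r_v - 1 = eps(v) + |D_v| - 2, and each dicritical neighbour combines N_v - 1 with -(d_u -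
    1) into N_v - d_u. *)
Lemma DeltaE v : v \in NN T ->
  Delta T v = ((eps T v)%:R - 2) * (N v - 1)
    + \sum_(x in dics T v) (N v - (degree T x)%:R)
    + (N v - N v / (acoef T v)%:~R).
Proof.
move=> vN; rewrite /Delta /rcoef dics_card // !sumrB.
rewrite !sumr_const -(mulr_natr (N v)) PoszD; move: #|dics T v| => d.
rewrite [(mult T v - 1)%:~R]rmorphB !(rmorphD, rmorphN) /= -!pmulrn.
by rewrite div1r; ring.
Qed.

Lemma dics_term v x : v \in NN T -> x \in dics T v ->
  N v * (1 - 1 / (kdet T x)%:~R) = N v - (degree T x)%:R.
Proof.
move=> vN xD; have [-> k0 _] := dic_mult newtonT minT vN xD.
rewrite rmorphM /=; have : (kdet T x)%:~R != 0 :> rat by rewrite intr_eq0 gt_eqF.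
rewrite -pmulrn => h; field; exact: h.
Qed.

Lemma mult_RR v : v \in NN T -> N v * RR T v set0 =
  \sum_(x in dics T v) (N v - (degree T x)%:R) + (N v - N v / (acoef T v)%:~R).
Proof.
move=> vN; rewrite /RR big_set0 addr0 mulrDr mulr_sumr.
rewrite (eq_bigr (fun x => N v - (degree T x)%:R)) => [|x /dics_term-> //].
by congr (_ + _); rewrite mulrBr mulr1 mulrA mulr1.
Qed.

Lemma Delta_RR v : v \in NN T ->
  Delta T v = ((eps T v)%:R - 2) * (N v - 1) + N v * RR T v set0.
Proof. by move=> vN; rewrite DeltaE // mult_RR // -addrA. Qed.

Lemma RR_set1 v w : v \in NN T -> w \in NN T -> adj v w ->
  N v * RR T v [set [set v; w]] = N v * RR T v set0 + (N v - cc v w).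
Proof.
move=> vN wN vw; rewrite /RR big_set0 big_set1 addr0 mulrDr; congr (_ + _).
have c0 := cc_gt0 newtonT minT vN wN vw.
have m0 : 0 < N v by rewrite ltr0z NN_mult.
rewrite /MM /= -/(cc v w); field.
by rewrite !gt_eqF.
Qed.

(** After [DeltaE] this is [gcd_deficit] for the degrees d_x of the dicritical neighbours of v and
    the numbers c(v, f) of its edges f in N other than {u, v}. *)
Lemma Delta_step u v : u \in NN T -> v \in NN T -> adj u v ->
  1 - cc u v <= Delta T v + \sum_(w in nbrs T v :\ u) (1 - cc v w).
Proof.
move=> uN vN uv; have vV := NN_vertex vN.
pose F x := if x \in dics T v then (degree T x)%:R else cc v x.
pose A := dics T v :|: (nbrs T v :\ u).
have nD x : x \in nbrs T v -> x \notin dics T v.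
  rewrite nbrsP => /andP[xN _]; apply/negP; rewrite inE => /andP[xD _].
  by move: (dic_nNN xD); rewrite xN.
have uv' : u \in nbrs T v by rewrite nbrsP uN adjC.
have epsE : (eps T v)%:R = 1 + #|nbrs T v :\ u|%:R :> rat.
  by rewrite /eps (cardsD1 u) uv' natrD.
have m0 : 0 < N v by rewrite ltr0z NN_mult.
have a1 : 1 <= (acoef T v)%:~R :> rat by rewrite (ler_int _ 1) acoef_ge1.
have hF x : x \in A -> 0 < F x /\ exists m : nat, N v = m%:R * F x.
  rewrite in_setU /F => /orP[xD|].
    rewrite xD; have [-> k0 d0] := dic_mult newtonT minT vN xD.
    rewrite ltr0n d0; split=> //; case: (kdet T x) k0 => // k _; exists k.
    by rewrite rmorphM /= -pmulrn.
  rewrite in_setD1 => /andP[xu xn]; rewrite (negbTE (nD x xn)).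
  move: xn; rewrite nbrsP => /andP[xN vx]; split; first exact: cc_gt0.
  by have [m _ E] := cc_dvq_mult newtonT minT vx vN xN; exists m.
have g0 := gens_gt0 newtonT minT u vN.
have hg (y : rat) : 0 < y -> dvq y (N v) -> (forall x, x \in A -> dvq y (F x)) ->
    y <= gcdqs (cgens T u v).
  move=> y0 yN yF; apply: dvq_le => //; apply: gens_max => // [x xD|w wn wu].
    by have := yF x; rewrite /F /A in_setU xD => /(_ isT).
  have := yF w; rewrite /F /A in_setU in_setD1 wu wn orbT (negbTE (nD w wn)).
  by move=> /(_ isT).
have := gcd_deficit m0 a1 g0 hF hg.
rewrite (gens_cc newtonT) // [_ * cc u v]mulrC mulfK ?acoef_neq0 //.
have -> : \sum_(x in A) (N v - F x) =
    \sum_(x in dics T v) (N v - (degree T x)%:R) + \sum_(w in nbrs T v :\ u) (N v - cc v w).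
  rewrite (big_setID (dics T v)) /=; congr (_ + _).
    have -> : A :&: dics T v = dics T v.
      by apply/setP => x; rewrite in_setI in_setU; case: (x \in dics T v); rewrite ?andbF.
    by apply: eq_bigr => x xD; rewrite /F xD.
  have -> : A :\: dics T v = nbrs T v :\ u.
    apply/setP => x; rewrite in_setD in_setU in_setD1.
    by case: (boolP (x \in nbrs T v)) => [/nD/negbTE->//|_]; rewrite andbF orbF andNb.
  apply: eq_bigr => x; rewrite in_setD1 => /andP[_ /nD/negbTE xD].
  by rewrite /F xD.
rewrite DeltaE // epsE !sumrB !sumr_const -!(mulr_natr (N v)).
move: (#|dics T v|%:R : rat) (#|nbrs T v :\ u|%:R : rat) (N v) (N v / _) => d n m b.
move: (\sum_(_ in _) _) (\sum_(_ in _) _) => S1 S2; lra.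
Qed.

(** a_v divides N_v: in [mult_sum] each Q(e, v) contains the decoration of the dead end, except when
    e is the dead end, and there [Bs] is 0. *)
Lemma Delta_int v : v \in NN T -> exists k : int, Delta T v = k%:~R.
Proof.
move=> vN; have vV := NN_vertex vN.
have [k E] : exists k, mult T v = k * acoef T v.
  apply/dvdzP; rewrite mult_sum ?vertex_n1 //; apply: rpred_sum => w vw.
  case w0 : (w \in arrows0 T); first by rewrite Bs_arrow0 // mulr0 rpred0.
  rewrite /Qn (acoefE newtonT) // => [|x x0]; last by apply: contraTneq x0 => ->; rewrite w0.
  by rewrite -mulrA; apply: dvdz_mulr; exact: dvdzz.
have aE : N v / (acoef T v)%:~R = k%:~R.
  by rewrite E rmorphM mulfK // acoef_neq0.
rewrite /Delta mulrBr mulr1 mulrA mulr1 aE sumrB sumr_const.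
exists ((rcoef T v - 1) * (mult T v - 1) + (mult T v - k)
  - ((\sum_(x in dics T v) degree T x)%N%:Z - #|dics T v|%:Z)).
by rewrite !(rmorphB, rmorphD, rmorphM) /= -!pmulrn natr_sum.
Qed.

End Defect.

(** * Teeth *)


Section Skeleton.
Context {X : finType} (T : decorated_tree X).
Context (newtonT : newton_tree T) (minT : minimally_complete T).
Implicit Types (t x y u v w z : X) (e f g : {set X}) (s : seq X).

Notation adj := (adj T).
Notation step := (step T).
Notation gamma := (gamma T).
Notation up := (up T).
Notation cc := (cc T).
Notation N v := ((mult T v)%:~R : rat).

(** N is connected, because a dicritical cell has a single adjacent vertex and so cannot lie inside
    a path between two vertices. *)
Lemma step_NN u z : u \in NN T -> z \in NN T -> u != z -> step u z \in NN T.
Proof.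
move=> uN zN uz; have uy := step_adj (T := T) uz; set y := step u z in uy *.
case: (eqVneq y z) => [->//|yz].
have yu : adj y u by rewrite adjC.
have yu' : step y z != u by rewrite -step_dich // eqxx.
have yy' := step_adj (T := T) yz.
have yV : y \in vertices T.
  rewrite inE; apply/negP => yA.
  by rewrite (arrow_nbr yA yy' yu) eqxx in yu'.
have [//|yD] := vertex_cases minT yV.
have [uE _] := dic_nbr newtonT minT yD (NN_vertex uN) yu.
case y'A : (step y z \in arrows T).
  have zV := NN_vertex zN; rewrite inE in zV.
  have sz := step_arrow yz y'A.
  by rewrite -sz y'A in zV.
have y'V : step y z \in vertices T by rewrite inE y'A.
have [E _] := dic_nbr newtonT minT yD y'V yy'.
by rewrite E uE eqxx in yu'.
Qed.

Lemma gamma_NN u z w : u \in NN T -> z \in NN T -> w \in gamma u z -> w \in NN T.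
Proof.
move=> + zN; elim/(gamma_ind (T := T) (y := z)): u => [|u uz IH] uN.
  by rewrite gammaxx inE => /eqP->.
rewrite gammaE // in_cons => /orP[/eqP->//|]; apply: IH; exact: step_NN.
Qed.

Lemma step_nbrs u z : u \in NN T -> z \in NN T -> u != z -> step u z \in nbrs T u.
Proof. by move=> uN zN uz; rewrite nbrsP step_NN ?step_adj. Qed.

Lemma eps1_uniq v x y : eps T v = 1%N -> x \in nbrs T v -> y \in nbrs T v -> x = y.
Proof. by move/eqP/cards1P => [a ->]; rewrite !in_set1 => /eqP-> /eqP->. Qed.

Lemma eps2_other v x y z : eps T v = 2%N -> x \in nbrs T v -> y \in nbrs T v ->
  z \in nbrs T v -> y != x -> z != x -> y = z.
Proof.
move=> e2 xv yv zv yx zx; have : #|nbrs T v :\ x| == 1%N.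
  by have := cardsD1 x (nbrs T v); rewrite -/(eps T v) e2 xv add1n => -[<-].
have yv' : y \in nbrs T v :\ x by rewrite in_setD1 yx.
have zv' : z \in nbrs T v :\ x by rewrite in_setD1 zx.
by case/cards1P => a E; move: yv' zv'; rewrite E !in_set1 => /eqP-> /eqP->.
Qed.

Definition chain v w := [/\ v != w, v \in NN T, w \in NN T, eps T v = 1%N
  & forall x, x \in gamma v w -> x != v -> x != w -> eps T x = 2%N].

(** Cells of valency 2 in N leave no room to branch off, and the path stops at the leaf v: on the
    side of v as seen from w, N is the chain itself. *)
Lemma chain_branch v w x : chain v w -> x \in NN T -> x != w ->
  step w x = step w v -> x \in gamma v w.
Proof.
case=> vw vN wN e1 h xN xw swx; rewrite mem_gammaC.
have {}h y : y \in gamma w v -> y != v -> y != w -> eps T y = 2%N.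
  by rewrite mem_gammaC; exact: h.
elim/(gamma_ind (T := T) (y := v)): w vw wN h xw swx => [|w wv IH] vw wN h xw swx.
  by rewrite eqxx in vw.
rewrite gammaE // in_cons (negbTE xw) /=.
have wy := step_adj (T := T) wv; have yN := step_NN wN vN wv.
set y := step w v in wy yN IH swx *.
have yw : y != w := adj_neq wy.
case: (eqVneq x y) => [->|xy]; first exact: mem_gammal.
have syx : step y x != w by rewrite -step_dich // swx.
have wny : w \in nbrs T y by rewrite nbrsP wN adjC.
have xny : step y x \in nbrs T y by apply: step_nbrs; rewrite // eq_sym.
case: (eqVneq y v) => [yv|yv].
  by move: wny xny syx; rewrite yv => a b; rewrite (eps1_uniq e1 b a) eqxx.
have yi : y \in gamma w v by rewrite gammaE // in_cons mem_gammal orbT.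
have syv : step y v != w by rewrite -step_dich ?eqxx.
have vny : step y v \in nbrs T y by apply: step_nbrs.
apply: IH => //; first by rewrite eq_sym.
  move=> a ai av ay; apply: h => //; first exact: mem_gamma_trans yi ai.
  by apply: contraTneq ai => ->; exact: notin_step wv.
exact: eps2_other (h y yi yv yw) wny xny vny syx syv.
Qed.

Lemma chain_nbr v w y u : chain v w -> y \in gamma v w -> y != w ->
  u \in nbrs T y -> u \in gamma v w.
Proof.
move=> ch yi yw; rewrite nbrsP => /andP[uN yu].
case: (eqVneq u w) => [->|uw]; first exact: mem_gammar.
have wv : w != v by case: ch => vw *; rewrite eq_sym.
have syv : step w y = step w v by apply: step_prefix; rewrite // mem_gammaC.
apply: (chain_branch ch) => //; rewrite -syv; apply/eqP/negPn/negP => ns.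
have wy : w != y by rewrite eq_sym.
have := step_between wy ns; have uy : adj u y by rewrite adjC.
rewrite gammaE ?(adj_neqC uy) // step_adjE // gammaxx in_cons in_cons.
by rewrite eq_sym (negbTE uw) (negbTE wy).
Qed.

(** Iteration of [Delta_step] from w to the leaf v: inside, Delta is 0 and a single term is passed
    on. *)
Lemma chain_cc v w : chain v w ->
  (forall x, x \in gamma v w -> x != v -> x != w -> Delta T x = 0) ->
  1 - cc w (step w v) <= Delta T v.
Proof.
case=> vw vN wN e1 h h0.
have {}h y : y \in gamma w v -> y != v -> y != w -> eps T y = 2%N.
  by rewrite mem_gammaC; exact: h.
have {}h0 y : y \in gamma w v -> y != v -> y != w -> Delta T y = 0.
  by rewrite mem_gammaC; exact: h0.
elim/(gamma_ind (T := T) (y := v)): w vw wN h h0 => [|w wv IH] vw wN h h0.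
  by rewrite eqxx in vw.
have wy := step_adj (T := T) wv; have yN := step_NN wN vN wv.
set y := step w v in wy yN IH *.
have yw : y != w := adj_neq wy.
have wny : w \in nbrs T y by rewrite nbrsP wN adjC.
have := Delta_step newtonT minT wN yN wy.
case: (eqVneq y v) => [yv|yv].
  rewrite yv big1 ?addr0 // => x; rewrite in_setD1 => /andP[xw xn].
  by rewrite yv in wny; rewrite (eps1_uniq e1 xn wny) eqxx in xw.
have yi : y \in gamma w v by rewrite gammaE // in_cons mem_gammal orbT.
have syv : step y v != w by rewrite -step_dich ?eqxx.
have vny : step y v \in nbrs T y by apply: step_nbrs.
rewrite (h0 y yi yv yw) add0r (big_pred1 (step y v)) => [|x].
  move/le_trans; apply; apply: IH => //; first by rewrite eq_sym.
    move=> a ai av ay; apply: h => //; first exact: mem_gamma_trans yi ai.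
    by apply: contraTneq ai => ->; exact: notin_step wv.
  move=> a ai av ay; apply: h0 => //; first exact: mem_gamma_trans yi ai.
  by apply: contraTneq ai => ->; exact: notin_step wv.
apply/idP/eqP => [|->]; last by rewrite in_setD1 syv vny.
rewrite in_setD1 => /andP[xw xn].
exact: eps2_other (h y yi yv yw) wny xn vny xw syv.
Qed.

Definition tooth_path v w := Gamma T (gamma v w).

Lemma gamma_rcons v w : v != w -> exists p,
  [/\ gamma v w = v :: rcons p w, last v p = step w v
    & forall x, x \in p = [&& x \in gamma v w, x != v & x != w]].
Proof.
move=> vw; have := gamma_uniq T v w; have := gamma_path T v w.
have := gamma_last T v w v; rewrite gamma_cons.
case: (lastP (behead (gamma v w))) (gamma_cons T v w) => [_ /= E|p a E].
  by rewrite E eqxx in vw.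
rewrite -[v :: rcons p a in X in X -> _]/([:: v] ++ rcons p a) last_cat last_rcons.
move=> aw; rewrite {}aw in E *; rewrite rcons_path => /andP[_ lw] un.
exists p; split=> //.
  have wl : adj w (last v p) by rewrite adjC.
  apply/esym/(mem_gamma_adj wl); rewrite mem_gammaC E -rcons_cons mem_rcons in_cons.
  by rewrite -[_ \in v :: p]/(last v p \in v :: p) mem_last orbT.
move=> x; rewrite in_cons mem_rcons in_cons.
move: un; rewrite cons_uniq mem_rcons in_cons negb_or rcons_uniq => /and3P[/andP[_ vp] wp _].
case: (eqVneq x v) => [->|_]; first by rewrite (negbTE vp) andbF.
by case: (eqVneq x w) => [->|_] /=; rewrite ?(negbTE wp) ?andbT.
Qed.

(** Since Delta vanishes inside the path, its total reduces to the values at the two ends. *)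
Lemma tooth_pathP v w : tooth_path v w <->
  [/\ chain v w, forall x, x \in gamma v w -> x != v -> x != w -> Delta T x = 0,
      Delta T v <= 0, 0 < Delta T v + Delta T w & up w (step w v)].
Proof.
rewrite /tooth_path /chain; case: (eqVneq v w) => [->|vw].
  by rewrite gammaxx /=; split=> [|[[//]]]; rewrite andbF /= ?andbF.
have [p [E lE pE]] := gamma_rcons vw.
have un := gamma_uniq T v w; have pth := gamma_path T v w.
have DS : (forall x, x \in gamma v w -> x != v -> x != w -> Delta T x = 0) ->
    DeltaS T [set:: v :: rcons p w] = Delta T v + Delta T w.
  move=> h; rewrite /DeltaS (bigD1 v) /=; last by rewrite inE mem_head.
  rewrite (bigD1 w) /=; last by rewrite inE in_cons mem_rcons mem_head orbT eq_sym.
  rewrite big1 ?addr0 // => x /andP[/andP[+ xv] xw].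
  by rewrite inE -E => xi; exact: h.
have tE : tlt T w (step w v) = up w (step w v).
  by apply: tlt_up; apply: step_adj; rewrite eq_sym.
have pp : path adj v (rcons p w) by move: pth; rewrite E.
have -> : Gamma T (gamma v w) = [&& (v \in NN T) && all [in NN T] (rcons p w),
    eps T v == 1%N & all (fun z => (eps T z == 2%N) && (Delta T z == 0)) p] &&
    [&& Delta T v <= 0, 0 < DeltaS T [set:: v :: rcons p w] & up w (step w v)].
  move: un; rewrite E /= belast_rcons last_rcons /= lE tE pp size_rcons => -> /=.
  by rewrite -!andbA.
split=> [/andP[/and3P[aN /eqP e1 /allP h] /and3P[dv dS u]]|[[_ vN wN e1 h] h0 dv dS u]].
  have {}h x : x \in gamma v w -> x != v -> x != w -> eps T x = 2%N /\ Delta T x = 0.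
    by move=> xi xv xw; have := h x; rewrite pE xi xv xw => /(_ isT)/andP[/eqP-> /eqP->].
  have h0 x : x \in gamma v w -> x != v -> x != w -> Delta T x = 0.
    by move=> xi xv xw; have [] := h x xi xv xw.
  move: aN; rewrite all_rcons => /and3P[vN wN _].
  rewrite DS // in dS; split=> //.
  by split=> // x xi xv xw; have [] := h x xi xv xw.
rewrite DS // dv dS u e1 eqxx !andbT /=.
apply/andP; split.
  rewrite vN all_rcons wN /=; apply/allP => x; rewrite pE => /and3P[xi _ _].
  exact: gamma_NN xi.
by apply/allP => x; rewrite pE => /and3P[xi xv xw]; rewrite (h x) // (h0 x) // !eqxx.
Qed.

Lemma mem_VV v w : (v \in VV T w) = tooth_path v w.
Proof. by rewrite inE. Qed.

End Skeleton.

(** * The skeleton *)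


Section Skeleton2.
Context {X : finType} (T : decorated_tree X).
Context (newtonT : newton_tree T) (minT : minimally_complete T).
Implicit Types (t x y u v w z : X) (e f g : {set X}) (s : seq X).

Notation adj := (adj T).
Notation step := (step T).
Notation gamma := (gamma T).
Notation up := (up T).
Notation cc := (cc T).
Notation N v := ((mult T v)%:~R : rat).
Notation S := (skeleton T).

Lemma last_edge v w : v != w ->
  last set0 (path_edges (gamma v w)) = [set w; step w v].
Proof.
move=> vw; have [p [-> <- _]] := @gamma_rcons _ T _ _ vw.
by rewrite /= -cats1 pairmap_cat last_cat /= setUC.
Qed.

Lemma tooth_neq v w : tooth_path T v w -> v != w.
Proof. by case/(tooth_pathP newtonT minT) => -[]. Qed.

Lemma tooth_interior v w x : tooth_path T v w -> x \in gamma v w -> x != w ->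
  x \in NN T /\ Delta T x <= 0.
Proof.
move=> tp xi xw; have [[_ vN wN _ _] h0 dv _ _] := iffLR (tooth_pathP newtonT minT v w) tp.
split; first exact: gamma_NN xi.
by case: (eqVneq x v) => [->//|xv]; rewrite h0.
Qed.

Lemma skelP x : reflect
  (x \in NN T /\ forall v w, tooth_path T v w -> x \in gamma v w -> x = w)
  (x \in S).
Proof.
rewrite in_setD andbC; apply: (iffP andP) => -[xN h]; split=> //.
  move=> v w vw xi; apply/eqP; apply: contraR h => xw.
  have wW : w \in WW T by rewrite inE; apply/existsP; exists v.
  apply/bigcupP; exists w => //; rewrite in_setD1 xw /Vbar wW.
  by apply/bigcupP; exists v; rewrite ?mem_VV // inE.
apply/bigcupP => -[w wW]; rewrite in_setD1 /Vbar wW => /andP[xw /bigcupP[v]].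
by rewrite mem_VV inE => vw xi; rewrite (h v w vw xi) eqxx in xw.
Qed.

Lemma skel_NN x : x \in S -> x \in NN T.
Proof. by case/skelP. Qed.

Lemma notin_skelP x : x \in NN T -> x \notin S ->
  exists v w, [/\ tooth_path T v w, x \in gamma v w & x != w].
Proof.
move=> xN; rewrite in_setD xN andbT negbK => /bigcupP[w wW].
rewrite in_setD1 /Vbar wW => /andP[xw /bigcupP[v]].
by rewrite mem_VV inE => vw xi; exists v, w.
Qed.

(** Delta is positive at the base, but at most 0 at every cell of a tooth other than its own base;
    so no other tooth passes through w. *)
Lemma tooth_base v w : tooth_path T v w -> w \in S.
Proof.
move=> tp; have [[_ vN wN _ _] h0 dv dvw _] := iffLR (tooth_pathP newtonT minT v w) tp.
apply/skelP; split=> // v' w' tp' wi; apply/eqP; apply: contraT => ww'.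
have [_] := tooth_interior tp' wi ww'; lra.
Qed.

Lemma tooth_nskel v w x : tooth_path T v w -> x \in gamma v w -> x != w ->
  x \notin S.
Proof. by move=> tp xi xw; apply/negP => /skelP[_ /(_ v w tp xi) E]; rewrite E eqxx in xw. Qed.

Lemma tooth_branch v w x : tooth_path T v w -> x \in NN T -> x != w ->
  step w x = step w v -> x \in gamma v w.
Proof. by case/(tooth_pathP newtonT minT) => ch *; exact: chain_branch ch _ _ _. Qed.

(** A path that leaves the skeleton does so at the base of a tooth, and by [chain_branch] all of N
    beyond lies in that tooth: it can never come back to z. *)
Lemma skel_step u z : u \in S -> z \in S -> u != z -> step u z \in S.
Proof.
move=> uS zS uz; have uN := skel_NN uS; have zN := skel_NN zS.
have uy := step_adj (T := T) uz; have yN := step_NN newtonT minT uN zN uz.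
apply: contraT => yS; have [v [w [tp yi yw]]] := notin_skelP yN yS.
have [ch _ _ _ _] := iffLR (tooth_pathP newtonT minT v w) tp.
have uny : u \in nbrs T (step u z) by rewrite nbrsP uN adjC.
have ui := chain_nbr newtonT minT ch yi yw uny.
have uw : u = w by case/skelP: uS => _ /(_ v w tp ui).
have syv : step w v = step w z.
  by rewrite -uw in yi yw *; apply: mem_gamma_adj; rewrite // mem_gammaC.
have zw : z != w by rewrite -uw eq_sym.
have := tooth_nskel tp (tooth_branch tp zN zw (esym syv)) zw.
by rewrite zS.
Qed.

Lemma skel_gamma u z w : u \in S -> z \in S -> w \in gamma u z -> w \in S.
Proof.
move=> + zS; elim/(gamma_ind (T := T) (y := z)): u => [|u uz IH] uS.
  by rewrite gammaxx inE => /eqP->.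
rewrite gammaE // in_cons => /orP[/eqP->//|]; apply: IH; exact: skel_step.
Qed.

(* Neighbours in the skeleton and base edges of teeth; Dbar gathers Delta over
   a vertex of the skeleton and its teeth. *)
Definition snb v : {set X} := nbrs T v :&: S.
Definition tnb v : {set X} := nbrs T v :\: S.

Lemma eps_split v : eps T v = (#|snb v| + #|tnb v|)%N.
Proof. by rewrite /eps -(cardsID S). Qed.

Lemma tnbP v : v \in S -> tnb v = [set step v t | t in VV T v].
Proof.
move=> vS; have vN := skel_NN vS; apply/setP => y; apply/idP/imsetP => [|[t]].
  rewrite in_setD nbrsP => /and3P[yS yN vy].
  have [t [w [tp yi yw]]] := notin_skelP yN yS.
  have [ch _ _ _ _] := iffLR (tooth_pathP newtonT minT t w) tp.
  have vny : v \in nbrs T y by rewrite nbrsP vN adjC.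
  have vi := chain_nbr newtonT minT ch yi yw vny.
  have vw : v = w by case/skelP: vS => _ /(_ t w tp vi).
  exists t; first by rewrite mem_VV vw.
  by rewrite -vw in yi; apply/esym/mem_gamma_adj; rewrite // mem_gammaC.
rewrite mem_VV => tp ->; have [[tv tN _ _ _] _ _ _ _] := iffLR (tooth_pathP newtonT minT t v) tp.
have vt : v != t by rewrite eq_sym.
rewrite in_setD step_nbrs // andbT; apply: tooth_nskel tp _ _; last exact: step_neq.
by rewrite mem_gammaC gammaE // in_cons mem_gammal orbT.
Qed.

(** Two teeth entering v by the same edge lie on one chain, which has only one cell of valency 1 in
    N besides possibly its base. *)
Lemma VV_inj v : {in VV T v &, injective (step v)}.
Proof.
move=> t t'; rewrite !mem_VV => tp tp' E.
have [ch _ _ _ _] := iffLR (tooth_pathP newtonT minT t v) tp.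
have [[t'v t'N _ e' _] _ _ _ _] := iffLR (tooth_pathP newtonT minT t' v) tp'.
have t'i := chain_branch newtonT minT ch t'N t'v (esym E).
case: ch => _ _ _ _ h; apply/eqP; apply: contraT => tt'.
by have := h t' t'i; rewrite e' eq_sym tt' t'v => /(_ isT isT).
Qed.

Lemma card_tnb v : v \in S -> #|tnb v| = #|VV T v|.
Proof. by move=> vS; rewrite tnbP // card_in_imset //; exact: VV_inj. Qed.

Definition Dbar v : rat := Delta T v + \sum_(t in VV T v) Delta T t.

Lemma Dbar_ge v : v \in S -> Delta T v + \sum_(y in tnb v) (1 - cc v y) <= Dbar v.
Proof.
move=> vS; rewrite lerD2l tnbP // big_imset /=; last exact: VV_inj.
apply: ler_sum => t; rewrite mem_VV => tp.
have [ch h0 _ _ _] := iffLR (tooth_pathP newtonT minT t v) tp.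
exact: chain_cc ch h0.
Qed.

Lemma VV_NN v t : t \in VV T v -> t \in NN T /\ t \notin S.
Proof.
rewrite mem_VV => tp; have [[tv tN _ _ _] _ _ _ _] := iffLR (tooth_pathP newtonT minT t v) tp.
by split=> //; apply: tooth_nskel tp _ tv; exact: mem_gammal.
Qed.

Lemma VV_le0 v t : t \in VV T v -> Delta T t <= 0.
Proof. by rewrite mem_VV => /(tooth_pathP newtonT minT)[]. Qed.

(* A tooth starting at several bases would be counted several times on the
   left, which only helps as Delta is nonpositive there. *)
Lemma sum_Dbar_le : \sum_(v in S) Dbar v <= DeltaS T (NN T).
Proof.
rewrite /DeltaS [X in _ <= X](big_setID S) /= big_split /=.
have -> : NN T :&: S = S by apply/setIidPr/subsetP => x; exact: skel_NN.
rewrite lerD2l (exchange_big_dep (mem (NN T :\: S))) /=; last first.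
  by move=> v t vS /VV_NN[tN tS]; rewrite in_setD tN tS.
apply: ler_sum => x; rewrite in_setD => /andP[xS xN].
case: (pickP (fun v => (v \in S) && (x \in VV T v))) => [v /andP[vS xV]|h].
  rewrite (bigD1 v) ?vS ?xV //= gerDl; apply: sumr_le0 => u /andP[/andP[_ xu] _].
  exact: VV_le0 xu.
rewrite big_pred0 //; have [v [w [tp xi xw]]] := notin_skelP xN xS.
have [_ h0 _ _ _] := iffLR (tooth_pathP newtonT minT v w) tp.
case: (eqVneq x v) => [xv|xv]; last by rewrite h0.
by move: (h w); rewrite (tooth_base tp) mem_VV xv tp.
Qed.

(** N_v times the contribution of the tooth edges to R(v, A). *)
Definition Ttot v : rat := \sum_(y in tnb v) (N v - cc v y).

Lemma mult_gt0 v : v \in NN T -> 0 < N v.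
Proof. by move=> vN; rewrite ltr0z NN_mult. Qed.

Lemma mult_ge1 v : v \in NN T -> 1 <= N v.
Proof. by move=> vN; rewrite (ler_int _ 1) -gtz0_ge1 NN_mult. Qed.

Lemma RR0_ge0 v : v \in NN T -> 0 <= N v * RR T v set0.
Proof.
move=> vN; rewrite (mult_RR newtonT minT) //; apply: addr_ge0.
  apply: sumr_ge0 => x xD; have [-> k0 _] := dic_mult newtonT minT vN xD.
  rewrite rmorphM /= -[(degree T x)%:R]mul1r pmulrn -mulrBl mulr_ge0 // ?ler0z //.
  by rewrite subr_ge0 (ler_int _ 1) -gtz0_ge1.
have a1 : 1 <= (acoef T v)%:~R :> rat by rewrite (ler_int _ 1) acoef_ge1 // NN_vertex.
rewrite subr_ge0 ler_pdivrMr; last by apply: lt_le_trans a1.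
by rewrite ler_peMr // ltW // mult_gt0.
Qed.

(** The condition z_(n-1) > z_n in the definition of Gamma makes the last edge of a tooth go up from
    its base, so [up_cc_half] applies. *)
Lemma tnb_half v y : v \in S -> y \in tnb v -> N v / 2 <= N v - cc v y.
Proof.
move=> vS; rewrite tnbP // => /imsetP[t]; rewrite mem_VV => tp ->.
have [[tv tN vN _ _] _ _ _ uv] := iffLR (tooth_pathP newtonT minT t v) tp.
have := up_cc_half newtonT minT vN (step_NN newtonT minT vN tN _) uv.
by rewrite eq_sym => /(_ tv); lra.
Qed.

Lemma Ttot_ge v : v \in S -> #|tnb v|%:R * (N v / 2) <= Ttot v.
Proof.
move=> vS; rewrite /Ttot mulrC mulr_natr -sumr_const.
by apply: ler_sum => y; exact: tnb_half.
Qed.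

(** [Delta_RR] with skeleton valency in place of eps: for each tooth, N_v - 1 and the bound 1 - c(v,
    e) of [Dbar_ge] add up to N_v - c(v, e). *)
Lemma Dbar_ge_mult v : v \in S ->
  (#|snb v|%:R - 2) * (N v - 1) + N v * RR T v set0 + Ttot v <= Dbar v.
Proof.
move=> vS; apply: le_trans (Dbar_ge vS); have vN := skel_NN vS.
rewrite (Delta_RR newtonT minT) // /Ttot eps_split natrD !sumrB !sumr_const.
rewrite -(mulr_natr (N v)) -/(1%:R *+ _).
move: (#|snb v|%:R : rat) (#|tnb v|%:R : rat) (N v) (RR T v set0) (\sum_(_ in _) _).
by move=> s t n r c; rewrite le_eqVlt; apply/orP; left; apply/eqP; ring.
Qed.

Lemma Dbar_int v : v \in S -> exists k : int, Dbar v = k%:~R.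
Proof.
move=> vS; have [k kE] := Delta_int newtonT (skel_NN vS).
rewrite /Dbar kE; elim/big_ind: _ => [|a b [m am] [n bn]|t /VV_NN[tN _]].
- by exists k; rewrite addr0.
- exists (m + n - k); rewrite rmorphB rmorphD /= -am -bn; ring.
by have [m ->] := Delta_int newtonT tN; exists (k + m); rewrite rmorphD.
Qed.

Lemma Dbar_gt0_ge1 v : v \in S -> 0 < Dbar v -> 1 <= Dbar v.
Proof. by move=> /Dbar_int[k ->]; rewrite ltr0z (ler_int _ 1) -gtz0_ge1. Qed.

Lemma VV0_Dbar v : v \in S -> #|tnb v| = 0%N -> Dbar v = Delta T v.
Proof.
move=> vS; rewrite card_tnb // => /eqP; rewrite cards_eq0 => /eqP E.
by rewrite /Dbar E big_set0 addr0.
Qed.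

(** With a single tooth, Dbar is the total of Delta on that path, positive by definition of Gamma;
    integrality does the rest. *)
Lemma VV1_Dbar v : v \in S -> #|tnb v| = 1%N -> 1 <= Dbar v.
Proof.
move=> vS; rewrite card_tnb // => /eqP/cards1P[t E]; apply: Dbar_gt0_ge1 => //.
have : t \in VV T v by rewrite E inE.
rewrite mem_VV /Dbar E big_set1 addrC => tp.
by have [] := iffLR (tooth_pathP newtonT minT t v) tp.
Qed.

(** Without a tooth, v is a leaf of N outside Omega, so Delta(v) > 0. One tooth is [VV1_Dbar]. Two
    teeth give at least -(N_v - 1) + 2 (N_v / 2) = 1. *)
Lemma skel_leaf v : v \in S -> v \notin Omega T -> #|snb v| = 1%N -> 1 <= Dbar v.
Proof.
move=> vS vO s1; have vN := skel_NN vS; have e := eps_split v; rewrite s1 in e.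
case t0 : #|tnb v| e => [|[|t]] e; last first.
- have := Dbar_ge_mult vS; have := RR0_ge0 vN; have := mult_ge1 vN.
  have := Ttot_ge vS; rewrite s1 t0 => h1 h2 h3 h4.
  have : 2 <= t.+2%:R :> rat by rewrite (ler_nat _ 2).
  nra.
- exact: VV1_Dbar.
apply: Dbar_gt0_ge1 => //; rewrite VV0_Dbar // ltNge; apply: contra vO => dv.
rewrite in_setD; apply/andP; split; last by rewrite inE vN e eqxx dv.
by apply/bigcupP => -[w wW /VV_NN[]]; rewrite vS.
Qed.

(* At most one neighbour lies below v, and an upward one forces N_v > 1. *)
Lemma mult_ge2 v : v \in NN T -> (1 < eps T v)%N -> 2 <= N v.
Proof.
move=> vN /card_gt1P[x [y [xv yv xy]]].
suff [w wv upw] : exists2 w, w \in nbrs T v & up v w.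
  have wN : w \in NN T by move: wv; rewrite nbrsP => /andP[].
  by have [_] := up_gap newtonT minT vN wN upw; rewrite (ler_int _ 2); clear; lia.
have adjv a : a \in nbrs T v -> adj v a by rewrite nbrsP => /andP[].
case: (boolP (up v x)) => [ux|ux]; first by exists x.
exists y => //; apply: up_other (adjv y yv) _; last by rewrite eq_sym; exact: xy.
by rewrite upC ?ux // adjC adjv.
Qed.

Lemma skel_branching v : v \in S -> (2 < #|snb v|)%N ->
  N v - 1 <= Dbar v /\ 1 <= Dbar v.
Proof.
move=> vS s3; have vN := skel_NN vS.
have n2 : 2 <= N v by apply: mult_ge2 => //; rewrite eps_split; lia.
suff h : N v - 1 <= Dbar v by split=> //; lra.
have := Dbar_ge_mult vS; have := RR0_ge0 vN; have := Ttot_ge vS.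
have : 3 <= #|snb v|%:R :> rat by rewrite (ler_nat _ 3).
have : 0 <= #|tnb v|%:R * (N v / 2) by rewrite mulr_ge0 // divr_ge0 // ltW // mult_gt0.
nra.
Qed.

Lemma skel_Dbar_ge0 v : v \in S -> (1 < #|snb v|)%N -> 0 <= Dbar v.
Proof.
move=> vS s2; have vN := skel_NN vS.
have := Dbar_ge_mult vS; have := RR0_ge0 vN; have := Ttot_ge vS.
have : 2 <= #|snb v|%:R :> rat by rewrite (ler_nat _ 2).
have : 0 <= #|tnb v|%:R * (N v / 2) by rewrite mulr_ge0 // divr_ge0 // ltW // mult_gt0.
have := mult_ge1 vN; nra.
Qed.

End Skeleton2.

(** * Orientation towards a vertex of the skeleton *)


Section Orient.
Context {X : finType} (T : decorated_tree X).
Context (newtonT : newton_tree T) (minT : minimally_complete T).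
Implicit Types (t x y u v w z : X) (e f g : {set X}) (s : seq X).

Notation adj := (adj T).
Notation step := (step T).
Notation cc := (cc T).
Notation N v := ((mult T v)%:~R : rat).
Notation S := (skeleton T).
Notation snb := (snb T).
Notation tnb := (tnb T).
Notation Dbar := (Dbar T).

(** Each summand 1 - 1/k_x or 1 - 1/a_v is 0 or at least 1/2. *)
Lemma RR0_half v : v \in NN T -> N v * RR T v set0 != 0 ->
  N v / 2 <= N v * RR T v set0.
Proof.
move=> vN; rewrite (mult_RR newtonT minT) //; have n0 := mult_gt0 vN.
have a1 := acoef_ge1 newtonT (NN_vertex vN).
have term x : x \in dics T v -> 0 <= N v - (degree T x)%:R /\
    ((degree T x)%:R != N v -> N v / 2 <= N v - (degree T x)%:R).
  move=> xD; have [E k0 d0] := dic_mult newtonT minT vN xD.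
  have d1 : 0 < (degree T x)%:R :> rat by rewrite ltr0n.
  case: (kdet T x) E k0 => // k E k0.
  have {}E : N v = k%:R * (degree T x)%:R by rewrite E rmorphM /= -pmulrn.
  split; last by move=> dN; have := multiple_half n0 d1 E dN; lra.
  have k1 : 1 <= k%:R :> rat by rewrite ler1n.
  rewrite E; nra.
have aterm : 0 <= N v - N v / (acoef T v)%:~R /\
    (acoef T v != 1 -> N v / 2 <= N v - N v / (acoef T v)%:~R).
  have [a2|->] : 2 <= acoef T v \/ acoef T v = 1 by clear -a1; lia.
    have {}a2 : 2 <= (acoef T v)%:~R :> rat by rewrite (ler_int _ 2).
    have a0 : 0 < (acoef T v)%:~R :> rat by lra.
    have : N v / (acoef T v)%:~R <= N v / 2.
      by rewrite ler_pM2l // lef_pV2.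
    lra.
  by rewrite divr1; split; [lra | rewrite eqxx].
case: (pickP (fun x => (x \in dics T v) && ((degree T x)%:R != N v))) => [x /andP[xD xN] _|h].
  rewrite (bigD1 x) //=.
  have : 0 <= \sum_(i in dics T v | i != x) (N v - (degree T i)%:R).
    by apply: sumr_ge0 => i /andP[/term[]].
  have [_ /(_ xN)] := term x xD; have [] := aterm; lra.
rewrite big1 => [|x xD]; last first.
  by move: (h x); rewrite xD /= => /negbFE/eqP->; rewrite subrr.
rewrite add0r => ne; have [_] := aterm; apply; apply: contraNneq ne => ->.
by rewrite divr1 subrr.
Qed.

Section Target.
Context (z : X) (zS : z \in S).

Notation U := (S :\ z).

Definition cz u : rat := cc u (step u z).

(* The condition on intermediate vertices in the definition of combs, for
   pairs (v, e_v) directed towards z. *)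
Definition linked v : bool :=
  ((eps T v == 2%N) && (RR T v [set [set v; step v z]] < 1)) ||
  [&& eps T v == 3%N, RR T v [set [set v; step v z]] == 0 & tnb v != set0].

Lemma mem_U u : u \in U -> [/\ u \in S, u \in NN T & u != z].
Proof. by rewrite in_setD1 => /andP[uz uS]; split=> //; exact: skel_NN uS. Qed.

Lemma mem_snb v x : (x \in snb v) = adj v x && (x \in S).
Proof.
rewrite inE nbrsP; case: (boolP (x \in S)) => [xS|]; rewrite ?andbF // !andbT.
by rewrite (skel_NN xS).
Qed.

Lemma par_snb u : u \in U -> step u z \in snb u.
Proof.
by case/mem_U => uS _ uz; rewrite mem_snb step_adj // skel_step.
Qed.

Lemma child_snb u v : u \in U -> step u z = v -> u \in snb v.
Proof.
move=> uU E; have [uS _ uz] := mem_U uU; rewrite mem_snb uS andbT adjC -E.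
exact: step_adj.
Qed.

Lemma child_par u v : v != z -> u \in U -> step u z = v -> u != step v z.
Proof.
move=> vz /mem_U[_ _ uz] E; rewrite eq_sym -step_dich ?E //.
by have := step_adj (T := T) uz; rewrite E.
Qed.

Lemma snb_child v x : v \in S -> x \in snb v -> x != step v z -> x \in U /\ step x z = v.
Proof.
move=> vS; rewrite mem_snb => /andP[vx xS] xp.
have xz : x != z.
  by apply: contraNneq xp => E; rewrite -E step_adjE.
rewrite in_setD1 xz xS; split=> //; apply/eqP.
by rewrite step_dich 1?adjC // eq_sym.
Qed.

(** The child u and the successor towards z are two skeleton neighbours. In the case eps = 2 they
    are all of them; in the case eps = 3 the third neighbour is a tooth. *)
Lemma linked_snb u v : v \in U -> u \in U -> step u z = v -> linked v ->
  snb v = [set u; step v z].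
Proof.
move=> vU uU uv lv; have [vS vN vz] := mem_U vU.
have us := child_snb uU uv; have ps := par_snb vU; have up' := child_par vz uU uv.
have sub : [set u; step v z] \subset snb v by rewrite subUset !sub1set us ps.
apply/esym/eqP; rewrite eqEcard sub cards2 up' /=.
have := subset_leq_card sub; rewrite cards2 up' /=.
have := eps_split T v; case/orP: lv => [/andP[/eqP-> _]|/and3P[/eqP-> _]].
  by clear; lia.
by rewrite -card_gt0; clear; lia.
Qed.

(** [Delta_step] across {u, v}: apart from u, the neighbours of v are its successor towards z and
    tooth cells, whose terms are absorbed by Dbar. *)
Lemma linked_Dbar u v : v \in U -> u \in U -> step u z = v -> linked v ->
  cz v - cz u <= Dbar v.
Proof.
move=> vU uU uv lv; have E := linked_snb vU uU uv lv.
have [vS vN vz] := mem_U vU; have [uS uN uz] := mem_U uU.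
have uav : adj u v by rewrite -uv step_adj.
have := Delta_step newtonT minT uN vN uav; have := Dbar_ge newtonT minT vS.
have up' := child_par vz uU uv.
have -> : nbrs T v :\ u = step v z |: tnb v.
  apply/setP => x; rewrite in_setD1 in_setU1 [x \in tnb v]in_setD.
  have := in_setI x (nbrs T v) S; rewrite -/(snb v) E in_set2.
  case: (x \in S); rewrite ?andbT ?andbF /= ?orbF.
    by move=> <-; case: eqVneq => // ->; rewrite (negbTE up').
  by move/negbT; rewrite negb_or => /andP[-> /negbTE->].
rewrite big_setU1 /=; last first.
  by rewrite in_setD negb_and negbK; have := par_snb vU; rewrite mem_snb => /andP[_ ->].
rewrite /cz uv; lra.
Qed.

(** The first bound serves the greatest cell of a class, the second one [break_in_C0]. With three
    skeleton neighbours both follow from Dbar >= N_v - 1; with two, the failure of the comb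
    condition yields even c <= Dbar. *)
Lemma nlinked_Dbar v : v \in U -> ~~ linked v -> (1 < #|snb v|)%N ->
  1 <= Dbar v /\ cz v - 1 <= Dbar v.
Proof.
move=> vU nl s2; have [vS vN vz] := mem_U vU.
have := par_snb vU; rewrite mem_snb => /andP[vp /skel_NN pN].
have c0 : 0 < cz v := cc_gt0 newtonT minT vN pN vp.
have cN : cz v <= N v := cc_le_mult newtonT minT vN pN vp.
have n0 := mult_gt0 vN.
case: (ltnP 2 #|snb v|) => [s3|s2'].
  have [h1 h2] := skel_branching newtonT minT vS s3; split=> //; lra.
have {s2 s2'}s2 : #|snb v| = 2%N by apply/eqP; rewrite eqn_leq s2' s2.
suff h : cz v <= Dbar v.
  by split; [apply: Dbar_gt0_ge1 => //; lra | lra].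
have := Dbar_ge_mult newtonT minT vS; rewrite s2 subrr mul0r add0r.
have R0 := RR0_ge0 newtonT minT vN; have Tt := Ttot_ge newtonT minT vS.
have RE : N v * RR T v [set [set v; step v z]] = N v * RR T v set0 + (N v - cz v).
  exact: RR_set1.
have epsE := eps_split T v; rewrite s2 in epsE.
case t0 : #|tnb v| epsE Tt => [|[|t]] epsE Tt.
(* No tooth: R(v, {e_v}) >= 1 says precisely that N_v R(v, empty set) >= c. *)
- have : ~~ (RR T v [set [set v; step v z]] < 1).
    by move: nl; rewrite /linked epsE /= orbF.
  rewrite -leNgt -(ler_pM2l n0) mulr1 RE; lra.
(* One tooth, worth N_v / 2. If c = N_v, then R(v, empty set) is nonzero and adds another N_v / 2;
   otherwise c <= N_v / 2. *)
- have tn : tnb v != set0 by rewrite -card_gt0 t0.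
  have : N v * RR T v [set [set v; step v z]] != 0.
    apply: mulf_neq0; first by rewrite gt_eqF.
    by move: nl; rewrite /linked epsE tn /= andbT.
  rewrite RE => ne.
  case: (eqVneq (cz v) (N v)) => [cE|cNe].
    rewrite cE subrr addr0 in ne; have := RR0_half vN ne; lra.
  have [m _ mE] := cc_dvq_mult newtonT minT vp vN pN.
  have := multiple_half n0 c0 mE cNe; lra.
have : 2 <= t.+2%:R :> rat by rewrite (ler_nat _ 2).
nra.
Qed.

Definition has_child v := [exists u in U, step u z == v].

Lemma nchild_snb v : v \in U -> ~~ has_child v -> #|snb v| = 1%N.
Proof.
move=> vU nc; have [vS vN vz] := mem_U vU.
apply/eqP/cards1P; exists (step v z); apply/setP => x; rewrite in_set1.
apply/idP/eqP => [xs|->]; last exact: par_snb.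
apply/eqP; apply: contraNT nc => xp; have [xU xv] := snb_child vS xs xp.
by apply/existsP; exists x; rewrite xU xv eqxx.
Qed.

Lemma child_snb2 v : v \in U -> has_child v -> (1 < #|snb v|)%N.
Proof.
move=> vU /existsP[u /andP[uU /eqP uv]]; have [vS vN vz] := mem_U vU.
apply/card_gt1P; exists u, (step v z); split; first exact: child_snb.
  exact: par_snb.
exact: child_par.
Qed.

Lemma Dbar_ge0 v : v \in U -> v \notin Omega T -> 0 <= Dbar v.
Proof.
move=> vU vO; have [vS _ _] := mem_U vU; case: (boolP (has_child v)) => hc.
  by apply: skel_Dbar_ge0 => //; exact: child_snb2.
apply: (le_trans (@ler01 rat)); apply: skel_leaf => //; exact: nchild_snb.
Qed.

Lemma top_Dbar v : v \in U -> v \notin Omega T -> ~~ (linked v && has_child v) ->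
  1 <= Dbar v.
Proof.
move=> vU vO; have [vS _ _] := mem_U vU; case: (boolP (has_child v)) => hc.
  rewrite andbT => nl; by have [] := nlinked_Dbar vU nl (child_snb2 vU hc).
by move=> _; apply: skel_leaf => //; exact: nchild_snb.
Qed.

End Target.
End Orient.

(** * Combs *)


Section Combs.
Context {X : finType} (T : decorated_tree X).
Context (newtonT : newton_tree T) (minT : minimally_complete T).
Implicit Types (t x y u v w z : X) (e f g : {set X}) (s : seq X).

Notation adj := (adj T).
Notation step := (step T).
Notation gamma := (gamma T).
Notation N v := ((mult T v)%:~R : rat).
Notation S := (skeleton T).
Notation snb := (snb T).
Notation tnb := (tnb T).

Lemma gamma_prefix x y u v : v \in gamma x y -> u \in gamma x v -> u \in gamma x y.
Proof. by rewrite !(mem_gammaC T x); exact: mem_gamma_trans. Qed.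

Lemma gamma_total x y u v : u \in gamma x y -> v \in gamma x y ->
  u \in gamma v y \/ v \in gamma u y.
Proof.
elim/(gamma_ind (T := T) (y := y)): x => [|x xy IH].
  by rewrite gammaxx !mem_seq1 => /eqP-> /eqP->; left; exact: mem_gammal.
rewrite gammaE // !(in_cons x) => /orP[/eqP->|ui] /orP[/eqP->|vi].
- by left; exact: mem_gammal.
- by right; rewrite gammaE // in_cons vi orbT.
- by left; rewrite gammaE // in_cons ui orbT.
- exact: IH.
Qed.

Lemma mem_edgesN v w : adj v w -> v \in NN T -> w \in NN T ->
  [set v; w] \in edgesN T v.
Proof. by move=> vw vN wN; rewrite inE set2_incident vw subUset !sub1set vN. Qed.

Section Target.
Context (z : X) (zS : z \in S).

Notation U := (S :\ z).
Notation toward := (toward T z).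
Notation cz := (cz T z).
Notation linked := (linked T z).

Lemma towardE u : u != z -> toward u = (u, [set u; step u z]).
Proof. by move=> uz; rewrite /Defs.toward gammaE // (gamma_cons T (step u z)). Qed.

Lemma cnum_toward u : u != z -> cnum T (toward u) = cz u.
Proof. by move=> uz; rewrite towardE. Qed.

Lemma toward_PP u : u \in U -> toward u \in PP T.
Proof.
move=> uU; have [uS uN uz] := mem_U uU.
rewrite inE towardE //= uN mem_edgesN ?step_adj // skel_NN //.
exact: (skel_step newtonT minT).
Qed.

(** Among pairs directed towards z, smaller means closer to z: the greatest element of a class is
    its farthest cell. *)
Lemma prec_toward u v : u != z -> v != z ->
  prec T (toward v) (toward u) = (v != u) && (v \in gamma u z).
Proof.
move=> uz vz; rewrite /prec !towardE //= !mem_path_edges ?step_adj //.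
rewrite mem_gammar mem_gammal /=; apply/andP/andP => -[].
  move=> su sv; have vu : v != u.
    by apply: contraTneq su => ->; rewrite gammaxx inE step_neq.
  split=> //; apply: step_between => //; apply: contraNneq sv => <-.
  by rewrite gammaE // in_cons mem_gammal orbT.
move=> vu vi; split.
  rewrite mem_gammaC -(step_prefix vi vu) gammaE 1?eq_sym //.
  by rewrite in_cons mem_gammal orbT.
apply/negP => sv; have := between_step vi vu vz.
by rewrite (mem_gamma_adj (step_adj vz) sv) eqxx.
Qed.

Lemma preceq_toward u v : u != z -> v != z ->
  preceq T (toward v) (toward u) = (v \in gamma u z).
Proof.
move=> uz vz; rewrite /preceq prec_toward //; case: (eqVneq v u) => [->|vu] /=.
  by rewrite eqxx mem_gammal.
by case: eqP => // -[E]; rewrite E eqxx in vu.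
Qed.

(** A pair of P lying between two pairs directed towards z is itself directed towards z. The comb
    condition, which ranges over all of P, therefore concerns only cells of one path. *)
Lemma between_toward u v r : u != z -> v != z -> r \in PP T ->
  prec T r (toward u) -> preceq T (toward v) r ->
  exists w, [/\ r = toward w, w != u, w \in gamma u z & v \in gamma w z].
Proof.
case: r => w g uz vz; rewrite inE /= => /andP[wN].
rewrite inE => /andP[/edge_set2[w' ww' ->] _] pru.
rewrite /preceq => /orP[/eqP E|].
  exists v; rewrite E mem_gammal; move: pru; rewrite -E prec_toward // => /andP[-> ->].
  by [].
rewrite /prec towardE //= !mem_path_edges ?step_adj // mem_gammar mem_gammal /=.
case/andP=> w'i si.
have wv : w != v.
  apply: contraTneq w'i => wv; rewrite wv gammaxx inE -wv.
  exact: adj_neq ww'.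
have ns : step v w != step v z.
  apply: contraNneq si => <-; rewrite gammaE 1?eq_sym //.
  by rewrite in_cons mem_gammal orbT.
have vi := step_between vz ns.
have wz : w != z.
  by apply: contraTneq vi => ->; rewrite gammaxx inE.
have swz : step w z = w'.
  rewrite -(step_prefix vi) 1?eq_sym //; apply: mem_gamma_adj => //.
  by rewrite mem_gammaC.
have E : (w, [set w; w']) = toward w by rewrite towardE // swz.
exists w; rewrite E; move: pru; rewrite E prec_toward // => /andP[-> ->].
by [].
Qed.

(* (u, e_u) is a comb over (v, e_v). *)
Definition clink u v : bool :=
  (v \in gamma u z) &&
  [forall w, [&& w \in gamma u z, w != u & v \in gamma w z] ==> linked w].

Lemma clinkP u v : reflect
  (v \in gamma u z /\
   forall w, w \in gamma u z -> w != u -> v \in gamma w z -> linked w)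
  (clink u v).
Proof.
apply: (iffP andP) => -[vi]; last first.
  by move=> h; split=> //; apply/forallP => w; apply/implyP => /and3P[]; exact: h.
move=> /forallP h; split=> // w wi wu vw.
by have := h w; rewrite wi wu vw.
Qed.

(** The last edge of a tooth has an end outside the skeleton, whereas the path from u to w and the
    edge from w towards z stay in it: both exclusions on g hold automatically. *)
Lemma tooth_edge u w : u \in U -> w \in S -> w != z ->
  [exists g in edgesN T w, [&& g \notin path_edges (gamma u w),
     g != [set w; step w z] & tooth T (w, g)]] = (tnb w != set0).
Proof.
move=> uU wS wz; have [uS uN uz] := mem_U uU; have wN := skel_NN wS.
apply/existsP/set0Pn => [[g /and4P[_ _ _ /andP[_ /existsP[t /andP[tp _]]]]]|[y yt]].
  exists (step w t); rewrite (tnbP newtonT minT) //; apply: imset_f.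
  by rewrite mem_VV.
have : y \in tnb w by []; rewrite in_setD nbrsP => /and3P[yS yN wy].
move: yt; rewrite (tnbP newtonT minT) // => /imsetP[t]; rewrite mem_VV => tp yE.
exists [set w; y]; rewrite mem_edgesN //=; apply/and3P; split.
- rewrite mem_path_edges // mem_gammar /=; apply: contra yS => yi.
  exact: skel_gamma yi.
- apply: contraNneq yS => E; rewrite (set2_inj wy (step_adj wz) E).
  exact: skel_step.
apply/andP; split; first by rewrite inE wN mem_edgesN.
apply/existsP; exists t; apply/andP; split; first exact: tp.
by apply/eqP; rewrite yE; apply: last_edge; exact: (tooth_neq newtonT minT tp).
Qed.

Lemma comb_clause u w (r := toward w) : u \in U -> w \in S -> w != z ->
  [|| (eps T r.1 == 2%N) && (RR T r.1 [set r.2] < 1)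
    | [&& eps T r.1 == 3%N, RR T r.1 [set r.2] == 0 &
        [exists g in edgesN T r.1,
          [&& g \notin path_edges (gamma (toward u).1 r.1), g != r.2
            & tooth T (r.1, g)]]]] = linked w.
Proof.
by move=> uU wS wz; rewrite /r (towardE wz) /linked -(tooth_edge uU wS wz).
Qed.

Lemma comb_toward u v : u \in U -> v \in U ->
  comb T (toward u) (toward v) = clink u v.
Proof.
move=> uU vU; have [uS uN uz] := mem_U uU; have [vS vN vz] := mem_U vU.
rewrite /comb !toward_PP // preceq_toward // 2!andTb; apply/andP/clinkP => -[vi].
  move=> /forallP h; split=> // w wi wu vw.
  have wz : w != z by apply: contraTneq vw => ->; rewrite gammaxx inE.
  have wS : w \in S by apply: skel_gamma wi.
  have wU : w \in U by rewrite in_setD1 wz.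
  have := h (toward w); rewrite comb_clause // toward_PP // prec_toward //.
  by rewrite preceq_toward // wi wu vw.
move=> h; split=> //; apply/forallP => r; apply/implyP => rP; apply/implyP => /andP[r1 r2].
have [w [-> wu wi vw]] := between_toward uz vz rP r1 r2.
have wz : w != z by apply: contraTneq vw => ->; rewrite gammaxx inE.
have wS : w \in S by apply: skel_gamma wi.
by rewrite comb_clause //; exact: h.
Qed.

Lemma clink_refl u : clink u u.
Proof.
apply/clinkP; split; first exact: mem_gammal.
by move=> w wi wu uw; rewrite (gamma_anti uw wi) eqxx in wu.
Qed.

Lemma clink_trans u v w : clink u v -> clink v w -> clink u w.
Proof.
move=> /clinkP[vi h1] /clinkP[wi h2]; apply/clinkP; split.
  exact: mem_gamma_trans vi wi.
move=> x xi xu wx; have [vx|xv] := gamma_total vi xi; first exact: h1.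
case: (eqVneq x v) => [xv'|xv']; last exact: h2.
by apply: h1 => //; rewrite xv' mem_gammal.
Qed.

Lemma clink_step u : u \in U -> step u z != z -> linked (step u z) -> clink u (step u z).
Proof.
move=> uU sz ls; have [uS uN uz] := mem_U uU; apply/clinkP; split.
  by rewrite gammaE // in_cons mem_gammal orbT.
move=> w; rewrite gammaE // in_cons => /orP[/eqP->|wi]; first by rewrite eqxx.
by move=> _ sw; rewrite -(gamma_anti sw wi).
Qed.

Lemma clink_above u v w : v \in gamma w z -> clink w u -> u \in gamma v z -> clink v u.
Proof.
move=> vw /clinkP[uw h] uv; apply/clinkP; split=> // x xi xv ux; apply: h => //.
  exact: mem_gamma_trans vw xi.
by apply: contraNneq xv => xw; apply/eqP; rewrite (gamma_anti vw) // -xw.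
Qed.

Lemma clink_below u v w : v \in gamma w z -> clink w u -> u \in gamma v z -> clink w v.
Proof.
move=> vw /clinkP[uw h] uv; apply/clinkP; split=> // x xi xw vx; apply: h => //.
exact: mem_gamma_trans vx uv.
Qed.

Definition ceq u v := clink u v || clink v u.

Lemma ceqC u v : ceq u v = ceq v u.
Proof. exact: orbC. Qed.

Lemma clink_down u v w : clink u v -> clink u w -> ceq v w.
Proof.
move=> uv uw; have /clinkP[vi _] := uv; have /clinkP[wi _] := uw.
have [h|h] := gamma_total vi wi; apply/orP; [right|left].
  exact: clink_above wi uv h.
exact: clink_above vi uw h.
Qed.

(** The case of transitivity that could fail by branching. Every cell strictly after v on the way to
    u is linked, hence has a single skeleton child by [linked_snb]; so the path of w can only join
    that of v at v or at w itself. *)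
Lemma clink_up_total u v w : u \in U -> v \in U -> w \in U -> clink v u -> clink w u ->
  v \in gamma w z \/ w \in gamma v z.
Proof.
move=> uU + wU vu /clinkP[uw hw]; have [uS uN uz] := mem_U uU.
have [wS wN wz] := mem_U wU.
elim/(gamma_ind (T := T) (y := z)): v vu => [|v vz IH] vu vU.
  by right; move: vU; rewrite in_setD1 eqxx.
have [vS vN _] := mem_U vU; have /clinkP[ui hv] := vu.
case: (eqVneq u v) => [<-|uv]; first by left.
have ui1 : u \in gamma (step v z) z by move: ui; rewrite gammaE // in_cons (negbTE uv).
have v1i : step v z \in gamma v z by rewrite gammaE // in_cons mem_gammal orbT.
have v1z : step v z != z by apply: contraTneq ui1 => ->; rewrite gammaxx inE.
have v1U : step v z \in U by rewrite in_setD1 v1z; exact: skel_step.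
have [h|h] := IH (clink_above v1i vu ui1) v1U; last first.
  by right; exact: mem_gamma_trans v1i h.
case: (eqVneq w (step v z)) => [->|wv1]; first by right.
have lv1 : linked (step v z) by apply: hv => //; exact: step_neq.
have v1w : step v z != w by rewrite eq_sym.
have xS : step (step v z) w \in snb (step v z).
  rewrite mem_snb step_adj //=; apply: skel_step => //; by have [] := mem_U v1U.
have xE := between_step h v1w v1z.
move: xS; rewrite (linked_snb newtonT minT zS v1U vU (erefl _) lv1) // in_set2 (negbTE xE) orbF.
move=> /eqP E; left; apply: gamma_prefix h _.
by rewrite mem_gammaC gammaE // in_cons E mem_gammal orbT.
Qed.

Lemma clink_up u v w : u \in U -> v \in U -> w \in U -> clink v u -> clink w u -> ceq v w.
Proof.
move=> uU vU wU vu wu; have /clinkP[uv _] := vu; have /clinkP[uw _] := wu.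
have [h|h] := clink_up_total uU vU wU vu wu; apply/orP; [right|left].
  exact: clink_below h wu uv.
exact: clink_below h vu uw.
Qed.

Lemma ceq_trans u v w : u \in U -> v \in U -> w \in U -> ceq u v -> ceq v w -> ceq u w.
Proof.
move=> uU vU wU /orP[uv|vu] /orP[vw|wv].
- by apply/orP; left; exact: clink_trans uv vw.
- exact: clink_up vU uU wU uv wv.
- exact: clink_down vu vw.
- by apply/orP; right; exact: clink_trans wv vu.
Qed.

Lemma comb_eq_toward u v : u \in U -> v \in U ->
  comb_eq T (toward u) (toward v) = ceq u v.
Proof. by move=> uU vU; rewrite /comb_eq !comb_toward. Qed.

Lemma OOP p : reflect (exists2 u, u \in U & p = toward u) (p \in OO T z).
Proof. exact: imsetP. Qed.

Lemma mem_OO u : u \in U -> toward u \in OO T z.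
Proof. by move=> uU; exact: imset_f. Qed.

Lemma comb_eq_equiv : {in OO T z & &, equivalence_rel (comb_eq T)}.
Proof.
move=> _ _ _ /OOP[u uU ->] /OOP[v vU ->] /OOP[w wU ->]; rewrite !comb_eq_toward //.
split; first by rewrite /ceq clink_refl.
move=> uv; apply/idP/idP; apply: ceq_trans => //.
by rewrite ceqC.
Qed.

Lemma OObar_partition : partition (OObar T z) (OO T z).
Proof. exact: equivalence_partitionP comb_eq_equiv. Qed.

Lemma OObarP C : C \in OObar T z -> exists2 u, u \in U &
  C = [set p in OO T z | comb_eq T (toward u) p].
Proof. by case/imsetP => _ /OOP[u uU ->] ->; exists u. Qed.

Lemma class_mem C u v : C \in OObar T z -> u \in U -> v \in U -> toward u \in C ->
  (toward v \in C) = ceq u v.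
Proof.
move=> /OObarP[w wU ->] uU vU; rewrite !inE !mem_OO // !comb_eq_toward //= => wu.
apply/idP/idP => [wv|uv]; last exact: ceq_trans wu uv.
by apply: ceq_trans wv => //; rewrite ceqC.
Qed.

Lemma class_sub C p : C \in OObar T z -> p \in C -> exists2 u, u \in U & p = toward u.
Proof. by case/OObarP => u uU ->; rewrite inE => /andP[/OOP]. Qed.

End Target.
End Combs.

(** * Classes *)


Section Classes.
Context {X : finType} (T : decorated_tree X).
Context (newtonT : newton_tree T) (minT : minimally_complete T).
Implicit Types (t x y u v w z : X) (e f g : {set X}) (s : seq X).

Notation step := (step T).
Notation gamma := (gamma T).
Notation S := (skeleton T).
Notation Dbar := (Dbar T).

Section Target.
Context (z : X) (zS : z \in S).

Notation U := (S :\ z).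
Notation toward := (toward T z).
Notation cz := (cz T z).
Notation linked := (linked T z).
Notation clink := (clink T z).
Notation ceq := (ceq T z).
Notation has_child := (has_child T z).

Lemma mem_gamma_U u v w : u \in U -> v != z -> w \in gamma u z -> v \in gamma w z -> w \in U.
Proof.
move=> /mem_U[uS _ _] vz wi vw; rewrite in_setD1 (skel_gamma newtonT minT uS zS wi) andbT.
by apply: contraTneq vw => ->; rewrite gammaxx inE.
Qed.

(** Excludes u and includes v when they differ: one cell for each difference of consecutive values
    of c in [telescope]. *)
Definition between u v : {set X} :=
  [set w in U | [&& w \in gamma u z, w != u & v \in gamma w z]].

Lemma mem_between u v w : (w \in between u v) =
  (w \in U) && [&& w \in gamma u z, w != u & v \in gamma w z].
Proof. by rewrite in_set. Qed.

Lemma telescope u v : u \in U -> v \in U -> clink u v ->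
  cz v - cz u <= \sum_(w in between u v) Dbar w.
Proof.
move=> + vU; elim/(gamma_ind (T := T) (y := z)): u => [|u uz IH] uU uv.
  by move: uU; rewrite in_setD1 eqxx.
have [vS vN vz] := mem_U vU; have [uS uN _] := mem_U uU.
have /clinkP[vi h] := uv.
case: (eqVneq v u) => [->|vu].
  rewrite subrr big_pred0 // => w; rewrite in_set; apply/negP => /and4P[_ wi wu uw].
  by rewrite (gamma_anti uw wi) eqxx in wu.
have u1i : step u z \in gamma u z by rewrite gammaE // in_cons mem_gammal orbT.
have vi1 : v \in gamma (step u z) z by move: vi; rewrite gammaE // in_cons (negbTE vu).
have u1U := mem_gamma_U uU vz u1i vi1.
have l1 : linked (step u z) by apply: h => //; exact: step_neq.
have := IH u1U (clink_above u1i uv vi1).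
have := linked_Dbar newtonT minT zS u1U uU (erefl _) l1.
have -> : between u v = step u z |: between (step u z) v.
  apply/setP => w; rewrite in_setU1 !mem_between.
  case: (eqVneq w (step u z)) => [->|wu1] /=.
    by rewrite u1i vi1 u1U step_neq.
  rewrite (gammaE uz) in_cons; case: (eqVneq w u) => [->|wu] //=.
  by rewrite (negbTE (notin_step uz)) !andbF.
rewrite big_setU1 /=; last by rewrite mem_between eqxx !andbF.
lra.
Qed.

Definition members (C : {set X * {set X}}) : {set X} := [set u in U | toward u \in C].

Lemma mem_members C u : (u \in members C) = (u \in U) && (toward u \in C).
Proof. by rewrite in_set. Qed.

Lemma class_sumE C (F : X -> rat) : C \in OObar T z ->
  \sum_(p in C) F p.1 = \sum_(u in members C) F u.
Proof.
move=> CO; have E : C = toward @: members C.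
  apply/setP => p; apply/idP/imsetP => [pC|[u]]; last by rewrite mem_members => /andP[_ uC] ->.
  have [u uU pE] := class_sub CO pC.
  by exists u => //; rewrite mem_members uU -pE.
by rewrite {1}E big_imset //= => u v _ _ /(congr1 fst).
Qed.

Section NonOmega.
Context (UO : forall v, v \in U -> v \notin Omega T).

(** A member farthest from z works: a child of a linked member belongs to the class by [clink_step]
    and is farther away. *)
Lemma exists_top C : C \in OObar T z ->
  exists2 u, u \in members C & ~~ (linked u && has_child u).
Proof.
move=> CO; have [u0 u0U CE] := OObarP CO.
have u0C : u0 \in members C.
  by rewrite mem_members u0U CE inE mem_OO // (comb_eq_toward newtonT minT) // /ceq clink_refl.
case: (arg_maxnP (fun u => size (gamma u z)) u0C) => u uC max; exists u => //.
apply/negP => /andP[lu /existsP[x /andP[xU /eqP xu]]].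
have : u \in members C by [].
rewrite mem_members => /andP[uU uC'].
have [xS _ xz] := mem_U xU; have [_ _ uz] := mem_U uU.
have cxu : clink x u by rewrite -xu; apply: clink_step; rewrite // xu.
have : x \in members C.
  by rewrite mem_members xU (class_mem newtonT minT zS CO uU xU uC') /ceq cxu orbT.
by move/max; rewrite (gammaE xz) xu /= ltnn.
Qed.

Lemma class_sum_ge1 C : C \in OObar T z -> 1 <= \sum_(p in C) Dbar p.1.
Proof.
move=> CO; rewrite class_sumE //; have [u uC tu] := exists_top CO.
have [/andP[uU _]] : (u \in U) && (toward u \in C) by rewrite -mem_members.
rewrite (bigD1 u) //=.
have := top_Dbar newtonT minT zS uU (UO uU) tu.
have : 0 <= \sum_(i in members C | i != u) Dbar i.
  apply: sumr_ge0 => i; rewrite mem_members => /andP[/andP[iU _] _].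
  exact: (Dbar_ge0 newtonT minT zS iU (UO iU)).
lra.
Qed.

Lemma between_sum C u v : C \in OObar T z -> u \in members C -> v \in U -> clink u v ->
  Dbar u + \sum_(w in between u v) Dbar w <= \sum_(p in C) Dbar p.1.
Proof.
move=> CO; rewrite class_sumE // => uC vU uv.
have [/andP[uU uC']] : (u \in U) && (toward u \in C) by rewrite -mem_members.
have [vS _ vz] := mem_U vU.
rewrite -big_setU1 /=; last by rewrite mem_between eqxx !andbF.
rewrite [X in _ <= X](big_setID (u |: between u v)) /=.
have -> : members C :&: (u |: between u v) = u |: between u v.
  apply/setIidPr; rewrite subUset sub1set uC; apply/subsetP => w.
  rewrite mem_between mem_members => /and4P[wU wi wu vw]; rewrite wU.
  rewrite (class_mem newtonT minT zS CO uU wU uC'); apply/orP; left.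
  exact: clink_below wi uv vw.
rewrite lerDl; apply: sumr_ge0 => i; rewrite in_setD mem_members => /and3P[_ iU _].
exact: (Dbar_ge0 newtonT minT zS iU (UO iU)).
Qed.

(** [telescope] bounds cdot(C) by Dbar on the cells after the greatest one. The greatest cell
    contributes 1 more, since otherwise it would be linked and have a child, a still greater
    member. *)
Lemma class_sum_cdot C : C \in OObar T z -> cdot T C + 1 <= \sum_(p in C) Dbar p.1.
Proof.
move=> CO; have c1 := class_sum_ge1 CO.
(* When an extremum is missing [cdot] defaults to 0 and [class_sum_ge1] suffices. *)
rewrite /cdot; case: pickP => [p /andP[pC /forallP pmax]|_]; last by rewrite add0r.
case: pickP => [p' /andP[p'C /forallP p'min]|_]; last by rewrite add0r.
have [u uU pE] := class_sub CO pC; have [v vU p'E] := class_sub CO p'C.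
have [uS _ uz] := mem_U uU; have [vS _ vz] := mem_U vU.
rewrite pE p'E !cnum_toward //.
have uC : u \in members C by rewrite mem_members uU -pE.
have vu : v \in gamma u z by have := pmax p'; rewrite p'C pE p'E preceq_toward.
have uv : clink u v.
  rewrite pE in pC; rewrite p'E in p'C.
  have := class_mem newtonT minT zS CO uU vU pC; rewrite p'C => /esym/orP[//|/clinkP[uv _]].
  by rewrite (gamma_anti uv vu) clink_refl.
apply: le_trans (between_sum CO uC vU uv).
have := telescope uU vU uv.
suff : 1 <= Dbar u by lra.
apply: (top_Dbar newtonT minT zS uU (UO uU)).
apply/negP => /andP[lu /existsP[x /andP[xU /eqP xu]]].
have [xS _ xz] := mem_U xU.
have cxu : clink x u by rewrite -xu; apply: clink_step; rewrite // xu.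
have xC : toward x \in C.
  rewrite pE in pC; rewrite (class_mem newtonT minT zS CO uU xU pC).
  by rewrite /ceq cxu orbT.
have := pmax (toward x); rewrite xC pE preceq_toward // => xi.
have /clinkP[ui _] := cxu.
by have := step_neq (T := T) xz; rewrite xu (gamma_anti ui xi) eqxx.
Qed.

End NonOmega.

Lemma Delta_total : Dbar z + \sum_(C in OObar T z) \sum_(p in C) Dbar p.1 <= DeltaS T (NN T).
Proof.
apply: le_trans (sum_Dbar_le newtonT minT); rewrite (big_setD1 z) //= lerD2l.
rewrite -(set_partition_big _ (OObar_partition newtonT minT zS)) /=.
by rewrite big_imset //= => u v _ _ /(congr1 fst).
Qed.

End Target.
End Classes.

(** * The set Omega *)


Section Main.
Context {X : finType} (T : decorated_tree X).
Context (newtonT : newton_tree T) (minT : minimally_complete T).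
Implicit Types (t x y u v w z : X) (e f g : {set X}) (s : seq X).

Notation adj := (adj T).
Notation step := (step T).
Notation gamma := (gamma T).
Notation root := (Defs.root T).
Notation up := (up T).
Notation cc := (cc T).
Notation N v := ((mult T v)%:~R : rat).
Notation S := (skeleton T).
Notation snb := (snb T).
Notation tnb := (tnb T).

Lemma OmegaP z : z \in Omega T ->
  [/\ z \in S, z \in NN T, eps T z = 1%N, Delta T z <= 0
    & forall w, ~ tooth_path T z w].
Proof.
rewrite in_setD inE => /andP[zV /and3P[zN /eqP e1 dz]].
have nt w : ~ tooth_path T z w.
  move=> tp; case/negP: zV; apply/bigcupP; exists w; last by rewrite mem_VV.
  by rewrite inE; apply/existsP; exists z.
split=> //; apply/skelP; split=> // v w tp zi; apply/eqP; apply: contraT => zw.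
have [[_ _ _ _ h] _ _ _ _] := iffLR (tooth_pathP newtonT minT v w) tp.
case: (eqVneq z v) => [zv|zv]; first by rewrite -zv in tp; case: (nt w).
by have := h z zi zv zw; rewrite e1.
Qed.

(** An edge of the skeleton lies on no path of Gamma: both of its ends would be the base. *)
Lemma snb_delta_star z : z \in S -> (#|snb z| <= delta_star T z)%N.
Proof.
move=> zS; rewrite -(card_in_imset (f := fun x => [set z; x])); last first.
  by move=> x y; rewrite !mem_snb => /andP[zx _] /andP[zy _]; exact: (set2_inj zx zy).
apply: subset_leq_card; apply/subsetP => e /imsetP[x]; rewrite mem_snb => /andP[zx xS] ->.
rewrite inE mem_edgesN ?skel_NN //=; apply/existsP => -[v /existsP[w /andP[tp]]].
rewrite mem_path_edges // => /andP[zi xi].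
have /skelP[_ /(_ v w tp zi) zw] := zS; have /skelP[_ /(_ v w tp xi) xw] := xS.
by have := adj_neq zx; rewrite zw xw eqxx.
Qed.

Lemma In_treeP z : z \in In_tree T -> z \in S /\ (#|snb z| <= 1)%N.
Proof.
rewrite /In_tree; case: ifP => _; last first.
  rewrite inE => /andP[zS d1]; split=> //; exact: leq_trans (snb_delta_star zS) d1.
by case/OmegaP => zS _ e1 _ _; split=> //; rewrite -e1 eps_split leq_addr.
Qed.

(** Induction from w down to the root. The cells already treated form a chain from w to y, so
    Delta(w) >= 1 - c >= 1 - N_y / 2 because the last edge goes up from y. As this chain is not a
    tooth, Delta(y) <= N_y / 2 - 1. But Delta(y) is at least N_y - 1 if eps(y) > 2, and at least N_y
    / 2 if eps(y) = 2 and R is nonzero. *)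
Lemma Omega_descend w y : w \in Omega T -> y \in gamma root w ->
  forall x, x \in gamma y w -> x != w ->
    eps T x = 2%N /\ Delta T x = 0 \/ x = root /\ eps T x = 1%N.
Proof.
case/OmegaP => wS wN e1 dw nt.
elim/(gamma_ind (T := T) (y := w)): y => [|y yw IH] yr.
  by move=> x; rewrite gammaxx inE => /eqP->; rewrite eqxx.
have yN := gamma_NN newtonT minT (root_NN newtonT) wN yr.
set x := step y w in IH.
have xy : adj y x := step_adj yw; have xN : x \in NN T := step_NN newtonT minT yN wN yw.
have xi : x \in gamma y w by rewrite gammaE // in_cons mem_gammal orbT.
have good := IH (mem_gamma_trans yr xi).
suff gy : eps T y = 2%N /\ Delta T y = 0 \/ y = root /\ eps T y = 1%N.
  by move=> a; rewrite gammaE // in_cons => /orP[/eqP->//|]; exact: good.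
have upyx : up y x.
  case: (eqVneq y root) => [yr'|yr']; first by rewrite yr'; apply: up_root; rewrite -yr'.
  have yr2 : y \in gamma w root by rewrite mem_gammaC.
  have ns := between_step yr2 yw yr'.
  by apply: up_other (up_step_root yr') xy ns.
have xny : x \in nbrs T y by rewrite nbrsP xN.
case: (eqVneq (eps T y) 1%N) => [ey|ey].
  right; split=> //; apply/eqP; apply: contraT => yr'.
  have yr2 : y \in gamma w root by rewrite mem_gammaC.
  have ns := between_step yr2 yw yr'.
  have rny := step_nbrs newtonT minT yN (root_NN newtonT) yr'.
  by move/eqP: ns; case; exact: eps1_uniq ey xny rny.
left.
have ch2 a : a \in gamma w y -> a != w -> a != y -> eps T a = 2%N /\ Delta T a = 0.
  move=> ai aw ay; have ai' : a \in gamma x w.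
    by move: ai; rewrite mem_gammaC gammaE // in_cons (negbTE ay).
  have [//|[_ e1a]] := good a ai' aw.
  have aN := gamma_NN newtonT minT wN yN ai.
  have aw1 := step_nbrs newtonT minT aN wN aw.
  have ay1 := step_nbrs newtonT minT aN yN ay.
  by have := between_step ai aw ay; rewrite (eps1_uniq e1a aw1 ay1) eqxx.
have wy : w != y by rewrite eq_sym.
have ch : chain T w y by split=> // a ai aw ay; have [] := ch2 a ai aw ay.
have ch0 a : a \in gamma w y -> a != w -> a != y -> Delta T a = 0.
  by move=> ai aw ay; have [] := ch2 a ai aw ay.
have dwy := chain_cc newtonT minT ch ch0.
have half := up_cc_half newtonT minT yN xN upyx.
have n0 := mult_gt0 yN.
have ntp : Delta T w + Delta T y <= 0.
  rewrite leNgt; apply/negP => dpos; apply: (nt y).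
  by apply/(tooth_pathP newtonT minT); split.
have e0 : (0 < eps T y)%N by apply/card_gt0P; exists x.
have DE := Delta_RR newtonT minT yN.
have R0 := RR0_ge0 newtonT minT yN; have n1 := mult_ge1 yN.
case: (ltnP 2 (eps T y)) => [e3|e2].
  have : 3 <= (eps T y)%:R :> rat by rewrite (ler_nat _ 3).
  nra.
have {e0 e2 ey}e2 : eps T y = 2%N by clear -e0 e2 ey; lia.
split=> //; rewrite e2 subrr mul0r add0r in DE.
apply/eqP; apply: contraT; rewrite DE => ne.
have := RR0_half newtonT minT yN ne; lra.
Qed.

(** Every cell between w and z lies on the path from w or from z to the root, so [Omega_descend]
    makes the whole path a chain; by [chain_branch] it fills N. *)
Lemma Omega_pair z w v : z \in Omega T -> w \in Omega T -> w != z ->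
  v \in NN T -> v != z -> v != w -> eps T v = 2%N /\ Delta T v = 0.
Proof.
move=> zO wO wz; have [zS zN ez _ _] := OmegaP zO; have [wS wN ew _ _] := OmegaP wO.
have good y : y \in gamma w z -> y != w -> y != z -> eps T y = 2%N /\ Delta T y = 0.
  move=> yi yw yz; have ns := between_step yi yw yz.
  have yN := gamma_NN newtonT minT wN zN yi.
  have yw1 := step_nbrs newtonT minT yN wN yw.
  have yz1 := step_nbrs newtonT minT yN zN yz.
  have e1 : eps T y <> 1%N by move=> e1; move/eqP: ns; case; exact: eps1_uniq e1 yw1 yz1.
  have : y \in gamma w root \/ y \in gamma z root.
    case: (eqVneq y root) => [->|yr]; first by left; exact: mem_gammar.
    case: (eqVneq (step y w) (step y root)) => [E|ne]; last by left; exact: step_between.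
    by right; apply: step_between => //; rewrite -E eq_sym.
  case; rewrite mem_gammaC => yr.
    by have [//|[_ /e1]] := Omega_descend wO yr (mem_gammal T y w) yw.
  by have [//|[_ /e1]] := Omega_descend zO yr (mem_gammal T y z) yz.
have ch : chain T w z by split=> // y yi yw yz; have [] := good y yi yw yz.
move=> vN vz vw; apply: good => //; apply: (chain_branch newtonT minT ch) => //.
have zv : z != v by rewrite eq_sym.
have zw : z != w by rewrite eq_sym.
by apply: eps1_uniq ez _ _; apply: (step_nbrs newtonT minT).
Qed.

(** One tooth is [VV1_Dbar]. With several, all neighbours of z in N lie above z, so z is the root,
    all its decorations are 1, and N_z is the sum of the [Bs] of its branches; hence the c(z, e) and
    the degrees d_x together add up to at most N_z. *)
Lemma singleton_skeleton z : S = [set z] -> (1 < #|NN T|)%N -> 0 < DeltaS T (NN T).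
Proof.
move=> SE N2; have zS : z \in S by rewrite SE set11.
have zN := skel_NN zS.
apply: lt_le_trans (sum_Dbar_le newtonT minT); rewrite SE big_set1.
have s0 : snb z = set0.
  apply/setP => x; rewrite [RHS]inE mem_snb SE in_set1.
  by apply/negP => /andP[zx /eqP xz]; have := adj_neq zx; rewrite xz eqxx.
have nE : nbrs T z = tnb z by rewrite -[LHS](setID _ S) -/(snb z) s0 set0U.
have epsE : eps T z = #|tnb z| by rewrite /eps nE.
have t0 : (0 < #|tnb z|)%N.
  have /card_gt1P[a [b [aN bN ab]]] := N2.
  have [x xN xz] : exists2 x, x \in NN T & z != x.
    by case: (eqVneq z a) => [za|za]; [exists b; rewrite // za | exists a].
  by rewrite -epsE; apply/card_gt0P; exists (step z x); exact: step_nbrs.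
case t1 : #|tnb z| t0 => [|[|t]] // _.
  by apply: lt_le_trans ltr01 _; exact: VV1_Dbar.
have upz y : y \in tnb z -> up z y.
  rewrite (tnbP newtonT minT) // => /imsetP[s]; rewrite mem_VV => tp ->.
  by have [] := iffLR (tooth_pathP newtonT minT s z) tp.
have zr : z = root.
  apply/eqP; apply: contraT => zr.
  have : step z root \in tnb z.
    by rewrite -nE; apply: step_nbrs => //; exact: root_NN.
  have pz := up_step_root zr; have zp : adj z (step z root) by exact: step_adj.
  by move/upz; rewrite upC // pz.
have a1 : acoef T z = 1.
  apply: acoef1 => [|w zw]; first exact: NN_vertex.
  apply/negP => w0; have := acoef_gt1 newtonT minT zN zw w0.
  by rewrite (acoef0 newtonT (NN_vertex zN) zw w0) zr qn_root -?zr.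
have NE : N z = \sum_(w | adj z w) (Bs T z w)%:~R.
  rewrite mult_sum ?vertex_n1 ?NN_vertex // rmorph_sum; apply: eq_bigr => w zw.
  by rewrite /Qn big1 ?mul1r // => b /andP[zb _]; rewrite zr qn_root // -zr.
have B0 w : adj z w -> 0 <= (Bs T z w)%:~R :> rat.
  move=> zw; rewrite ler0z; have upzw : up z w by rewrite zr; apply: up_root; rewrite -zr.
  by have [] := Bs_pos newtonT zw upzw.
have dD x : x \in dics T z -> x \notin nbrs T z.
  by rewrite mem_dics => /andP[/dic_nNN xN _]; rewrite nbrsP (negbTE xN).
have le : \sum_(y in nbrs T z) cc z y + \sum_(x in dics T z) (degree T x)%:R <= N z.
  rewrite NE [X in _ <= X](bigID (mem (nbrs T z))) /= [X in _ <= _ + X](bigID (mem (dics T z))) /=.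
  apply: lerD.
    rewrite [X in _ <= X](eq_bigl (mem (nbrs T z))) => [|y /=]; last first.
      by rewrite nbrsP; case: (y \in NN T); rewrite ?andbF //= andbb.
    apply: ler_sum => y yn; have : y \in nbrs T z := yn.
    rewrite nbrsP => /andP[yN zy]; have [h _] := cc_dvq_Bs newtonT minT zy zN yN.
    apply: dvq_le h; first exact: cc_gt0.
    by rewrite ltr0z; apply: (Bs_gt0 newtonT (NN_vertex yN)); apply: upz; rewrite -nE.
  rewrite -[X in X <= _]addr0; apply: lerD; last first.
    by apply: sumr_ge0 => w /andP[/andP[zw _] _]; exact: B0.
  rewrite [X in _ <= X](eq_bigl (mem (dics T z))) => [|x /=]; last first.
    case xD : (x \in dics T z); rewrite ?andbF //= andbT dD // andbT.
    by move: xD; rewrite mem_dics => /andP[].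
  apply: ler_sum => x xD; have [xd zx _] := dicsP newtonT minT zN xD.
  rewrite (dic_Bs newtonT minT xd zx) rmorphM /= -pmulrn ler_peMl ?ler0n //.
  by rewrite (ler_int _ 1) (acoef_ge1 newtonT) // dic_vertex.
have := Dbar_ge newtonT minT zS; have DE := DeltaE minT zN.
rewrite nE in le; rewrite epsE t1 a1 divr1 subrr addr0 in DE.
rewrite sumrB sumr_const t1 => hD.
have T2 : 2 <= t.+2%:R :> rat by rewrite (ler_nat _ 2).
have n1 := mult_ge1 zN; rewrite sumrB sumr_const -[N z *+ _]mulr_natr in DE.
(* For n teeth and d dicritical neighbours the bounds combine to Dbar >= (n + d - 3) N_z + 2. *)
case: (ltnP 2 (t.+2 + #|dics T z|)) => [h3|h2].
  have : 3 <= t.+2%:R + #|dics T z|%:R :> rat by rewrite -natrD (ler_nat _ 3).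
  nra.
(* The case n = 2, d = 0 cannot occur: Delta(z) would be 0, while a tooth needs Delta(s) <= 0 <
   Delta(s) + Delta(z). *)
have /card_gt0P[s] : (0 < #|VV T z|)%N by rewrite -(card_tnb newtonT minT) // t1.
rewrite mem_VV => /(tooth_pathP newtonT minT)[_ _ ds dsz _].
have t2 : t = 0%N by clear -h2; lia.
have d0 : dics T z = set0 by apply/eqP; rewrite -cards_eq0; clear -h2; lia.
move: DE; rewrite d0 big_set0 cards0 t2 => DE; exfalso; clear -ds dsz DE; lra.
Qed.

End Main.

(** * The main inequality *)


Section Final.
Context {X : finType} (T : decorated_tree X).
Context (newtonT : newton_tree T) (minT : minimally_complete T).
Implicit Types (t x y u v w z : X) (e f g : {set X}) (s : seq X).

Notation adj := (adj T).
Notation step := (step T).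
Notation gamma := (gamma T).
Notation cc := (cc T).
Notation N v := ((mult T v)%:~R : rat).
Notation S := (skeleton T).
Notation snb := (snb T).
Notation tnb := (tnb T).
Notation Dbar := (Dbar T).

Section Endpoint.
Context (z z' : X) (zS : z \in S) (snbz : snb z = [set z']).

Notation U := (S :\ z).
Notation toward := (toward T z).
Notation cz := (cz T z).
Notation linked := (linked T z).
Notation clink := (clink T z).
Notation ceq := (ceq T z).
Notation has_child := (has_child T z).

Lemma endpoint_adj : adj z z' /\ z' \in S.
Proof.
have : z' \in snb z by rewrite snbz set11.
by rewrite mem_snb => /andP[].
Qed.

Lemma endpoint_U : z' \in U.
Proof. by have [zz' z'S] := endpoint_adj; rewrite in_setD1 z'S (adj_neq zz'). Qed.

Lemma endpoint_step u : u \in U -> step z u = z'.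
Proof.
case/mem_U => uS _ uz; apply/eqP; rewrite -in_set1 -snbz mem_snb.
have zu : z != u by rewrite eq_sym.
by rewrite step_adj // skel_step.
Qed.

Lemma endpoint_through u : u \in U -> z' \in gamma u z.
Proof.
move=> uU; have [_ _ uz] := mem_U uU.
by rewrite mem_gammaC gammaE 1?eq_sym // endpoint_step // in_cons mem_gammal orbT.
Qed.

Lemma ceq_endpoint u : u \in U -> ceq z' u = clink u z'.
Proof.
move=> uU; apply/idP/idP => [/orP[|//]|uz']; last by rewrite /ceq uz' orbT.
case/clinkP => uz' _; rewrite (gamma_anti uz' (endpoint_through uU)).
exact: clink_refl.
Qed.

Lemma C0E : C0 T z = [set p in OO T z | comb_eq T (toward z') p].
Proof.
have [zz' z'S] := endpoint_adj; rewrite /C0.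
case: pickP => [x /andP[xS zx]|/(_ z')]; last by rewrite z'S zz'.
have : x \in snb z by rewrite mem_snb zx xS.
by rewrite snbz in_set1 => /eqP->.
Qed.

Lemma C0_OObar : C0 T z \in OObar T z.
Proof. by rewrite C0E; apply: imset_f; apply: mem_OO; exact: endpoint_U. Qed.

Lemma mem_C0 u : u \in U -> (toward u \in C0 T z) = clink u z'.
Proof.
move=> uU; rewrite C0E inE mem_OO // (comb_eq_toward newtonT minT) ?endpoint_U //=.
exact: ceq_endpoint.
Qed.

(** z' lies on every path to z, and a linked cell passes membership in C0 on to its children; so C0
    spreads over the whole skeleton. *)
Lemma single_class :
  (forall v, v \in U -> has_child v -> clink v z' -> linked v) ->
  OObar T z = [set C0 T z].
Proof.
move=> h; have all u : u \in U -> clink u z'.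
  elim/(gamma_ind (T := T) (y := z)): u => [|u uz IH] uU.
    by move: uU; rewrite in_setD1 eqxx.
  have [uS _ _] := mem_U uU; case: (eqVneq (step u z) z) => [uz1|u1z].
    have : u \in snb z.
      by have := step_adj (T := T) uz; rewrite uz1 mem_snb uS adjC => ->.
    by rewrite snbz in_set1 => /eqP->; exact: clink_refl.
  have u1U : step u z \in U by rewrite in_setD1 u1z; exact: skel_step.
  have c1 := IH u1U; apply: clink_trans (c1); apply: clink_step => //.
  by apply: h => //; apply/existsP; exists u; rewrite uU /=.
have OOE u : u \in U -> [set p in OO T z | comb_eq T (toward u) p] = OO T z.
  move=> uU; apply/setP => p; rewrite inE; case: (boolP (p \in OO T z)) => //.
  case/OOP => v vU ->; rewrite (comb_eq_toward newtonT minT) //.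
  by apply: (ceq_trans newtonT minT zS uU endpoint_U vU); rewrite ?(ceqC _ _ u) ceq_endpoint ?all.
apply/setP => C; rewrite in_set1; apply/idP/eqP => [/OObarP[u uU ->]|->].
  by rewrite C0E !OOE ?endpoint_U.
exact: C0_OObar.
Qed.

Context (UO : forall v, v \in U -> v \notin Omega T).

Lemma classes_bound :
  #|OObar T z|%:R - 1 + \sum_(C in OObar T z :\ C0 T z) cdot T C <=
  \sum_(C in OObar T z :\ C0 T z) \sum_(p in C) Dbar p.1.
Proof.
rewrite (cardsD1 (C0 T z)) C0_OObar add1n -natr1 addrK addrC -sumr_const -big_split /=.
apply: ler_sum => C; rewrite in_setD1 => /andP[_ CO].
exact: (class_sum_cdot newtonT minT zS UO).
Qed.

Lemma Delta_total_C0 :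
  Dbar z + \sum_(p in C0 T z) Dbar p.1 +
  (#|OObar T z|%:R - 1 + \sum_(C in OObar T z :\ C0 T z) cdot T C) <= DeltaS T (NN T).
Proof.
apply: le_trans (Delta_total newtonT minT zS).
by rewrite (big_setD1 _ C0_OObar) /= -addrA !lerD2l; exact: classes_bound.
Qed.

(** Three bounds cancel: Dbar(z) >= 1 - c(z') because z is a leaf of N, Dbar(v) >= c(v) - 1 by
    [nlinked_Dbar], and the cells from v to z' give at least c(z') - c(v) by [telescope]. *)
Lemma break_in_C0 v : z \in Omega T -> v \in U -> has_child v -> clink v z' ->
  ~~ linked v -> 0 <= Dbar z + \sum_(p in C0 T z) Dbar p.1.
Proof.
move=> zO vU hc vz' nl; have [_ zN ez _ _] := OmegaP newtonT minT zO.
have [zz' z'S] := endpoint_adj; have z'N := skel_NN z'S.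
have vC : v \in members T z (C0 T z) by rewrite mem_members vU mem_C0.
have := between_sum newtonT minT zS UO C0_OObar vC endpoint_U vz'.
have := telescope newtonT minT zS vU endpoint_U vz'.
have [_] := nlinked_Dbar newtonT minT zS vU nl (child_snb2 newtonT minT zS vU hc).
have t0 : #|tnb z| = 0%N by have := eps_split T z; rewrite ez snbz cards1 => -[].
rewrite (VV0_Dbar newtonT minT zS t0).
have z'z : adj z' z by rewrite adjC.
have := Delta_step newtonT minT z'N zN z'z.
rewrite big1 => [|x]; last first.
  rewrite in_setD1 => /andP[xz' xn].
  have z'n : z' \in nbrs T z by rewrite nbrsP z'N.
  by rewrite (eps1_uniq ez xn z'n) eqxx in xz'.
have -> : cz z' = cc z' z by rewrite /cz step_adjE.
lra.
Qed.

End Endpoint.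

Lemma linked_Omega_pair z w v : z \in Omega T -> w \in Omega T -> w != z ->
  v \in S :\ z -> has_child T z v -> linked T z v.
Proof.
move=> zO wO wz vU hc; have [zS zN _ _ _] := OmegaP newtonT minT zO.
have [vS vN vz] := mem_U vU; have s2 := child_snb2 newtonT minT zS vU hc.
have [_ _ ew _ _] := OmegaP newtonT minT wO.
have vw : v != w.
  by apply: contraTneq s2 => ->; have := eps_split T w; rewrite ew; clear; lia.
have [e2 d0] := Omega_pair newtonT minT zO wO wz vN vz vw.
have := par_snb newtonT minT zS vU; rewrite mem_snb => /andP[vp /skel_NN pN].
apply/orP; left; rewrite e2 eqxx /= -(ltr_pM2l (mult_gt0 vN)) mulr1.
rewrite (RR_set1 newtonT minT) //.
have := Delta_RR newtonT minT vN; rewrite d0 e2 subrr mul0r add0r => <-.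
have := cc_gt0 newtonT minT vN pN vp; lra.
Qed.

End Final.

Theorem corollary6p20 (X : finType) (T : decorated_tree X)
    (newtonT : newton_tree T) (minT : minimally_complete T)
    (z : X) (zIn : z \in In_tree T) :
  (#|OObar T z|%:R + \sum_(C in OObar T z :\ C0 T z) cdot T C
     <= 1 + Num.max 0 (DeltaS T (NN T)))
  /\
  ((1 < #|NN T|)%N -> DeltaS T (NN T) <= #|OObar T z|%:R ->
     Omega T != set0).
Proof.
have [zS s1] := In_treeP newtonT minT zIn.
have max0 : 0 <= Num.max 0 (DeltaS T (NN T)) by rewrite le_max lexx.
have maxD : DeltaS T (NN T) <= Num.max 0 (DeltaS T (NN T)) by rewrite le_max lexx orbT.
(* If the skeleton is {z} there is no class, and the hypotheses of (b) contradict
   [singleton_skeleton]. *)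
have [U0|/set0Pn[u uU]] := eqVneq (skeleton T :\ z) set0.
  have O0 : OObar T z = set0.
    apply/setP => C; rewrite [RHS]inE; apply/negP => /OObarP[u].
    by rewrite U0 inE.
  rewrite O0 cards0 big_pred0 => [|C]; last by rewrite in_setD1 inE andbF.
  split; first lra.
  have SE : skeleton T = [set z] by rewrite -(setD1K zS) U0 setU0.
  move=> /(singleton_skeleton newtonT minT SE); lra.
have [uS uN uz] := mem_U uU.
have zu : z != u by rewrite eq_sym.
have z's : step T z u \in snb T z by rewrite mem_snb step_adj // skel_step.
have snbz : snb T z = [set step T z u].
  apply/eqP; rewrite eq_sym eqEcard sub1set z's cards1.
  by move: s1.
set z' := step T z u in z's snbz.
have [O0|On0] := eqVneq (Omega T) set0.
  have UO v : v \in skeleton T :\ z -> v \notin Omega T by move=> _; rewrite O0 inE.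
  have tot := Delta_total_C0 newtonT minT zS snbz UO.
  have c1 := class_sum_ge1 newtonT minT zS UO (C0_OObar snbz).
  have z1 : 1 <= Dbar T z.
    by apply: skel_leaf => //; rewrite ?O0 ?inE // snbz cards1.
  split; first lra.
  (* Each class contributes at least 1 and so does z, hence Delta(N) exceeds the number of
     classes. *)
  move=> _ le; exfalso.
  have := Delta_total newtonT minT zS.
  have : #|OObar T z|%:R <= \sum_(C in OObar T z) \sum_(p in C) Dbar T p.1.
    by rewrite -sumr_const; apply: ler_sum => C; exact: (class_sum_ge1 newtonT minT zS UO).
  lra.
split=> //.
have zO : z \in Omega T by move: zIn; rewrite /In_tree On0.
have single : (forall v, v \in skeleton T :\ z -> has_child T z v ->
    clink T z v z' -> linked T z v) ->
  #|OObar T z|%:R + \sum_(C in OObar T z :\ C0 T z) cdot T C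
     <= 1 + Num.max 0 (DeltaS T (NN T)).
  move/(single_class newtonT minT zS snbz) => ->.
  by rewrite setDv big_set0 cards1; lra.
have [/existsP[w /andP[wO wz]]|] := boolP [exists w, (w \in Omega T) && (w != z)].
  apply: single => v vU hc _; exact: (linked_Omega_pair newtonT minT zO wO wz).
rewrite negb_exists => /forallP h.
have UO v : v \in skeleton T :\ z -> v \notin Omega T.
  by case/mem_U => _ _ vz; have := h v; rewrite vz andbT.
(* Either some cell of C0 breaks the comb condition and pays for z, or C0 is the only class. *)
have [/existsP[v /and4P[vU hc vz' nl]]|] := boolP [exists v,
  [&& v \in skeleton T :\ z, has_child T z v, clink T z v z' & ~~ linked T z v]].
  have := break_in_C0 newtonT minT zS snbz UO zO vU hc vz' nl.
  have := Delta_total_C0 newtonT minT zS snbz UO; lra.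
rewrite negb_exists => /forallP nb; apply: single => v vU hc vz'.
by have := nb v; rewrite vU hc vz' /= negbK.
Qed.
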